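(* Let $d$ and $i$ be integers with $2\le i\le d/3$, let $j=\min\{\lfloor\frac{d-1}{2}\rfloor-1,\ d-2i\}$, and let $\Delta\in S(j,d-1)$. Then $g_i(\Delta)\geq 2\alpha(\Delta)$.
   Context: All simplicial complexes are finite. A face $\tau$ of a simplicial complex $\Delta$ has dimension $|\tau|-1$. A missing face of $\Delta$ is a set of vertices that is not a face but all of whose proper subsets are faces; its dimension is its cardinality minus $1$. The link of a face $\tau$ is $\mathrm{lk}(\tau)=\{\sigma\in\Delta:\sigma\cup\tau\in\Delta,\ \sigma\cap\tau=\emptyset\}$. A $(d-1)$-sphere means a $\mathbb{Z}/2\mathbb{Z}$-homology sphere: a pure $(d-1)$-dimensional simplicial complex such that for every face $\sigma$ (including $\emptyset$), $\mathrm{lk}(\sigma)$ has the $\mathbb{Z}/2\mathbb{Z}$-homology of a $(d-1-|\sigma|)$-dimensional sphere. $S(j,d-1)$ denotes the set of $(d-1)$-spheres all of whose missing faces have dimension at most $j$. $f_i$ is the number of $i$-faces ($f_{-1}=1$); $\sum_{i=0}^d f_{i-1}(t-1)^{d-i}=\sum_{i=0}^d h_i t^{d-i}$ defines the $h$-numbers; $g_0=1$, $g_j=h_j-h_{j-1}$ for $1\le j\le\lceil d/2\rceil$. $\alpha(\Delta)$ is the independence number of the graph ($1$-skeleton) of $\Delta$. *)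

(* Defs.v *)
From mathcomp Require Import all_boot all_order all_algebra.

Set Implicit Arguments.
Unset Strict Implicit.
Unset Printing Implicit Defensive.

Import GRing.Theory.

(* A family of sets is over an ambient finite type V; elements of V need not
   be vertices of the complex. *)
Definition simplicial_complex (V : finType) (D : {set {set V}}) : Prop :=
  set0 \in D /\ forall s t : {set V}, s \in D -> t \subset s -> t \in D.

Definition vertices (V : finType) (D : {set {set V}}) : {set V} :=
  [set v | [set v] \in D].

Definition link (V : finType) (D : {set {set V}}) (t : {set V}) :
    {set {set V}} :=
  [set s in D | (s :|: t \in D) && (s :&: t == set0)].

(* Faces are graded by cardinality: faces_of_card D k consists of the
   (k-1)-dimensional faces, so #|faces_of_card D k| is f_{k-1}. *)
Definition faces_of_card (V : finType) (D : {set {set V}}) (k : nat) :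
    {set {set V}} :=
  [set s in D | #|s| == k].

(* Matrix (acting on row vectors) of the mod 2 boundary map
   C_{k-1}(D) -> C_{k-2}(D) of the augmented chain complex, in the bases of
   faces.  For k = 0, \proper makes the matrix zero, as it should be. *)
Definition boundary (V : finType) (D : {set {set V}}) (k : nat) :
    'M['F_2]_(#|faces_of_card D k|, #|faces_of_card D k.-1|) :=
  (\matrix_(s, t)
     ((enum_val t : {set V}) \proper (enum_val s : {set V}))%:R)%R.

(* Dimension over Z/2 of the reduced homology group H~_{k-1}(D; Z/2), that is,
   of the quotient of cycles by boundaries. *)
Definition betti (V : finType) (D : {set {set V}}) (k : nat) : nat :=
  \rank (kermx (boundary D k)) - \rank (boundary D k.+1).

(* D has the Z/2-homology of the (m-1)-dimensional sphere.  Reduced homology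
   covers m = 0, the (-1)-dimensional sphere being the empty space. *)
Definition has_sphere_homology (V : finType) (m : nat) (D : {set {set V}}) :
    Prop :=
  forall k : nat, betti D k = (k == m).

(* All facets have dimension d-1. *)
Definition pure (V : finType) (d : nat) (D : {set {set V}}) : Prop :=
  forall s : {set V}, maxset [in D] s -> #|s| = d.

(* (d-1)-dimensional Z/2-homology spheres. *)
Definition homology_sphere (V : finType) (d : nat) (D : {set {set V}}) :
    Prop :=
  [/\ simplicial_complex D, pure d D &
      forall s : {set V}, s \in D -> has_sphere_homology (d - #|s|) (link D s)].

Definition missing_face (V : finType) (D : {set {set V}}) (s : {set V}) :
    Prop :=
  [/\ s \subset vertices D, s \notin D &
      forall t : {set V}, t \proper s -> t \in D].

(* The class S(j, d-1); the bound says that s has dimension at most j. *)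
Definition sphere_class (V : finType) (j d : nat) (D : {set {set V}}) : Prop :=
  homology_sphere d D /\
  forall s : {set V}, missing_face D s -> #|s| <= j.+1.

Definition hpoly (V : finType) (d : nat) (D : {set {set V}}) : {poly int} :=
  (\sum_(k < d.+1) ('X - 1) ^+ (d - k) *+ #|faces_of_card D k|)%R.

(* Meaningful for k <= d. *)
Definition hnum (V : finType) (d : nat) (D : {set {set V}}) (k : nat) : int :=
  ((hpoly d D)`_(d - k))%R.

Definition gnum (V : finType) (d : nat) (D : {set {set V}}) (k : nat) : int :=
  if k is k'.+1 then (hnum d D k - hnum d D k')%R else 1%R.

Definition adjacent (V : finType) (D : {set {set V}}) : rel V :=
  fun u v => (u != v) && ([set u; v] \in D).

Definition independent (V : finType) (D : {set {set V}}) (A : {set V}) : bool :=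
  (A \subset vertices D) && [forall u in A, forall v in A, ~~ adjacent D u v].

Definition independence_number (V : finType) (D : {set {set V}}) : nat :=
  \max_(A : {set V} | independent D A) #|A|.

(* Main.v *)
(* Let K be the field of rational functions over F_2 in the entries a_{r,w} of
   d+1 generic linear forms theta_0, ..., theta_d = omega in one variable per
   vertex. Reduced homology gives the Cohen-Macaulay property of the star of
   every face t, so that A(t) = K[st t]/(theta_0, ..., theta_(d-1)) is Artinian
   and, by the Dehn-Sommerville relations for links, a Poincare duality algebra
   for the degree map psi, a sum over facets of values at points. Differentiating
   psi with respect to the a_{r,w} turns psi(X^2J x_G) into the square of
   psi(X^J x_G x_L); hence multiplication by omega is injective on A(0) in degrees
   k with 2k < d, and g_i is the dimension of (A(0)/omega)_i.

   For a face t with at most i vertices, the bound d - 2i on the dimension of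
   missing faces makes (A(t)/omega)_s nonzero for s <= i: if omega maps A(t)_s
   onto A(t)_(s+1), then duality lets one divide any class of degree s by omega.
   Derivations killing the forms move such classes to multiples of x_t. For a
   vertex v, either two faces r u, r w containing v with r u w not a face, or the
   neighbourliness of the star of v (which has at least d+3 vertices, as its link
   has no large missing face), provide two classes in x_v K[X], independent in
   A(v)/omega. These 2|A| classes, v ranging over an independent set A, are
   independent in A(0)/omega, because x_u vanishes on the star of v. *)
Require Import Defs.
From Stdlib Require Import Classical.
From HB Require Import structures.
From mathcomp Require Import all_boot all_order all_algebra.
From mathcomp Require Import generic_quotient.
From mathcomp Require Import zify ring mpoly.

Set Implicit Arguments.
Unset Strict Implicit.
Unset Printing Implicit Defensive.

Import Order.TTheory GRing.Theory Num.Theory.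
Local Open Scope ring_scope.

(** * Homology spheres *)

(** Of the topology only the consequences collected in [sphere_facts] survive, over any field K
    containing F_2. All quotient rings are handled by one predicate, membership in the ideal
    generated by the first r forms and the monomials of bad support; the stars of all faces thus
    share one polynomial ring, and restriction to a smaller star is a weakening of the predicate.
    Modulo the first d-1 forms the ring of a facet F is a polynomial ring in theta_(d-1), hence
    visible through evaluation at the point z_F where theta_(d-1) is 1. Duality becomes
    orthogonality between spaces of functions on the facets. Characteristic 2 removes signs and
    makes squares constants of every derivation. The forms are generic in that the derivations by
    their coefficients exist; nonvanishing of minors follows from this. The numbers: 3i <= d gives
    2i <= d - |t| for |t| <= i, the range of the division argument; j <= d - 2i rules out
    exceptional bad monomials in it; the other bound on j provides d+3 vertices of a star, two with
    prescribed values and d+1 unknowns for d+1 linear equations. *)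

Definition down_closed (V : finType) (L : {set {set V}}) :=
  forall s t : {set V}, s \in L -> t \subset s -> t \in L.

Lemma minimal_nonface (V : finType) (D : {set {set V}}) (A : {set V}) : A \notin D ->
  exists G : {set V}, [/\ G \subset A, G \notin D & forall H : {set V}, H \proper G -> H \in D].
Proof.
move=> AD; have [G /minsetP[GD Gmin] GA] := minset_exists (P := fun B => B \notin D) AD.
exists G; split=> // H HG; apply: contraTT (HG) => HD.
by rewrite (Gmin H HD (proper_sub HG)) properxx.
Qed.

Lemma card_between (V : finType) (r s : {set V}) :
  r \subset s -> #|s| = #|r|.+2 ->
  #|[set t : {set V} | [&& r \subset t, t \subset s & #|t| == #|r|.+1]]| = 2%N.
Proof.
move=> rs cs.
have -> : [set t : {set V} | [&& r \subset t, t \subset s & #|t| == #|r|.+1]]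
        = [set v |: r | v in s :\: r].
  apply/setP=> t; rewrite inE; apply/and3P/imsetP.
  - case=> rt ts /eqP ct.
    have /cards1P[v vE] : #|t :\: r| == 1%N.
      by rewrite cardsD (setIidPr rt) ct subSnn.
    have: v \in t :\: r by rewrite vE set11.
    rewrite inE => /andP[vr vt]; exists v; first by rewrite inE vr (subsetP ts).
    by rewrite -vE setUC setDE setUIr setUCr setIT; apply/esym/setUidPr.
  - case=> v; rewrite inE => /andP[vr vs] ->; split.
    + exact: subsetUr.
    + by rewrite subUset sub1set vs.
    + by rewrite cardsU1 vr add1n.
rewrite card_in_imset; first by rewrite cardsD (setIidPr rs) cs; lia.
move=> u v; rewrite !inE => /andP[ur _] /andP[vr _] E.
have: u \in v |: r by rewrite -E setU11.
by rewrite !inE (negbTE ur) orbF => /eqP.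
Qed.

Section Acyclic.
Variables (V : finType) (L : {set {set V}}).
Hypothesis L_down : down_closed L.

Lemma faces_of_cardP (k : nat) (i : 'I_#|faces_of_card L k|) :
  (enum_val i : {set V}) \in L /\ #|(enum_val i : {set V})| = k.
Proof. by have := enum_valP i; rewrite inE => /andP[? /eqP]. Qed.

Lemma boundary0 : boundary L 0 = 0.
Proof.
apply/matrixP=> s t; rewrite !mxE; case: (boolP (_ \proper _)) => // /proper_card.
by rewrite (faces_of_cardP s).2.
Qed.

Lemma boundaryE (k : nat) s t :
  boundary L k.+1 s t = ((enum_val t : {set V}) \subset (enum_val s : {set V}))%:R.
Proof.
rewrite mxE properEcard; case: (boolP (_ \subset _)) => //= _.
by rewrite (faces_of_cardP s).2 (faces_of_cardP t).2 /= ltnSn.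
Qed.

(** Between two faces whose cardinalities differ by 2 lie exactly two faces, and 2 = 0 in F_2. *)
Lemma boundary_boundary (k : nat) : boundary L k.+1 *m boundary L k = 0.
Proof.
case: k => [|k]; first by rewrite boundary0 mulmx0.
apply/matrixP=> s r; rewrite !mxE.
under eq_bigr do rewrite !boundaryE -natrM mulnb.
have [sL cs] := faces_of_cardP s; have [_ cr] := faces_of_cardP r.
rewrite -(big_enum_val (A := mem (faces_of_card L k.+1))
  (fun t => ((t \subset (enum_val s : {set V})) && ((enum_val r : {set V}) \subset t))%:R)) /=.
rewrite -raddf_sum /=.
have -> : (\sum_(t in faces_of_card L k.+1)
   ((t \subset (enum_val s : {set V})) && ((enum_val r : {set V}) \subset t)))%N
   = #|[set t : {set V} | [&& enum_val r \subset t, t \subset enum_val s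
                            & #|t| == #|(enum_val r : {set V})|.+1]]|.
  rewrite -sum1dep_card big_mkcond [RHS]big_mkcond /=; apply: eq_bigr => t _.
  rewrite inE cr /=; case: (boolP (t \subset _)) => [ts|_]; last first.
    by case: ifP; rewrite ?andbF.
  rewrite (L_down sL ts) /= andbC; by case: (#|t| == _); case: (_ \subset _).
case: (boolP ((enum_val r : {set V}) \subset (enum_val s : {set V}))) => rs.
  by rewrite card_between // ?cs ?cr //; apply/val_inj.
rewrite (_ : [set _ | _] = set0) ?cards0 //.
apply/setP=> t; rewrite !inE; apply/negbTE/negP => /and3P[rt ts _].
by case/negP: rs; apply: subset_trans ts.
Qed.

Lemma rank_boundary_le (k : nat) : (\rank (boundary L k.+1) <= \rank (kermx (boundary L k)))%N.
Proof. by apply/mxrankS/sub_kermxP/boundary_boundary. Qed.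

Section Chains.
Variables (K : fieldType) (iota : {rmorphism 'F_2 -> K}).

Definition chain (k : nat) (c : {set V} -> K) : 'rV[K]_#|faces_of_card L k| :=
  \row_i c (enum_val i).

Lemma chain_cycle (k : nat) (c : {set V} -> K) :
  (forall t, t \in L -> #|t|.+1 = k ->
    \sum_(s in L | (t \subset s) && (#|s| == k)) c s = 0) ->
  (chain k c <= map_mx iota (kermx (boundary L k)))%MS.
Proof.
move=> cyc; rewrite map_kermx; apply/sub_kermxP.
case: k cyc => [|k] cyc; first by rewrite boundary0 map_mx0 mulmx0.
apply/matrixP=> i t; rewrite !mxE.
have [tL ct] := faces_of_cardP t.
rewrite -[RHS](cyc (enum_val t)) ?ct //.
under eq_bigr do rewrite mxE mxE boundaryE.
rewrite -(big_enum_val (A := mem (faces_of_card L k.+1)) (fun s => c s *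
   iota ((enum_val t : {set V}) \subset s)%:R)) /=.
rewrite big_mkcond [RHS]big_mkcond /=; apply: eq_bigr => s _; rewrite inE.
case: (s \in L) => //=; case: (_ == _); rewrite ?andbF ?andbT //.
by case: (_ \subset _); rewrite ?rmorph1 ?rmorph0 ?mulr1 ?mulr0.
Qed.

(** The vanishing Betti number makes kernel and image of consecutive boundary matrices equal over
    F_2; ranks and kernels are preserved by extension of scalars, so a K-valued cycle is a
    boundary. *)
Lemma chain_exact (k : nat) (c : {set V} -> K) :
  betti L k = 0%N ->
  (forall t, t \in L -> #|t|.+1 = k ->
    \sum_(s in L | (t \subset s) && (#|s| == k)) c s = 0) ->
  exists h : {set V} -> K, forall s, s \in L -> #|s| = k ->
    c s = \sum_(s' in L | (s \subset s') && (#|s'| == k.+1)) h s'.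
Proof.
move=> b0 /chain_cycle cyc.
have ke : (kermx (boundary L k) <= boundary L k.+1)%MS.
  have : (boundary L k.+1 <= kermx (boundary L k))%MS.
    by apply/sub_kermxP/boundary_boundary.
  move=> le; have := mxrank_leqif_sup le => -[_ <-].
  by rewrite eqn_leq rank_boundary_le -subn_eq0; apply/eqP.
have {cyc} /submxP[w wE] : (chain k c <= map_mx iota (boundary L k.+1))%MS.
  by apply: submx_trans cyc _; rewrite map_submx.
pose h (s : {set V}) : K := \sum_(i | enum_val i == s) w 0 i.
exists h => s sL cs.
have sF : s \in faces_of_card L k by rewrite inE sL cs eqxx.
move/rowP/(_ (enum_rank_in sF s)): wE; rewrite !mxE enum_rankK_in // => ->.
under eq_bigr do rewrite mxE boundaryE enum_rankK_in //.
have hE i : h (enum_val i) = w 0 i.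
  by rewrite /h (big_pred1 i) // => j; rewrite (inj_eq enum_val_inj).
under eq_bigr do rewrite -hE.
rewrite -(big_enum_val (A := mem (faces_of_card L k.+1)) (fun s' => h s' *
   iota (s \subset s')%:R)) /=.
rewrite big_mkcond [RHS]big_mkcond /=; apply: eq_bigr => s' _; rewrite inE.
case: (s' \in L) => //=; case: (_ == _); rewrite ?andbF ?andbT //.
by case: (_ \subset _); rewrite ?rmorph1 ?rmorph0 ?mulr1 ?mulr0.
Qed.

(** The cycles form a line over F_2, hence over K, and the last hypothesis says that the all-ones
    chain lies on it. *)
Lemma top_cycle_const (k : nat) (c : {set V} -> K) :
  betti L k = 1%N -> (forall s, s \in L -> #|s| <= k)%N ->
  (forall t, t \in L -> #|t|.+1 = k ->
    \sum_(s in L | (t \subset s) && (#|s| == k)) c s = 0) ->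
  (forall t, t \in L -> #|t|.+1 = k ->
    \sum_(s in L | (t \subset s) && (#|s| == k)) (1 : K) = 0) ->
  exists h : K, forall s, s \in L -> #|s| = k -> c s = h.
Proof.
move=> b1 small /chain_cycle cyc /chain_cycle ones.
have b0 : \rank (boundary L k.+1) = 0%N.
  apply/eqP; rewrite mxrank_eq0; apply/eqP/matrixP=> s t.
  by have [sL cs] := faces_of_cardP s; have := small _ sL; rewrite cs ltnn.
have rk : \rank (map_mx iota (kermx (boundary L k))) = 1%N.
  by rewrite mxrank_map; move: b1; rewrite /betti b0 subn0.
have [[s0 [s0L cs0]]|no] :
  (exists s0, s0 \in L /\ #|s0| = k) \/ (forall s, s \in L -> #|s| <> k).
- case: (pickP [pred s in L | #|s| == k]) => [s0 /andP[? /eqP ?]|no].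
    by left; exists s0.
  by right=> s sL cs; have := no s; rewrite /= sL cs eqxx.
- have onz : chain k (fun=> 1) != 0.
    have sF : s0 \in faces_of_card L k by rewrite inE s0L cs0 eqxx.
    apply/eqP=> /matrixP/(_ 0 (enum_rank_in sF s0)); rewrite !mxE.
    by move/eqP; rewrite oner_eq0.
  have eq1 : (map_mx iota (kermx (boundary L k)) <= chain k (fun=> 1))%MS.
    have := mxrank_leqif_sup ones => -[_ <-].
    by rewrite rk rank_rV onz.
  have /sub_rVP[a aE] := submx_trans cyc eq1.
  exists a => s sL cs.
  have sF : s \in faces_of_card L k by rewrite inE sL cs eqxx.
  by move/rowP/(_ (enum_rank_in sF s)): aE; rewrite !mxE enum_rankK_in // mulr1.
- by exists 0 => s sL /(no _ sL).
Qed.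

End Chains.

(** Rank-nullity in every degree makes the alternating sum telescope, up to the contribution of the
    one nonzero Betti number. *)
Lemma euler_betti (m : nat) :
  (forall k, betti L k = (k == m)) ->
  \sum_(s in L) (-1) ^+ #|s| = (-1) ^+ m :> int.
Proof.
move=> b.
have rkk k : (#|faces_of_card L k| =
    (k == m) + \rank (boundary L k.+1) + \rank (boundary L k))%N.
  have := b k; rewrite /betti mxrank_ker => /esym ->.
  have := rank_boundary_le k; rewrite mxrank_ker.
  have := rank_leq_row (boundary L k); lia.
pose r k := \rank (boundary L k); pose f k := #|faces_of_card L k|.
have fE k : f k = ((k == m) + r k.+1 + r k)%N := rkk k.
have fV k : (#|V| < k)%N -> f k = 0%N.
  move=> lt; apply/eqP; rewrite cards_eq0; apply/eqP/setP=> s; rewrite !inE.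
  by apply/negP=> /andP[_ /eqP cs]; have := max_card (mem s); rewrite cs leqNgt lt.
have r0 : r 0%N = 0%N by rewrite /r boundary0 mxrank0.
(* The only leftover is the rank of the boundary in degree M, which is 0 once M exceeds the size of
   V. *)
have tele M : \sum_(k < M) (-1) ^+ k * (f k)%:Z =
   (if (m < M)%N then (-1) ^+ m else 0) - (-1) ^+ M * (r M)%:Z.
  elim: M => [|M IH]; first by rewrite big_ord0 r0 mulr0 subr0.
  rewrite big_ord_recr /= IH fE !PoszD exprS ltnS (leq_eqVlt m M) (eq_sym M).
  by case: ltngtP => [lt|lt|->] /=; ring.
have mV : (m <= #|V|)%N.
  by rewrite leqNgt; apply/negP=> lt; have := fE m; rewrite eqxx fV.
have rV : r #|V|.+1 = 0%N by have := fE #|V|.+1; rewrite fV //; lia.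
have := tele #|V|.+1; rewrite ltnS mV rV mulr0 subr0 => <-.
rewrite (partition_big (fun s : {set V} => inord #|s| : 'I_#|V|.+1) xpredT) //=.
apply: eq_bigr => k _; transitivity (\sum_(s in faces_of_card L k) (-1) ^+ k : int).
  rewrite big_mkcond [RHS]big_mkcond /=; apply: eq_bigr => s _; rewrite inE.
  case: (s \in L) => //=; rewrite -val_eqE /= inordK ?ltnS ?max_card //.
  by case: eqP => // ->.
by rewrite sumr_const -mulr_natr natz.
Qed.

End Acyclic.

Lemma link_down (V : finType) (D : {set {set V}}) (t : {set V}) :
  down_closed D -> down_closed (link D t).
Proof.
move=> dD s u; rewrite !inE => /and3P[sD stD /eqP si] us.
rewrite (dD _ _ sD us) (dD _ _ stD (setSU t us)) /=.
by rewrite -subset0 -si setSI.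
Qed.

Lemma setDUK (V : finType) (t x : {set V}) : t \subset x -> x :\: t :|: t = x.
Proof. by move=> tx; rewrite setUC setDE setUIr setUCr setIT; apply/setUidPr. Qed.

Lemma link_sum (V : finType) (D : {set {set V}}) (t : {set V}) (R : nmodType)
    (P : pred {set V}) (F : {set V} -> R) :
  down_closed D ->
  \sum_(s in link D t | P (s :|: t)) F (s :|: t) = \sum_(x in D | (t \subset x) && P x) F x.
Proof.
move=> dD.
rewrite [RHS](reindex_onto (fun s => s :|: t) (fun x => x :\: t)) /=; last first.
  by move=> x /and3P[_ tx _]; apply: setDUK.
apply: eq_bigl => s; rewrite inE subsetUr andTb.
have -> : ((s :|: t) :\: t == s) = (s :&: t == set0).
  by rewrite setDUl setDv setU0 (sameP eqP setDidPl) -setI_eq0.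
have [si|] := boolP (s :&: t == set0); rewrite ?andbF ?andbT //=.
have [stD|] := boolP (s :|: t \in D); rewrite ?andbF //=.
by rewrite (dD _ _ stD (subsetUl s t)).
Qed.

(* Chains of the link of t are written as functions on the faces containing t,
   so that only the complex itself occurs. *)
Record sphere_facts (K : fieldType) (V : finType) (d : nat) (D : {set {set V}}) :
    Prop := SphereFacts {
  sf_empty : set0 \in D;
  sf_down : down_closed D;
  sf_card : forall s, s \in D -> (#|s| <= d)%N;
  sf_facet : forall s, s \in D -> exists F, [/\ F \in D, s \subset F & #|F| = d];
  sf_exact : forall (t : {set V}) q (c : {set V} -> K), t \in D -> (#|t| <= q < d)%N ->
    (forall y, y \in D -> t \subset y -> #|y|.+1 = q ->
      \sum_(x in D | (y \subset x) && (#|x| == q)) c x = 0) ->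
    exists h : {set V} -> K, forall x, x \in D -> t \subset x -> #|x| = q ->
      c x = \sum_(z in D | (x \subset z) && (#|z| == q.+1)) h z;
  sf_top : forall (t : {set V}) (c : {set V} -> K), t \in D ->
    (forall y, y \in D -> t \subset y -> #|y|.+1 = d ->
      \sum_(x in D | (y \subset x) && (#|x| == d)) c x = 0) ->
    exists h : K, forall x, x \in D -> t \subset x -> #|x| = d -> c x = h;
  sf_euler : forall t : {set V}, t \in D ->
    \sum_(x in D | t \subset x) (-1) ^+ #|x| = (-1) ^+ d :> int;
  sf_ridge : forall t : {set V}, t \in D -> #|t|.+1 = d ->
    #|[set F in D | (t \subset F) && (#|F| == d)]| = 2%N }.

Section Sphere.
Variables (V : finType) (d : nat) (D : {set {set V}}).
Hypothesis sphD : homology_sphere d D.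
Variables (K : fieldType) (iota : {rmorphism 'F_2 -> K}).

Let dD : down_closed D. Proof. by case: sphD => -[]. Qed.

Lemma sphere_facet s : s \in D -> exists F, [/\ F \in D, s \subset F & #|F| = d].
Proof.
move=> sD; have [F maxF sF] := @maxset_exists _ (fun x => x \in D) s sD.
by exists F; split=> //; [case/maxsetP: maxF | case: sphD => _ pu _; apply: pu].
Qed.

Lemma sphere_card s : s \in D -> (#|s| <= d)%N.
Proof. by case/sphere_facet=> F [_ sF <-]; apply: subset_leq_card. Qed.

Lemma card_link s t : s \in link D t -> #|s :|: t| = (#|s| + #|t|)%N.
Proof. by rewrite !inE => /and3P[_ _ /eqP st]; rewrite cardsU st cards0 subn0. Qed.

Lemma link_subset t u s : u \in link D t -> s \in link D t ->
  (u :|: t \subset s :|: t) = (u \subset s).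
Proof.
rewrite !inE => /and3P[_ _ ut] /and3P[_ _ st]; apply/idP/idP; last exact: setSU.
move=> /subsetP uts; apply/subsetP=> x xu; have := uts x; rewrite !inE xu => /(_ isT).
case/orP=> // xt; move/eqP/setP/(_ x): ut; by rewrite !inE xu xt.
Qed.

Lemma link_cycle (t : {set V}) k (c : {set V} -> K) :
  (forall y, y \in D -> t \subset y -> #|y|.+1 = (k + #|t|)%N ->
      \sum_(x in D | (y \subset x) && (#|x| == (k + #|t|)%N)) c x = 0) ->
  forall u, u \in link D t -> #|u|.+1 = k ->
    \sum_(s in link D t | (u \subset s) && (#|s| == k)) c (s :|: t) = 0.
Proof.
move=> cyc u uL cu.
rewrite -[RHS](cyc (u :|: t)); first last.
- by rewrite card_link // -cu.
- exact: subsetUr.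
- by move: uL; rewrite inE => /and3P[].
transitivity (\sum_(s in link D t | (u :|: t \subset s :|: t) && (#|s :|: t| == (k + #|t|)%N))
     c (s :|: t)).
  apply: eq_bigl => s; case: (boolP (s \in link D t)) => //= sL.
  by rewrite link_subset // card_link // eqn_add2r.
rewrite (link_sum t (fun x => (u :|: t \subset x) && (#|x| == (k + #|t|)%N)) c dD).
apply: eq_bigl => x; rewrite subUset; case: (x \in D); case: (t \subset x); rewrite ?andbF //=.
Qed.

Lemma sphere_betti t k : t \in D -> betti (link D t) k = (k == d - #|t|)%N.
Proof. by move=> tD; case: sphD => _ _ /(_ t tD). Qed.

Lemma sphere_exact (t : {set V}) q (c : {set V} -> K) : t \in D -> (#|t| <= q < d)%N ->
    (forall y, y \in D -> t \subset y -> #|y|.+1 = q ->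
      \sum_(x in D | (y \subset x) && (#|x| == q)) c x = 0) ->
    exists h : {set V} -> K, forall x, x \in D -> t \subset x -> #|x| = q ->
      c x = \sum_(z in D | (x \subset z) && (#|z| == q.+1)) h z.
Proof.
move=> tD /andP[tq qd] cyc; have qE : q = (q - #|t| + #|t|)%N by rewrite subnK.
rewrite qE in cyc; have {}cyc := link_cycle cyc.
have [|h hE] := chain_exact (link_down (t := t) dD) iota _ cyc.
  by rewrite sphere_betti //; apply/eqP; rewrite eqb0; lia.
exists (fun z => h (z :\: t)) => x xD tx cx.
have xE : x = x :\: t :|: t by rewrite setDUK.
have xL : x :\: t \in link D t.
  rewrite inE -xE xD (dD xD (subsetDl x t)) /= -subset0.
  by apply/subsetP=> v; rewrite !inE => /andP[/andP[/negbTE ->]].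
rewrite xE hE //; last by rewrite cardsD (setIidPr tx) cx.
transitivity (\sum_(s' in link D t | (x :\: t :|: t \subset s' :|: t) && (#|s' :|: t| == q.+1))
   h ((s' :|: t) :\: t)).
  apply: eq_big => [s|s /andP[sL _]].
    case: (boolP (s \in link D t)) => //= sL; rewrite link_subset // card_link //.
    by congr andb; apply/eqP/eqP; lia.
  congr h; rewrite setDUl setDv setU0; apply/esym/setDidPl.
  by move: sL; rewrite inE -setI_eq0 => /and3P[].
rewrite -xE (link_sum t (fun z => (x \subset z) && (#|z| == q.+1)) (fun z => h (z :\: t)) dD).
apply: eq_bigl => z; case: (boolP (x \subset z)) => xz; rewrite ?andbF //=.
by rewrite (subset_trans tx xz).
Qed.

(** The link of a ridge is zero-dimensional. Its Betti number 0 in index 0 forces the first boundary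
    to have rank 1, and the Betti number 1 in index 1 then leaves exactly two vertices. *)
Lemma sphere_ridge t : t \in D -> #|t|.+1 = d ->
    #|[set F in D | (t \subset F) && (#|F| == d)]| = 2%N.
Proof.
move=> tD ct.
have L0 : set0 \in link D t by rewrite inE set0U tD set0I eqxx (dD tD (sub0set t)).
have small s : s \in link D t -> (#|s| <= 1)%N.
  move=> sL; have := sphere_card (s := s :|: t); rewrite card_link // -ct => h.
  by have := h _; rewrite addnC -addn1 leq_add2l; apply; move: sL; rewrite inE => /and3P[].
have r2 : \rank (boundary (link D t) 2) = 0%N.
  apply/eqP; rewrite mxrank_eq0; apply/eqP/matrixP=> s ?.
  by have [/small + cs] := faces_of_cardP s; rewrite cs.
have f0 : #|faces_of_card (link D t) 0| = 1%N.
  rewrite (_ : faces_of_card _ 0 = [set set0]) ?cards1 //; apply/setP=> s.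
  by rewrite in_set in_set1 cards_eq0; case: eqP => [->|]; rewrite ?andbF ?L0.
have b0 := sphere_betti 0 tD; have b1 := sphere_betti 1 tD.
have dt : (d - #|t|)%N = 1%N by rewrite -ct subSnn.
have k0 : \rank (kermx (boundary (link D t) 0)) = 1%N.
  by rewrite boundary0 mxrank_ker mxrank0 subn0.
have k1 := mxrank_ker (boundary (link D t) 1).
have le1 := rank_leq_row (boundary (link D t) 1).
have f1 : #|faces_of_card (link D t) 1| = 2%N.
  have le0 : (\rank (boundary (link D t) 1) <= 1)%N by rewrite -[X in (_ <= X)%N]f0; apply: rank_leq_col.
  move: b0 b1 k1 le1 le0; rewrite /betti dt r2 k0 subn0 /=.
  move: (\rank _) (\rank _) => x y; clear; move: x y; rewrite /=; lia.
rewrite -f1 -!sum1_card.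
transitivity (\sum_(s in link D t | #|s :|: t| == d) 1)%N.
  by rewrite (link_sum t (fun z => #|z| == d) (fun=> 1%N) dD); apply: eq_bigl => z; rewrite inE.
apply: eq_bigl => s; rewrite [in RHS]inE; case: (boolP (s \in link D t)) => //= sL.
by rewrite card_link // -ct -addn1 addnC eqn_add2l.
Qed.

Lemma F2_pchar : 2%N \in [pchar K].
Proof.
rewrite inE /=; apply/eqP; rewrite -(rmorph_nat iota) (_ : 2%:R = 0) ?rmorph0 //.
by apply/val_inj.
Qed.

Lemma sphere_top (t : {set V}) (c : {set V} -> K) : t \in D ->
    (forall y, y \in D -> t \subset y -> #|y|.+1 = d ->
      \sum_(x in D | (y \subset x) && (#|x| == d)) c x = 0) ->
    exists h : K, forall x, x \in D -> t \subset x -> #|x| = d -> c x = h.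
Proof.
move=> tD cyc; have dE : d = (d - #|t| + #|t|)%N by rewrite subnK // sphere_card.
have ones y : y \in D -> t \subset y -> #|y|.+1 = d ->
      \sum_(x in D | (y \subset x) && (#|x| == d)) (1 : K) = 0.
  move=> yD ty cy.
  rewrite (eq_bigl (mem [set F in D | (y \subset F) && (#|F| == d)])); last by move=> z; rewrite /= inE.
  by rewrite sumr_const sphere_ridge // -[_ *+ 2]/(2%:R) (pcharf0 F2_pchar).
have cyc' := @link_cycle t (d - #|t|) c; rewrite -dE in cyc'.
have ones' := @link_cycle t (d - #|t|) (fun=> 1); rewrite -dE in ones'.
have [||h hE] := top_cycle_const iota _ _ (cyc' cyc) (ones' ones).
- by rewrite sphere_betti // eqxx.
- move=> s sL; rewrite -(leq_add2r #|t|) -dE -card_link // sphere_card //.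
  by move: sL; rewrite inE => /and3P[].
exists h => x xD tx cx.
have xE : x = x :\: t :|: t by rewrite setDUK.
have xL : x :\: t \in link D t.
  rewrite inE -xE xD (dD xD (subsetDl x t)) /= -subset0.
  by apply/subsetP=> v; rewrite !inE => /andP[/andP[/negbTE ->]].
by rewrite xE hE // cardsD (setIidPr tx) cx.
Qed.

Lemma sphere_euler t : t \in D ->
    \sum_(x in D | t \subset x) (-1) ^+ #|x| = (-1) ^+ d :> int.
Proof.
move=> tD; have := euler_betti (link_down (t := t) dD) (fun k => sphere_betti k tD).
move=> /(congr1 (fun x => x * (-1) ^+ #|t|)); rewrite -exprD subnK ?sphere_card // => <-.
rewrite mulr_suml; transitivity (\sum_(s in link D t | predT (s :|: t)) (-1) ^+ #|s :|: t| : int).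
  by rewrite (link_sum t predT (fun z => (-1) ^+ #|z| : int) dD); apply: eq_bigl => z; rewrite andbT.
by apply: eq_big => [s|s /andP[sL _]]; rewrite ?andbT // card_link // exprD.
Qed.

Lemma sphere_factsP : sphere_facts K d D.
Proof.
split; [by case: sphD => -[] | exact: dD | exact: sphere_card | exact: sphere_facet |
  exact: sphere_exact | exact: sphere_top | exact: sphere_euler | exact: sphere_ridge].
Qed.

End Sphere.

(** * Ideals of monomials and linear forms *)

Section MonomialIdeals.
Variables (K : fieldType) (n : nat).
Implicit Types (f g : {mpoly K[n]}) (m : 'X_{1..n}) (bad : pred {set 'I_n}).

Definition msup m : {set 'I_n} := [set i | m i != 0%N].

Lemma msupD m1 m2 : msup (m1 + m2)%MM = msup m1 :|: msup m2.
Proof. by apply/setP=> i; rewrite !inE mnmDE addn_eq0 negb_and. Qed.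

Definition upward bad := forall A B : {set 'I_n}, A \subset B -> bad A -> bad B.

(** For [upward bad] this is a squarefree monomial ideal; with the nonfaces as bad sets it is the
    Stanley-Reisner ideal. *)
Definition mono_ideal bad f := forall m, f@_m != 0 -> bad (msup m).

Lemma mono_ideal0 bad : mono_ideal bad 0.
Proof. by move=> m; rewrite mcoeff0 eqxx. Qed.

Lemma mono_idealD bad f g : mono_ideal bad f -> mono_ideal bad g -> mono_ideal bad (f + g).
Proof.
move=> hf hg m; rewrite mcoeffD => nz; have [/eqP f0|/hf//] := boolP (f@_m == 0).
by apply: hg; move: nz; rewrite f0 add0r.
Qed.

Lemma mono_ideal_sum bad (I : Type) (r : seq I) (P : pred I) (F : I -> {mpoly K[n]}) :
  (forall i, P i -> mono_ideal bad (F i)) -> mono_ideal bad (\sum_(i <- r | P i) F i).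
Proof.
move=> h; apply: (big_ind (mono_ideal bad)) => //; first exact: mono_ideal0.
exact: mono_idealD.
Qed.

Lemma mono_idealM bad f g : upward bad -> mono_ideal bad f -> mono_ideal bad (g * f).
Proof.
move=> up hf m; rewrite -mcoeff_msupp => /msuppM_le /allpairsP[[m1 m2] /= [m1g m2f ->]].
by rewrite msupD; apply: (up (msup m2)); [apply: subsetUr | apply: hf; rewrite -mcoeff_msupp].
Qed.

Lemma mono_ideal_weaken bad bad' f :
  (forall A, bad A -> bad' A) -> mono_ideal bad f -> mono_ideal bad' f.
Proof. by move=> h hf m /hf /h. Qed.

Section WithForms.
Variable theta : nat -> {mpoly K[n]}.

(** The quotient by this set is the face ring given by [bad] modulo the first r forms; [upward bad]
    is what makes the set an ideal. *)
Definition in_ideal r bad f :=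
  exists g : nat -> {mpoly K[n]}, mono_ideal bad (f - \sum_(s < r) theta s * g s).

Lemma in_ideal_mono r bad f : mono_ideal bad f -> in_ideal r bad f.
Proof.
by move=> h; exists (fun=> 0); rewrite big1 ?subr0 // => i _; rewrite mulr0.
Qed.

Lemma in_ideal_mono0 bad f : in_ideal 0 bad f -> mono_ideal bad f.
Proof. by case=> g; rewrite big_ord0 subr0. Qed.

Lemma in_ideal0 r bad : in_ideal r bad 0.
Proof. exact/in_ideal_mono/mono_ideal0. Qed.

Lemma in_idealD r bad f1 f2 : in_ideal r bad f1 -> in_ideal r bad f2 -> in_ideal r bad (f1 + f2).
Proof.
case=> g1 h1 [g2 h2]; exists (fun s => g1 s + g2 s).
under eq_bigr do rewrite mulrDr.
by rewrite big_split /= opprD addrACA; apply: mono_idealD.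
Qed.

Lemma in_idealM r bad f h : upward bad -> in_ideal r bad f -> in_ideal r bad (h * f).
Proof.
move=> up [g hg]; exists (fun s => h * g s).
under eq_bigr do rewrite mulrCA.
by rewrite -mulr_sumr -mulrBr; apply: mono_idealM.
Qed.

Lemma in_idealZ r bad c f : in_ideal r bad f -> in_ideal r bad (c *: f).
Proof.
case=> g hg; exists (fun s => c *: g s).
under eq_bigr do rewrite -scalerAr.
rewrite -scaler_sumr -scalerBr => m; rewrite mcoeffZ mulf_eq0 negb_or => /andP[_]; exact: hg.
Qed.

Lemma in_idealN r bad f : in_ideal r bad f -> in_ideal r bad (- f).
Proof. by move=> h; rewrite -scaleN1r; apply: in_idealZ. Qed.

Lemma in_idealB r bad f1 f2 : in_ideal r bad f1 -> in_ideal r bad f2 -> in_ideal r bad (f1 - f2).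
Proof. by move=> h1 h2; apply/in_idealD/in_idealN. Qed.

Lemma in_ideal_subl r bad f g : in_ideal r bad (f - g) -> in_ideal r bad g -> in_ideal r bad f.
Proof. by move=> h1 h2; rewrite -(subrK g f); apply: in_idealD. Qed.

Lemma in_ideal_sum r bad (I : Type) (s : seq I) (P : pred I) (F : I -> {mpoly K[n]}) :
  (forall i, P i -> in_ideal r bad (F i)) -> in_ideal r bad (\sum_(i <- s | P i) F i).
Proof.
move=> h; apply: (big_ind (in_ideal r bad)) => //; first exact: in_ideal0.
exact: in_idealD.
Qed.

Lemma in_ideal_weaken r bad bad' f :
  (forall A, bad A -> bad' A) -> in_ideal r bad f -> in_ideal r bad' f.
Proof. by move=> h [g hg]; exists g; apply: mono_ideal_weaken hg. Qed.

Lemma in_ideal_theta r bad s g : (s < r)%N -> in_ideal r bad (theta s * g).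
Proof.
move=> sr; exists (fun t => if t == s then g else 0).
rewrite (bigD1 (Ordinal sr)) //= eqxx big1 ?addr0 ?subrr; last first.
  by move=> i; rewrite -val_eqE /= => /negbTE ->; rewrite mulr0.
exact: mono_ideal0.
Qed.

Lemma in_ideal_leq r r' bad f : (r <= r')%N -> in_ideal r bad f -> in_ideal r' bad f.
Proof.
move=> le [g hg]; apply: (@in_ideal_subl _ _ _ (\sum_(s < r) theta s * g s)).
  exact: in_ideal_mono.
by apply: in_ideal_sum => s _; apply: in_ideal_theta; apply: leq_trans le.
Qed.

Lemma in_idealS r bad f :
  in_ideal r.+1 bad f <-> exists g, in_ideal r bad (f - theta r * g).
Proof.
split=> [[g]|[g hg]]; last first.
  by apply: in_ideal_subl (in_ideal_leq (leqnSn r) hg) _; apply: in_ideal_theta.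
by rewrite big_ord_recr /= => h; exists (g r), g; rewrite -addrA -opprD [_ + \sum_(_ < _) _]addrC.
Qed.

End WithForms.

(* Killing a form that is regular on the terms of a complex costs one place of
   exactness, by a diagram chase. *)
Section ExactMod.
Variables (theta : nat -> {mpoly K[n]}) (T : finType) (rk : T -> nat) (cov : rel T).
Variables (bad : T -> pred {set 'I_n}) (d : nat).
Hypothesis bad_up : forall x, upward (bad x).
Hypothesis cov_rk : forall x y, cov x y -> rk x = (rk y).+1.
Hypothesis cov_bad : forall x y, cov x y -> forall A, bad x A -> bad y A.
Hypothesis cov_square : forall x y,
  \sum_(w | cov x w && cov w y) (1 : K) = 0.
Hypothesis exact0 : forall q (p : T -> {mpoly K[n]}), (2 <= q)%N ->
  (forall y, rk y = q.-1 -> mono_ideal (bad y) (\sum_(x | cov x y) p x)) ->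
  exists h : T -> {mpoly K[n]}, forall x, rk x = q ->
    mono_ideal (bad x) (p x - \sum_(z | cov z x) h z).
Hypothesis regular : forall r x f, (r < d)%N -> (r < rk x < d)%N ->
  in_ideal theta r (bad x) (theta r * f) -> in_ideal theta r (bad x) f.

Lemma exact_mod r q (p : T -> {mpoly K[n]}) : (r < d)%N -> (r + 2 <= q <= d.+1)%N ->
  (forall y, rk y = q.-1 -> in_ideal theta r (bad y) (\sum_(x | cov x y) p x)) ->
  exists h : T -> {mpoly K[n]}, forall x, rk x = q ->
    in_ideal theta r (bad x) (p x - \sum_(z | cov z x) h z).
Proof.
elim: r q p => [|r IH] q p rd /andP[rq qd] cyc.
  have [||h hE] := exact0 (q := q) (p := p); first by lia.
    by move=> y ry; apply/in_ideal_mono0/cyc.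
  by exists h => x /hE; apply: in_ideal_mono.
have rd' : (r < d)%N by lia.
have {cyc} [g gE] : exists g : T -> {mpoly K[n]}, forall y, rk y = q.-1 ->
    in_ideal theta r (bad y) (\sum_(x | cov x y) p x - theta r * g y).
  apply: (fin_all_exists (P := fun y gy => rk y = q.-1 ->
    in_ideal theta r (bad y) (\sum_(x | cov x y) p x - theta r * gy))) => y.
  have [ry|] := eqVneq (rk y) q.-1; last by exists 0 => e; rewrite e eqxx in i.
  by have /in_idealS[gy gyE] := cyc y ry; exists gy.
(* The square of the boundary is 0, so theta_r times the boundary of g lies in the ideal; by
   regularity g is a cycle, and exactness one place lower makes it the boundary of h1. *)
have [||h1 h1E] := IH q.-1 g rd'; first by lia.
  move=> z rz; apply: regular => //; first by lia.
  rewrite mulr_sumr.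
  have -> : \sum_(y | cov y z) theta r * g y =
      - \sum_(y | cov y z) (\sum_(x | cov x y) p x - theta r * g y).
    rewrite -sumrN; under [RHS]eq_bigr do rewrite opprB.
    rewrite [RHS]sumrB -[LHS]subr0; congr (_ - _).
    rewrite (exchange_big_dep predT) //= big1 // => x _.
    rewrite (eq_bigl (fun y => cov x y && cov y z)); last by move=> y; rewrite andbC.
    rewrite -[p x]mul1r -mulr_suml -[1](rmorph1 (@mpolyC n K)) -rmorph_sum cov_square.
    by rewrite rmorph0 mul0r.
  apply/in_idealN/in_ideal_sum => y yz; apply: (in_ideal_weaken (cov_bad yz)).
  by apply: gE; rewrite (cov_rk yz); lia.
(* Subtracting theta_r h1 from p turns a cycle modulo r+1 forms into a cycle modulo r forms. *)
have [||h2 h2E] := IH q (fun x => p x - theta r * h1 x) rd'; first by lia.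
  move=> y ry; rewrite sumrB -mulr_sumr.
  have -> : \sum_(x | cov x y) p x - theta r * (\sum_(x | cov x y) h1 x) =
     (\sum_(x | cov x y) p x - theta r * g y) + theta r * (g y - \sum_(x | cov x y) h1 x).
    by rewrite mulrBr addrA subrK.
  by apply: in_idealD; [apply: gE | apply/in_idealM/h1E].
exists h2 => x rx; apply/in_idealS; exists (h1 x).
by rewrite addrAC; apply: h2E.
Qed.

End ExactMod.

End MonomialIdeals.

(** * Regularity of generic forms on the polynomial ring of a face *)

Section LinearForms.
Variables (K : fieldType) (n : nat).
Implicit Types (v : 'rV[K]_n) (s : {set 'I_n}).

Definition lin v : {mpoly K[n]} := \sum_i v 0 i *: 'X_i.

Lemma lin_coeff v i : (lin v)@_(U_(i)) = v 0 i.
Proof.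
rewrite /lin raddf_sum (bigD1 i) //= mcoeffZ mcoeffX eqxx mulr1 big1 ?addr0 // => j ji.
by rewrite mcoeffZ mcoeffX eq_mnm1 (negbTE ji) mulr0.
Qed.

Lemma lin_is_linear : linear lin.
Proof.
move=> c u v; rewrite /lin scaler_sumr -big_split /=; apply: eq_bigr => i _.
by rewrite !mxE scalerDl scalerA.
Qed.

HB.instance Definition _ := GRing.isLinear.Build K 'rV[K]_n {mpoly K[n]} _ lin lin_is_linear.

Lemma lin_homog v : lin v \is 1.-homog.
Proof. by apply: rpred_sum => i _; apply: rpredZ; rewrite dhomogX /= mdeg1. Qed.

Lemma lin_delta i : lin (delta_mx 0 i) = 'X_i.
Proof.
rewrite /lin (bigD1 i) //= mxE !eqxx scale1r big1 ?addr0 // => j ji.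
by rewrite mxE (negbTE ji) andbF scale0r.
Qed.

Definition not_sub s : pred {set 'I_n} := fun A => ~~ (A \subset s).

Lemma not_sub_up s : upward (not_sub s).
Proof. by move=> A B AB; apply: contraNN; apply: subset_trans. Qed.

Section Forms.
Variable a : nat -> 'I_n -> K.

Definition arow r : 'rV[K]_n := \row_w a r w.
Definition theta r : {mpoly K[n]} := lin (arow r).

Lemma thetaE r : theta r = \sum_w a r w *: 'X_w.
Proof. by apply: eq_bigr => i _; rewrite mxE. Qed.

(** The rows span the linear forms that vanish in K[s] modulo the first r forms; zero rows stand in
    for the variables in s. *)
Definition killed r s : 'M[K]_(r + n, n) :=
  col_mx (\matrix_(k < r) arow k) (\matrix_(w < n) (if w \in s then 0 else delta_mx 0 w)).

Lemma lin_killed r s v : (v <= killed r s)%MS -> in_ideal theta r (not_sub s) (lin v).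
Proof.
case/submxP=> y ->; rewrite -[y]hsubmxK mul_row_col raddfD /=; apply: in_idealD.
  rewrite mulmx_sum_row raddf_sum /=; apply: in_ideal_sum => k _.
  rewrite linearZ rowK /=; apply: in_idealZ; rewrite -[lin _]mulr1.
  exact: (in_ideal_theta theta (not_sub s) 1 (ltn_ord k)).
rewrite mulmx_sum_row raddf_sum /=; apply: in_ideal_sum => w _.
rewrite linearZ rowK /=; apply: in_idealZ; case: ifP => ws; first by rewrite raddf0; apply: in_ideal0.
rewrite lin_delta; apply: in_ideal_mono => m; rewrite mcoeffX; case: (U_(w)%MM =P m) => [<- _|_]; last by rewrite eqxx.
by apply/subsetPn; exists w; rewrite ?ws // inE mnm1E eqxx.
Qed.

Lemma arow_killed r s k : (k < r)%N -> (arow k <= killed r s)%MS.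
Proof.
move=> kr; have -> : arow k = row (lshift n (Ordinal kr)) (killed r s); last exact: row_sub.
by apply/rowP=> j; rewrite !mxE (unsplitK (inl _)) !mxE.
Qed.

Lemma delta_killed r s w : w \notin s -> ((delta_mx 0 w : 'rV_n) <= killed r s)%MS.
Proof.
move=> ws; have -> : (delta_mx 0 w : 'rV_n) = row (rshift r w) (killed r s); last exact: row_sub.
by apply/rowP=> j; rewrite !mxE (unsplitK (inr _)) !mxE (negbTE ws) !mxE.
Qed.

Lemma subst_diff r (bad : pred {set 'I_n}) (lq : n.-tuple {mpoly K[n]}) f :
  upward bad -> (forall i, in_ideal theta r bad ('X_i - tnth lq i)) ->
  in_ideal theta r bad (f - (f \mPo lq)).
Proof.
move=> up hX.
have mulP g h : in_ideal theta r bad (g - (g \mPo lq)) -> in_ideal theta r bad (h - (h \mPo lq)) ->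
    in_ideal theta r bad (g * h - ((g * h) \mPo lq)).
  move=> hg hh; rewrite (rmorphM (comp_mpoly lq)) /=.
  have -> : g * h - (g \mPo lq) * (h \mPo lq) =
    h * (g - (g \mPo lq)) + (g \mPo lq) * (h - (h \mPo lq)) by ring.
  by apply: in_idealD; apply: in_idealM.
have one : in_ideal theta r bad (1 - (1 \mPo lq)) by rewrite comp_mpoly1 subrr; apply: in_ideal0.
rewrite [f]mpolyE (raddf_sum (comp_mpoly lq)) -sumrB; apply: in_ideal_sum => m _.
rewrite /= comp_mpolyZ -scalerBr; apply: in_idealZ.
rewrite mpolyXE_id; apply: (big_ind (fun g => in_ideal theta r bad (g - (g \mPo lq)))) => // i _.
elim: (m i) => [|k IH]; first by rewrite expr0.
by rewrite exprS; apply: mulP; rewrite // comp_mpolyXU -tnth_nth; apply: hX.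
Qed.

(** A polynomial ring modulo linear forms is again a polynomial ring, hence a domain. Concretely,
    projecting the linear forms along the killed ones gives a substitution whose kernel is the
    ideal, and theta_r survives it. *)
Lemma regular_linear r s f : ~~ (arow r <= killed r s)%MS ->
  in_ideal theta r (not_sub s) (theta r * f) -> in_ideal theta r (not_sub s) f.
Proof.
move=> nin.
pose S := <<killed r s>>%MS; pose P := proj_mx (S^C)%MS S.
have dis : (S^C :&: S = 0)%MS by rewrite capmxC; apply: capmx_compl.
have P0 m (v : 'M_(m, n)) : (v <= killed r s)%MS -> v *m P = 0.
  by move=> vS; apply: proj_mx_0 => //; rewrite genmxE.
have PS m (v : 'M_(m, n)) : (v - v *m P <= killed r s)%MS.
  rewrite -(genmxE (killed r s)); apply: proj_mx_compl_sub => //.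
  by rewrite addsmxC (eqmxP (addsmx_compl_full _)) ?submx1 // || apply: submx_full; rewrite addsmxC addsmx_compl_full.
pose lq : n.-tuple {mpoly K[n]} := [tuple lin (row i P) | i < n].
have lqX i : 'X_i \mPo lq = lin (row i P) by rewrite comp_mpolyXU -tnth_nth tnth_mktuple.
have lqlin v : lin v \mPo lq = lin (v *m P).
  rewrite mulmx_sum_row [RHS]raddf_sum /lin (raddf_sum (comp_mpoly lq)) /=; apply: eq_bigr => i _.
  by rewrite comp_mpolyZ lqX linearZ.
have kill g : in_ideal theta r (not_sub s) g -> g \mPo lq = 0.
  case=> c hc; rewrite -[g](subrK (\sum_(k < r) theta k * c k)) comp_mpolyD.
  rewrite (raddf_sum (comp_mpoly lq)) [X in _ + X]big1 ?addr0 /= => [|k _]; last first.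
    by rewrite (rmorphM (comp_mpoly lq)) /= lqlin P0 ?raddf0 ?mul0r // arow_killed.
  rewrite [g - _]mpolyE (raddf_sum (comp_mpoly lq)) /= big_seq big1 // => m; rewrite mcoeff_msupp => /hc.
  case/subsetPn=> w; rewrite inE => mw ws; rewrite comp_mpolyZ comp_mpolyX.
  rewrite (bigD1 w) //= tnth_mktuple rowE P0 ?delta_killed // raddf0 expr0n (negbTE mw).
  by rewrite mul0r scaler0.
have diff g : in_ideal theta r (not_sub s) (g - (g \mPo lq)).
  apply: subst_diff => [|i]; first exact: not_sub_up.
  by rewrite tnth_mktuple -lin_delta rowE -raddfB; apply/lin_killed/PS.
move=> /kill; rewrite (rmorphM (comp_mpoly lq)) /= lqlin => /eqP; rewrite mulf_eq0 => /orP[/eqP z|/eqP z].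
  case/negP: nin; have := PS _ (arow r).
  suff -> : arow r *m P = 0 by rewrite subr0.
  by apply/rowP=> i; rewrite -lin_coeff z mcoeff0 mxE.
by rewrite -[f]subr0 -z; apply: diff.
Qed.

Definition generic d := forall k (e : 'I_k -> 'I_n), (k <= d)%N -> injective e ->
  \det (\matrix_(i < k, j < k) a i (e j)) != 0.

Lemma set_injection k (s : {set 'I_n}) : (k <= #|s|)%N ->
  exists2 e : 'I_k -> 'I_n, injective e & forall i, e i \in s.
Proof.
move=> ks; exists (fun i => enum_val (widen_ord ks i)) => [i j /enum_val_inj /(congr1 val)|i].
  by move=> /= E; apply: val_inj.
exact: enum_valP.
Qed.

(** A dependence among the rows 0, ..., r would survive restriction to r+1 columns in s and make an
    initial minor vanish. *)
Lemma arow_not_killed d r s : generic d -> (r < d)%N -> (r < #|s|)%N ->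
  ~~ (arow r <= killed r s)%MS.
Proof.
move=> gen rd rs; have [e e_inj es] := set_injection rs.
have := gen _ e rd e_inj; apply: contraNN => /submxP[y yE].
apply/det0P; exists (\row_(k < r.+1) if unlift ord_max k is Some k' then - y 0 (lshift n k') else 1).
  by apply/eqP=> /rowP/(_ ord_max); rewrite !mxE unlift_none => /eqP; rewrite oner_eq0.
apply/rowP=> j; rewrite !mxE big_ord_recr /= !mxE unlift_none mul1r.
move/rowP/(_ (e j)): yE; rewrite !mxE big_split_ord /= => ->.
rewrite [X in _ + (_ + X)]big1 ?addr0 => [|w _]; last first.
  rewrite !mxE (unsplitK (inr _)) !mxE; case: ifP => ws; rewrite !mxE ?mulr0 //=.
  by have -> : (e j == w) = false; [apply/negP=> /eqP E; rewrite -E es in ws | rewrite mulr0].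
rewrite -big_split big1 //= => k _; rewrite !mxE (unsplitK (inl _)) !mxE.
have -> : widen_ord (leqnSn r) k = lift ord_max k by apply: val_inj; rewrite /= /bump leqNgt ltn_ord.
by rewrite liftK /= /bump leqNgt ltn_ord /= mulNr addrC subrr.
Qed.

End Forms.
End LinearForms.

Lemma sum_option (R : nmodType) (T : finType) (P : pred (option T)) (F : option T -> R) :
  \sum_(z | P z) F z = (if P None then F None else 0) + \sum_(s | P (Some s)) F (Some s).
Proof.
rewrite (bigID (fun z => z == None)) /=; congr (_ + _).
  by rewrite big_mkcondl big_pred1_eq.
rewrite (reindex_omap (@Some T) id) /=; last by case=> //; rewrite andbF.
by apply: eq_bigl => s; rewrite eqxx !andbT.
Qed.

Section CoeffChoice.
Variables (K : fieldType) (n : nat).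

(** Polynomials are chosen one exponent at a time; the zero choice in large degrees keeps the
    supports finite. *)
Lemma choose_coefficients (T : finType) (P : 'X_{1..n} -> (T -> K) -> Prop) M :
  (forall m, exists c, P m c) -> (forall m, (M <= mdeg m)%N -> P m (fun=> 0)) ->
  exists h : T -> {mpoly K[n]}, forall m, exists2 c, P m c & forall z, (h z)@_m = c z.
Proof.
move=> exc big0.
have [c cP] := fin_all_exists (P := fun (m : 'X_{1..n < M}) c => P m c) (fun m => exc m).
exists (fun z => \sum_(m : 'X_{1..n < M}) c m z *: 'X_[m]) => m.
have [mM|Mm] := ltnP (mdeg m) M; last first.
  exists (fun=> 0); first exact: big0.
  move=> z; rewrite raddf_sum big1 // => m' _; rewrite /= mcoeffZ mcoeffX.
  case: (_ =P m) => [E|_]; last by rewrite mulr0.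
  by move: Mm; rewrite -E leqNgt bmdeg.
exists (c (BMultinom mM)); first exact: (cP (BMultinom mM)).
move=> z; rewrite raddf_sum (bigD1 (BMultinom mM)) //= mcoeffZ mcoeffX eqxx mulr1.
rewrite big1 ?addr0 // => m' ne; rewrite /= mcoeffZ mcoeffX.
case: (_ =P m) => [E|_]; last by rewrite mulr0.
by case/eqP: ne; apply/val_inj.
Qed.

End CoeffChoice.

(** * Depth of the face rings of stars *)

Section SphereIdeals.
Variables (K : fieldType) (n d : nat) (D : {set {set 'I_n}}).
Hypothesis sphD : sphere_facts K d D.
Hypothesis char2 : 2%N \in [pchar K].
Variable a : nat -> 'I_n -> K.
Hypothesis gen : generic a d.

Let dD := sf_down sphD.
Local Notation R := {mpoly K[n]}.
Local Notation theta := (theta a).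

(** The nonfaces of the star of t; for t empty, of the whole complex. *)
Definition off_star (t : {set 'I_n}) : pred {set 'I_n} := fun A => A :|: t \notin D.

Lemma off_star_up t : upward (off_star t).
Proof. by move=> A B AB; apply: contraNN => h; apply: dD h _; apply: setSU. Qed.

Lemma off_star_sub (t t' A : {set 'I_n}) : t \subset t' -> off_star t A -> off_star t' A.
Proof. by move=> tt'; apply: contraNN => h; apply: dD h _; apply: setUS. Qed.

Section Star.
Variable t : {set 'I_n}.
Hypothesis tD : t \in D.

Definition star_face (x : {set 'I_n}) := (x \in D) && (t \subset x).

(** [None] is an extra top element, of rank d+1 and above all facets of the star; its term in the
    complex is the ring of the whole star, while [Some s] carries K[s]. *)
Definition crk (x : option {set 'I_n}) := if x is Some s then #|s| else d.+1.
Definition ccov (x y : option {set 'I_n}) :=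
  if y is Some s then
    star_face s &&
    (if x is Some s' then [&& star_face s', s \subset s' & #|s'| == #|s|.+1] else #|s| == d)
  else false.
(** For a set s that is not a face of the star every monomial is bad, so its term is zero and the
    index type may contain all sets. *)
Definition cbad (x : option {set 'I_n}) : pred {set 'I_n} :=
  if x is Some s then fun A => ~~ star_face s || not_sub s A else off_star t.

Lemma cbad_up x : upward (cbad x).
Proof.
case: x => [s|]; last exact: off_star_up.
by move=> A B AB /orP[h|h]; apply/orP; [left | right; apply: not_sub_up h].
Qed.

Lemma ccov_rk x y : ccov x y -> crk x = (crk y).+1.
Proof. by case: x y => [s|] [s'|] //= /andP[_]; [case/and3P => _ _ /eqP | move/eqP=> ->]. Qed.

Lemma ccov_bad x y : ccov x y -> forall A, cbad x A -> cbad y A.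
Proof.
case: x y => [s|] [s'|] //= /andP[vs'].
  case/and3P=> -> ss' _ A /= ns; apply/orP; right.
  by apply: contraNN ns => As'; apply: subset_trans ss'.
move=> _ A bA; apply/orP; right; apply: contraNN bA => As'.
by case/andP: vs' => s'D ts'; apply: dD s'D _; rewrite subUset As' ts'.
Qed.

Lemma star_face_sub (s s' : {set 'I_n}) : t \subset s -> s \subset s' -> s' \in D -> star_face s.
Proof. by move=> ts ss' s'D; rewrite /star_face ts (dD s'D ss'). Qed.

(** An interval of length 2 has two middle elements, also below the top: these are the two facets
    through a ridge. *)
Lemma ccov_square x y : \sum_(w | ccov x w && ccov w y) (1 : K) = 0.
Proof.
case: y => [s|]; last by rewrite big_pred0 // => w; rewrite andbF.
rewrite sumr_const.
have two (A : pred (option {set 'I_n})) (B : {set {set 'I_n}}) :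
   #|B| = 2%N -> (forall w, A w = if w is Some s' then s' \in B else false) -> (1 : K) *+ #|A| = 0.
  move=> B2 AB; have -> : #|A| = #|B|.
    rewrite -(card_imset B (@Some_inj _)); apply: eq_card => w; rewrite -[w \in A]/(A w) AB.
    case: w => [s'|]; first by rewrite mem_imset //; apply: Some_inj.
    by apply/esym/imsetP => -[].
  by rewrite B2 -[_ *+ 2]/(2%:R) (pcharf0 char2).
have zero (A : pred (option {set 'I_n})) : (forall w, A w = false) -> (1 : K) *+ #|A| = 0.
  by move=> A0; rewrite (eq_card0 (A := A)).
case: x => [x|].
  case: (boolP [&& star_face x, star_face s, s \subset x & #|x| == #|s|.+2]) => [|no].
    case/and4P=> vx vs sx /eqP cx.
    apply: (two _ _ (card_between sx cx)) => -[w|] /=; last by [].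
    rewrite inE vx vs /=; have [sw|] := boolP (s \subset w); last by rewrite !andbF.
    have [wx|] := boolP (w \subset x); last by rewrite !andbF.
    case/andP: vx => xD _; case/andP: (vs) => _ ts.
    rewrite (star_face_sub (subset_trans ts sw) wx xD) /= cx.
    by rewrite eqSS eq_sym andbb.
  apply: (zero (fun w => ccov _ w && ccov w _)) => -[w|] /=; last by [].
  apply/negP; case/andP=> /andP[vw /and3P[vx wx /eqP cx]] /andP[vs /and3P[_ sw /eqP cw]].
  by case/and4P: no; rewrite vx vs (subset_trans sw wx) cx cw.
case: (boolP (star_face s && (#|s|.+1 == d))) => [/andP[vs /eqP cs]|no].
  case/andP: (vs) => sD ts.
  apply: (two _ _ (sf_ridge sphD sD cs)) => -[w|] /=; last by [].
  rewrite inE vs /= cs; have [sw|] := boolP (s \subset w); last by rewrite !andbF.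
  rewrite /star_face (subset_trans ts sw); case: (w \in D) => //=.
  by case: (#|w| == d).
apply: (zero (fun w => ccov _ w && ccov w _)) => -[w|] /=; last by [].
apply/negP; case/andP=> /andP[vw /eqP cw] /andP[vs /and3P[_ sw /eqP cw']].
by case/andP: no; rewrite vs -cw' cw.
Qed.

(** The complex splits by exponents. The part with exponent m only involves the faces containing the
    support of m and t, so it is the chain complex of a link, whose reduced homology sits in top
    degree. *)
Lemma cexact0 q (p : option {set 'I_n} -> R) : (2 <= q)%N ->
  (forall y, crk y = q.-1 -> mono_ideal (cbad y) (\sum_(x | ccov x y) p x)) ->
  exists h : option {set 'I_n} -> R, forall x, crk x = q ->
    mono_ideal (cbad x) (p x - \sum_(z | ccov z x) h z).
Proof.
move=> q2 cyc.
(* Above rank d only the extra top element matters, where exactness says that a polynomial vanishing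
   on every facet of the star has bad monomials only. *)
have [dq|qd] := ltnP d q.
  exists (fun=> 0) => -[s|] /= rx m; rewrite big1 // subr0 => nz.
    apply/orP; left; apply/negP=> /andP[sD _].
    by have := sf_card sphD sD; rewrite rx leqNgt dq.
  apply/negP=> mD; have [F [FD mF cF]] := sf_facet sphD mD.
  have vF : star_face F by rewrite /star_face FD (subset_trans (subsetUr _ _) mF).
  have := cyc (Some F); rewrite /= cF -rx => /(_ erefl m).
  rewrite (big_pred1 None); last first.
    case=> [s|] /=; rewrite ?vF ?cF ?eqxx //=.
    apply/negP=> /and3P[/andP[/(sf_card sphD)] + _ _ /eqP cs].
    by rewrite cs ltnn.
  move/(_ nz); rewrite /= vF /= /not_sub.
  by rewrite (subset_trans (subsetUl _ _) mF).
pose P m (c : option {set 'I_n} -> K) := msup m :|: t \in D ->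
  forall x, x \in D -> msup m :|: t \subset x -> #|x| = q ->
  (p (Some x))@_m = \sum_(z | ccov z (Some x)) c z.
have [||h hP] := @choose_coefficients K n _ P (\max_s msize (p (Some s))).
- move=> m; rewrite /P; have [mD|_] := boolP (msup m :|: t \in D); last by exists (fun=> 0).
  set k := msup m :|: t in mD *.
  have tk : t \subset k by apply: subsetUr.
  have [qk|kq] := ltnP q #|k|.
    by exists (fun=> 0) => _ x xD kx cx; have := subset_leq_card kx; rewrite cx leqNgt qk.
  have cyc' y : y \in D -> k \subset y -> #|y|.+1 = q ->
      \sum_(x in D | (y \subset x) && (#|x| == q)) (p (Some x))@_m = 0.
    move=> yD ky cy; have vy : star_face y by rewrite /star_face yD (subset_trans tk ky).
    have := cyc (Some y); rewrite /= -cy => /(_ erefl m) h.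
    have : (\sum_(x | ccov x (Some y)) p x)@_m == 0.
      apply/negPn/negP=> /h /=; rewrite vy /= /not_sub.
      by rewrite (subset_trans (subsetUl _ _) ky).
    rewrite raddf_sum sum_option /= vy /=.
    have -> : (#|y| == d) = false by apply/negbTE; rewrite neq_ltn; apply/orP; left; lia.
    rewrite add0r => /eqP z; rewrite -[RHS]z; apply: eq_bigl => x; rewrite /star_face.
    case: (boolP (y \subset x)) => yx; rewrite ?andbF //=.
    by rewrite (subset_trans tk (subset_trans ky yx)) andbT.
  have [qd'|dq'] := ltnP q d.
    have [|h hE] := sf_exact sphD mD _ cyc'; first by rewrite kq.
    exists (fun z => if z is Some s then h s else 0) => _ x xD kx cx.
    rewrite hE // sum_option /= /star_face xD (subset_trans tk kx) /= cx.
    rewrite (_ : (q == d) = false) ?add0r; last by apply/eqP; lia.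
    apply: eq_bigl => z; case: (boolP (x \subset z)) => xz; rewrite ?andbF //=.
    by rewrite (subset_trans tk (subset_trans kx xz)) andbT.
  (* Here a cycle on the facets through k is constant, and this constant becomes the coefficient at
     the extra top element. *)
  have eqd : q = d by lia.
  rewrite eqd in cyc'; have [h hE] := sf_top sphD mD cyc'.
  exists (fun z => if z is Some s then 0 else h) => _ x xD kx cx.
  rewrite hE ?cx // sum_option /= /star_face xD (subset_trans tk kx) /= cx eqd eqxx big1 ?addr0 //.
- move=> m mM _ x xD kx cx; rewrite big1 //; apply: memN_msupp_eq0; apply: msize_mdeg_ge.
  by exact: leq_trans (@leq_bigmax _ (fun s : {set _} => msize (p (Some s))) x) mM.
exists h => -[x|] rx m; last first.
  by move: qd; rewrite -rx /= ltnn.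
have [c cP cE] := hP m; rewrite mcoeffB raddf_sum /=; apply: contraR.
rewrite negb_or negbK => /andP[vx /negPn mx]; case/andP: (vx) => xD tx.
have kx : msup m :|: t \subset x by rewrite subUset mx.
by rewrite (cP _ x xD kx rx) ?(dD xD kx) // (eq_bigr _ (fun z _ => cE z)) subrr.
Qed.

Lemma star_regular r x f : (r < d)%N -> (r < crk x < d)%N ->
  in_ideal theta r (cbad x) (theta r * f) -> in_ideal theta r (cbad x) f.
Proof.
move=> rd; case: x => [s|] /= /andP[rs sd]; last by lia.
case: (boolP (star_face s)) => vs; last first.
  by move=> _; apply: in_ideal_mono => m _; apply/orP; left.
move=> h; apply: (@in_ideal_weaken _ _ _ _ (not_sub s)).
  by move=> A nA; apply/orP; right.
apply: regular_linear; first exact: arow_not_killed gen _ _.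
by apply: in_ideal_weaken h => A /orP[]//; rewrite vs.
Qed.

(* This is exactness at the first place of the complex k[st t] -> sum of the
   k[s], #|s| = d -> sum of the k[s], #|s| = d-1 -> ..., reduced modulo r forms. *)
Lemma in_ideal_facets r f : (r < d)%N ->
  (forall F, F \in D -> t \subset F -> #|F| = d -> in_ideal theta r (not_sub F) f) ->
  in_ideal theta r (off_star t) f.
Proof.
move=> rd hF.
have [||h hE] := @exact_mod K n theta _ crk ccov cbad d cbad_up ccov_rk ccov_bad
   ccov_square cexact0 star_regular r d.+1 (fun x => if x is None then f else 0) rd.
- by lia.
- move=> y ry; rewrite sum_option [X in _ + X]big1 ?addr0 //.
  case: ifP => [|_]; last exact: in_ideal0.
  case: y ry => //= F _ /andP[vF /eqP cF]; case/andP: (vF) => FD tF.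
  by apply: in_ideal_weaken (hF F FD tF cF) => A nA; apply/orP; right.
have := hE None erefl; rewrite big_pred0 ?subr0 //.
Qed.

(** With fewer than d forms, membership in the ideal is decided on the single facets, where the
    quotient is a domain in which theta_r is not zero. *)
Lemma star_nzd r f : (r < d)%N ->
  in_ideal theta r (off_star t) (theta r * f) -> in_ideal theta r (off_star t) f.
Proof.
move=> rd h; apply: in_ideal_facets => // F FD tF cF.
apply: regular_linear; first by apply: arow_not_killed gen _ _; rewrite // cF.
apply: in_ideal_weaken h => A; apply: contraNN => AF.
by apply: dD FD _; rewrite subUset AF.
Qed.

End Star.
End SphereIdeals.

(** * Hilbert functions *)

Section HomogeneousParts.
Variables (K : fieldType) (n : nat).
Implicit Types (f g : {mpoly K[n]}).

Lemma pihomog_coeff k f m : (pihomog mdeg k f)@_m = if mdeg m == k then f@_m else 0.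
Proof.
set M := maxn (msize f) (mdeg m).+1.
rewrite (@pihomogwE _ _ mdeg k M) ?leq_maxl // raddf_sum /=.
have mM : (mdeg m < M)%N by rewrite leq_max ltnSn orbT.
have [E|ne] := eqVneq (mdeg m) k.
  rewrite (bigD1 (BMultinom mM)) /= ?E // mcoeffZ mcoeffX eqxx mulr1 big1 ?addr0 // => m' /andP[_ ne].
  rewrite mcoeffZ mcoeffX; case: (_ =P m) => [E'|_]; last by rewrite mulr0.
  by case/eqP: ne; apply/val_inj.
rewrite big1 // => m' /eqP E; rewrite mcoeffZ mcoeffX.
case: (_ =P m) => [E'|_]; last by rewrite mulr0.
by case/eqP: ne; rewrite -E'.
Qed.

Lemma pihomogM1 k f g : f \is 1.-homog -> pihomog mdeg k.+1 (f * g) = f * pihomog mdeg k g.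
Proof.
move=> f1; pose N := maxn (msize g) k.+1.
rewrite {1}(@pihomog_partitionE _ _ mdeg N g) ?leq_maxl // mulr_sumr raddf_sum /=.
have kN : (k < N)%N by rewrite leq_max ltnSn orbT.
rewrite (bigD1 (Ordinal kN)) //= pihomog_dE ?(dhomogM f1) ?pihomogP // big1 ?addr0 //.
move=> i; rewrite -val_eqE /= => ik; apply: (@pihomog_ne0 _ _ mdeg i.+1 k.+1).
  by rewrite eqSS.
by rewrite -add1n; apply: dhomogM => //; apply: pihomogP.
Qed.

Lemma pihomogM0 f g : f \is 1.-homog -> pihomog mdeg 0 (f * g) = 0.
Proof.
move=> f1; rewrite (@pihomog_partitionE _ _ mdeg (msize g) g) // mulr_sumr raddf_sum /=.
rewrite big1 // => i _; apply: (@pihomog_ne0 _ _ mdeg i.+1 0) => //.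
by rewrite -add1n; apply: dhomogM => //; apply: pihomogP.
Qed.

Lemma in_ideal_homog (a : nat -> 'I_n -> K) r bad k f :
  in_ideal (theta a) r bad f -> in_ideal (theta a) r bad (pihomog mdeg k f).
Proof.
case=> g hg; exists (fun s => if k is k'.+1 then pihomog mdeg k' (g s) else 0) => m nz.
apply: hg; apply: contraNneq nz => E; move: E.
rewrite !mcoeffB pihomog_coeff => E.
have -> : (\sum_(s < r) theta a s * (if k is k'.+1 then pihomog mdeg k' (g s) else 0))
   = pihomog mdeg k (\sum_(s < r) theta a s * g s).
  rewrite raddf_sum; apply: eq_bigr => s _; have h1 := lin_homog (arow a s).
  by case: k => [|k] /=; rewrite ?pihomogM0 ?mulr0 // pihomogM1.
by rewrite pihomog_coeff; case: ifP => _; rewrite ?subrr ?E.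
Qed.

End HomogeneousParts.

Definition mexp n M (e : {ffun 'I_n -> 'I_M}) : 'X_{1..n} := [multinom (e i : nat) | i < n].

Section Hilbert.
Variables (K : fieldType) (n' : nat).
Local Notation n := n'.+1.
Local Notation U m := (dhomog n K m).
Variable a : nat -> 'I_n -> K.

Lemma mulh_proof r m (f : U m) : theta a r * f \is m.+1.-homog.
Proof. by rewrite -[m.+1]add1n; apply: dhomogM; [apply: lin_homog | apply: dhomog_is_dhomog]. Qed.

Definition mulh r m (f : U m) : U m.+1 := DHomog (mulh_proof r f).

Lemma mulh_is_linear r m : linear (@mulh r m).
Proof. by move=> c f g; apply: val_inj; rewrite /= mulrDr -scalerAr. Qed.

HB.instance Definition _ r m := GRing.isLinear.Build K (U m) (U m.+1) _ (@mulh r m) (@mulh_is_linear r m).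

Variable bad : pred {set 'I_n}.

Definition exps M k := [pred e : {ffun 'I_n -> 'I_M} |
  (mdeg (mexp e) == k) && ~~ bad (msup (mexp e))].

Definition goodc M k (f : U k) : {ffun {e | e \in exps M k} -> K^o} :=
  [ffun e : {e | e \in exps M k} => (f : {mpoly K[n]})@_(mexp (sval e)) : K^o].

Lemma goodc_is_linear M k : linear (@goodc M k).
Proof. by move=> c f g; apply/ffunP=> e; rewrite !ffunE /= mcoeffD mcoeffZ. Qed.

HB.instance Definition _ M k := GRing.isLinear.Build K (U k) _ _ (@goodc M k) (@goodc_is_linear M k).

(** The degree k part of the ideal as a subspace, so that it has a dimension. Exponents below k+1
    suffice in degree k, whence [goodc k.+1 k]. *)
Fixpoint jvs r k : {vspace U k} :=
  if r is r'.+1 then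
    if k is k'.+1 return {vspace U k} then (jvs r' k'.+1 + limg (linfun (@mulh r' k')))%VS
    else jvs r' 0
  else lker (linfun (@goodc k.+1 k)).

Lemma goodc_ker M k (f : U k) : (k < M)%N -> (f \in lker (linfun (@goodc M k))) <-> mono_ideal bad f.
Proof.
move=> kM; rewrite memv_ker lfunE /=; split=> [/eqP/ffunP z m|h].
  apply: contraNT => nb.
  have [mk|mk] := eqVneq (mdeg m) k; last by rewrite (dhomog_nemf_coeff (dhomog_is_dhomog f)).
  have lt i : (m i < M)%N by apply: leq_ltn_trans kM; rewrite -mk mdegE (bigD1 i) //= leq_addr.
  pose e := [ffun i => Ordinal (lt i)].
  have em : mexp e = m by apply/mnmP=> i; rewrite mnmE ffunE.
  have ee : e \in exps M k by rewrite inE em mk eqxx.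
  by have := z (exist _ e ee); rewrite !ffunE /= em => ->.
apply/eqP/ffunP=> -[e ee]; rewrite !ffunE /=; apply/eqP/negPn/negP=> /h.
by apply/negP; case/andP: ee.
Qed.

Lemma mem_jvs r k (f : U k) : (f \in jvs r k) <-> in_ideal (theta a) r bad f.
Proof.
elim: r k f => [|r IH] k f /=.
  rewrite goodc_ker //; split; [exact: in_ideal_mono | exact: in_ideal_mono0].
rewrite in_idealS; case: k f => [|k] f.
  rewrite IH; split=> [h|[g hg]]; first by exists 0; rewrite mulr0 subr0.
  have := in_ideal_homog 0 hg; rewrite pihomogB pihomogM0 ?lin_homog // subr0 pihomog_dE //.
  exact: dhomog_is_dhomog.
split=> [/memv_addP[u uJ [v /memv_imgP[g _ ->] ->]]|[g hg]].
  by exists g; rewrite lfunE /= addrK; apply/IH.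
pose g' : U k := DHomog (pihomogP mdeg k g).
have := in_ideal_homog k.+1 hg; rewrite pihomogB pihomogM1 ?lin_homog //.
rewrite pihomog_dE; last exact: dhomog_is_dhomog.
move=> h; apply/memv_addP; exists (f - mulh r g'); first exact/IH.
by exists (mulh r g'); rewrite ?subrK // -[mulh r g'](lfunE (@mulh r k)) memv_img ?memvf.
Qed.

Definition hilb r k := (\dim {:U k} - \dim (jvs r k))%N.

Lemma dim_jvs_le r k : (\dim (jvs r k) <= \dim {:U k})%N.
Proof. exact/dimvS/subvf. Qed.

Lemma hilb0E M k : (k < M)%N -> hilb 0 k = #|exps M k|.
Proof.
move=> kM; rewrite /hilb /=.
have -> : lker (linfun (@goodc k.+1 k)) = lker (linfun (@goodc M k)).
  by apply/vspaceP=> f; apply/idP/idP => /goodc_ker h; apply/goodc_ker => //; apply: h.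
rewrite -(limg_ker_dim (linfun (@goodc M k)) fullv) capfv addKn.
have -> : limg (linfun (@goodc M k)) = fullv.
  apply/vspaceP=> c; rewrite memvf; apply/memv_imgP.
  pose f : {mpoly K[n]} := \sum_(e : {e | e \in exps M k}) c e *: 'X_[mexp (sval e)].
  have fh : f \is k.-homog.
    by apply: rpred_sum => -[e ee] _; apply: rpredZ; rewrite dhomogX /=; case/andP: (ee).
  exists (DHomog fh); rewrite ?memvf // lfunE /=; apply/ffunP=> e; rewrite ffunE /=.
  rewrite raddf_sum (bigD1 e) //= mcoeffZ mcoeffX eqxx mulr1 big1 ?addr0 // => e' ne.
  rewrite mcoeffZ mcoeffX; case: (_ =P _) => [E|_]; last by rewrite mulr0.
  case/eqP: ne; apply/val_inj/ffunP=> i; apply: val_inj.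
  by have := congr1 (fun m : 'X_{1..n} => m i) E; rewrite !mnmE.
by rewrite dimvf -[RHS]muln1 -card_sig.
Qed.

Lemma theta_neq0 r : theta a r != 0 -> forall m, injective (@mulh r m).
Proof.
move=> nz m f g /(congr1 val) /= /(mulfI nz) E; exact: val_inj.
Qed.

(** The short exact sequence of multiplication by a regular form: on subspaces, the ideal meets the
    multiples of theta_r exactly in theta_r times the ideal. *)
Lemma hilbS r k : upward bad -> theta a r != 0 ->
  (forall f : U k, in_ideal (theta a) r bad (theta a r * f) -> in_ideal (theta a) r bad f) ->
  (hilb r.+1 k.+1 + hilb r k = hilb r k.+1)%N.
Proof.
move=> up nz nzd; rewrite /hilb /=.
have lk : lker (linfun (@mulh r k)) = 0%VS.
  by apply/eqP/lker0P => f g; rewrite !lfunE /=; apply: theta_neq0.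
have cap : (jvs r k.+1 :&: limg (linfun (@mulh r k)) = linfun (@mulh r k) @: jvs r k)%VS.
  apply/vspaceP=> f; apply/memv_capP/memv_imgP.
    case=> fJ /memv_imgP[g _ fE]; exists g => //; apply/mem_jvs/nzd.
    by move: fJ; rewrite fE lfunE => /mem_jvs.
  case=> g gJ ->; split; last by rewrite memv_img ?memvf.
  rewrite lfunE; apply/mem_jvs => /=.
  by apply: in_idealM; rewrite -?mem_jvs.
have := dimv_sum_cap (jvs r k.+1) (limg (linfun (@mulh r k))).
rewrite cap !limg_dim_eq ?lk ?capv0 //.
have := dim_jvs_le r k; have := dim_jvs_le r k.+1; have := dim_jvs_le r.+1 k.+1 => /=.
move: (\dim _) (\dim _) (\dim _) (\dim _) (\dim _) => a1 a2 a3 a4 a5; clear; move: a1 a2 a3 a4 a5; rewrite /=; lia.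
Qed.

Lemma hilbS0 r : hilb r.+1 0 = hilb r 0.
Proof. by []. Qed.

End Hilbert.

(** * The Hilbert series of a star, computed modulo a power of X *)

Section TruncatedSeries.
Variable M : nat.
Implicit Types p q : {poly int}.

Definition eq_trunc p q := exists r, p = q + r * 'X^M.

Lemma eq_trunc_refl p : eq_trunc p p.
Proof. by exists 0; rewrite mul0r addr0. Qed.

Lemma eq_truncD p q p' q' : eq_trunc p q -> eq_trunc p' q' -> eq_trunc (p + p') (q + q').
Proof. by case=> r -> [r' ->]; exists (r + r'); ring. Qed.

Lemma eq_truncM p q p' q' : eq_trunc p q -> eq_trunc p' q' -> eq_trunc (p * p') (q * q').
Proof. by case=> r -> [r' ->]; exists (q * r' + q' * r + r * r' * 'X^M); ring. Qed.

Lemma eq_trunc_trans p q s : eq_trunc p q -> eq_trunc q s -> eq_trunc p s.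
Proof. by case=> r -> [r' ->]; exists (r + r'); ring. Qed.

Lemma eq_trunc_sum (I : finType) (P : pred I) (F G : I -> {poly int}) :
  (forall i, P i -> eq_trunc (F i) (G i)) -> eq_trunc (\sum_(i | P i) F i) (\sum_(i | P i) G i).
Proof.
move=> h; apply: (big_ind2 eq_trunc) => //; [exact: eq_trunc_refl | move=> *; exact: eq_truncD].
Qed.

Lemma eq_trunc_prod (I : finType) (P : pred I) (F G : I -> {poly int}) :
  (forall i, P i -> eq_trunc (F i) (G i)) -> eq_trunc (\prod_(i | P i) F i) (\prod_(i | P i) G i).
Proof.
move=> h; apply: (big_ind2 eq_trunc) => //; [exact: eq_trunc_refl | move=> *; exact: eq_truncM].
Qed.

Lemma eq_trunc_coef p q m : eq_trunc p q -> (m < M)%N -> p`_m = q`_m.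
Proof. by case=> r -> mM; rewrite coefD coefMXn mM addr0. Qed.

Lemma eq_trunc_of_coef p q : (forall m, (m < M)%N -> p`_m = q`_m) -> eq_trunc p q.
Proof.
move=> h; exists (drop_poly M (p - q)); rewrite -[LHS](subrK q) addrC; congr (_ + _).
rewrite -[LHS](poly_take_drop M) [take_poly _ _](_ : _ = 0) ?add0r //.
by apply/polyP=> i; rewrite coef_take_poly coef0 coefB; case: ifP => // /h ->; rewrite subrr.
Qed.

Lemma geometric_trunc : eq_trunc ((1 - 'X) * \sum_(j < M) 'X^j) 1.
Proof.
exists (-1).
have := subrX1 ('X : {poly int}) M => E.
have -> : (1 - 'X) * \sum_(j < M) 'X^j = - (('X - 1) * \sum_(j < M) 'X^j) :> {poly int} by ring.
by rewrite -E; ring.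
Qed.

End TruncatedSeries.

Section StarSeries.
Variables (n : nat) (D : {set {set 'I_n}}) (t : {set 'I_n}) (d : nat).
Hypothesis small : forall x, x \in D -> (#|x| <= d)%N.

(** The h-polynomial of the link of t, as a sum over the faces containing t. The star is a cone over
    iterated suspensions of no consequence for it: joining with the simplex t leaves the
    h-polynomial unchanged. *)
Definition star_series : {poly int} :=
  \sum_(x in D | t \subset x) 'X^(#|x| - #|t|) * (1 - 'X) ^+ (d - #|x|).

Variable M : nat.
Hypothesis M_gt0 : (0 < M)%N.

Definition face_ok (x : {set 'I_n}) w (j : 'I_M) := (w \in t) || ((w \in x) == (j != 0%N :> nat)).

Lemma face_ok_trunc (x : {set 'I_n}) w : t \subset x ->
  eq_trunc M ((if w \in x then 1 - 'X else 1) * \sum_(j < M | face_ok x w j) 'X^j)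
    (if w \in x :\: t then 'X else 1).
Proof.
move=> tx; rewrite inE /face_ok; have [wt|wt] /= := boolP (w \in t).
  by rewrite (subsetP tx _ wt); apply: geometric_trunc.
case: (boolP (w \in x)) => wx /=.
  have [r E] := geometric_trunc M; exists r; move: E.
  case: (M) M_gt0 => // M' _; rewrite big_ord_recl [in X in _ -> X]big_mkcond big_ord_recl /=.
  rewrite expr0 add0r => E.
  have -> : (\sum_(i < M') (if (lift ord0 i != 0%N :> nat) then 'X^(lift ord0 i) else 0))
     = \sum_(i < M') 'X^(lift ord0 i) :> {poly int} by [].
  move: E; set S := \sum_(i < _) _ => E.
  have -> : (1 - 'X) * S = (1 - 'X) * (1 + S) - (1 - 'X) by ring.
  by rewrite E; ring.
rewrite mul1r (big_pred1 (Ordinal M_gt0)) ?expr0; first exact: eq_trunc_refl.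
by move=> j; apply/eqP/eqP => [E|->//]; apply: val_inj => /=; move: E; case: (nat_of_ord j).
Qed.

Lemma star_monomials (x : {set 'I_n}) : t \subset x ->
  \sum_(e : {ffun 'I_n -> 'I_M} | msup (mexp e) :|: t == x) 'X^(mdeg (mexp e))
  = \prod_w \sum_(j < M | face_ok x w j) 'X^j :> {poly int}.
Proof.
move=> tx.
rewrite (bigA_distr_big_dep (fun w j => face_ok x w j) (fun w (j : 'I_M) => 'X^j)) /=.
apply: eq_big => [e|e _]; last by rewrite mdegE -expr_sum; congr (_ ^+ _); apply: eq_bigr => w _; rewrite mnmE.
apply/eqP/familyP=> [E w|h].
  rewrite unfold_in /face_ok; case: (boolP (w \in t)) => //= wt.
  by move/setP/(_ w): E; rewrite !inE (negbTE wt) orbF mnmE => ->.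
apply/setP=> w; have := h w; rewrite unfold_in /face_ok !inE mnmE.
by case: (boolP (w \in t)) => [/(subsetP tx) ->|_] /=; rewrite ?orbT ?orbF // => /eqP.
Qed.

(** Monomials are sorted by x, the union of t with the support. Each vertex of x absorbs one factor
    1 - X of (1-X)^d, and its geometric series becomes 1 on t and X on the rest of x. *)
Lemma star_count :
  eq_trunc M ((1 - 'X) ^+ d *
    \sum_(e : {ffun 'I_n -> 'I_M} | msup (mexp e) :|: t \in D) 'X^(mdeg (mexp e)))
  star_series.
Proof.
rewrite (partition_big (fun e : {ffun 'I_n -> 'I_M} => msup (mexp e) :|: t)
  (fun x => (x \in D) && (t \subset x))) /=; last first.
  by move=> e ->; rewrite subsetUr.
rewrite mulr_sumr; apply: eq_trunc_sum => x /andP[xD tx].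
rewrite (eq_bigl (fun e => msup (mexp e) :|: t == x)); last first.
  by move=> e; case: eqP => [->|]; rewrite ?andbT ?andbF.
rewrite star_monomials //.
have -> : (1 - 'X) ^+ d = (1 - 'X) ^+ (d - #|x|) * \prod_w (if w \in x then 1 - 'X else 1) :> {poly int}.
  by rewrite -big_mkcond /= prodr_const -exprD subnK ?small.
rewrite -mulrA -big_split /= mulrC; apply: eq_truncM; last exact: eq_trunc_refl.
have -> : 'X^(#|x| - #|t|) = \prod_w (if w \in x :\: t then 'X else 1) :> {poly int}.
  by rewrite -big_mkcond /= prodr_const cardsD (setIidPr tx).
by apply: eq_trunc_prod => w _; apply: face_ok_trunc.
Qed.

End StarSeries.

(** Replacing X by 1/X and multiplying by X^(b+c) exchanges the two polynomials. This links the
    series of a star with the reversed form in which h-numbers are defined. *)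
Lemma binomial_reverse b c m : (m <= b + c)%N ->
  ('X^b * (1 - 'X) ^+ c : {poly int})`_m = (('X - 1) ^+ c : {poly int})`_(b + c - m).
Proof.
move=> mbc.
have E : (1 - 'X) ^+ c = \sum_(i < c.+1) ((-1) ^+ i * 'C(c, i)%:R) *: 'X^i :> {poly int}.
  rewrite exprDn; apply: eq_bigr => i _; rewrite expr1n mul1r (exprNn 'X) [in RHS]mulrC -scalerA scaler_nat.
  by rewrite -mul_polyC (rmorph_sign (@polyC int)) mulrC.
have E' : ('X - 1) ^+ c = \sum_(i < c.+1) ((-1) ^+ (c - i) * 'C(c, i)%:R) *: 'X^i :> {poly int}.
  rewrite addrC exprDn; apply: eq_bigr => i _; rewrite [in RHS]mulrC -scalerA scaler_nat.
  by rewrite -mul_polyC (rmorph_sign (@polyC int)).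
have coef (F : nat -> int) k : (\sum_(i < c.+1) F i *: 'X^i : {poly int})`_k = if (k <= c)%N then F k else 0.
  by rewrite -(poly_def c.+1 F) coef_poly ltnS.
rewrite coefXnM E E' (coef (fun i => (-1) ^+ i * 'C(c, i)%:R)).
rewrite (coef (fun i => (-1) ^+ (c - i) * 'C(c, i)%:R)).
case: (ltnP m b) => mb; first by rewrite ifF //; apply/negbTE; lia.
rewrite !ifT; [|lia|lia]; have -> : (b + c - m = c - (m - b))%N by lia.
by rewrite bin_sub ?subKn //; lia.
Qed.

(** * Dehn-Sommerville relations for links *)

Section DehnSommerville.
Variables (K : fieldType) (n d : nat) (D : {set {set 'I_n}}).
Hypothesis sphD : sphere_facts K d D.

Lemma sum_powers (R : comPzRingType) (t x : {set 'I_n}) (z : R) : t \subset x ->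
  \sum_(y : {set 'I_n} | (t \subset y) && (y \subset x)) z ^+ (#|x| - #|y|) = (1 + z) ^+ (#|x| - #|t|).
Proof.
move=> tx.
have -> : (1 + z) ^+ (#|x| - #|t|) = \prod_w (if w \in x :\: t then 1 + z else 1).
  by rewrite -big_mkcond /= prodr_const cardsD (setIidPr tx).
rewrite (eq_bigr (fun w => (if w \in x then 1 else 0) + (if w \in t then 0 else if w \in x then z else 1))); last first.
  move=> w _; rewrite inE; case: (boolP (w \in t)) => [/(subsetP tx) ->|_]; rewrite /= ?addr0 //.
  by case: (w \in x); rewrite ?add0r.
rewrite bigA_distr /= [RHS](bigID (fun y : {set 'I_n} => (t \subset y) && (y \subset x))) /= [X in _ + X]big1 ?addr0.
  apply: eq_big => [y|y /andP[ty yx]]; first by [].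
  have -> : z ^+ (#|x| - #|y|) = \prod_w (if w \in x :\: y then z else 1).
    by rewrite -big_mkcond /= prodr_const cardsD (setIidPr yx).
  apply: eq_bigr => w _; rewrite inE; case: (boolP (w \in y)) => [/(subsetP yx) -> //|wy] /=.
  by rewrite (contraNF (subsetP ty w) wy).
move=> y; rewrite negb_and => /orP[] /subsetPn[w]; [move=> wt wy | move=> wy wx].
  by rewrite (bigD1 w) //= (negbTE wy) wt mul0r.
by rewrite (bigD1 w) //= wy (negbTE wx) mul0r.
Qed.

(** Writing X = 1 + (X - 1) spreads the power of X belonging to x over the faces y between t and x.
    After exchanging the sums, the inner one is the Euler characteristic of the link of y up to
    sign, and it cancels to 1. *)
Lemma dehn_sommerville t : t \in D ->
  star_series D t d = \sum_(x in D | t \subset x) ('X - 1) ^+ (d - #|x|).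
Proof.
move=> tD; rewrite /star_series.
transitivity (\sum_(x in D | t \subset x) \sum_(y in D | (t \subset y) && (y \subset x))
   (-1) ^+ (d - #|x|) * ('X - 1) ^+ (d - #|y|) : {poly int}).
  apply: eq_bigr => x /andP[xD tx].
  have E : 'X = 1 + ('X - 1) :> {poly int} by ring.
  rewrite {1}E.
  rewrite -sum_powers // mulr_suml.
  apply: eq_big => [y|y /andP[_ yx]].
    by case: (boolP (y \subset x)) => [yx|]; rewrite ?andbF // (sf_down sphD xD yx).
  rewrite -(opprB 'X 1).
  have xd := sf_card sphD xD; have yx' := subset_leq_card yx.
  rewrite (exprNn ('X - 1)) mulrCA -exprD.
  by have -> : (#|x| - #|y| + (d - #|x|) = d - #|y|)%N by clear -xd yx'; lia.
rewrite (exchange_big_dep (fun y : {set _} => (y \in D) && (t \subset y))) /=; last by move=> x y _ /and3P[-> ->].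
apply: eq_bigr => y /andP[yD ty].
rewrite (eq_bigl (fun x => (x \in D) && (y \subset x))); last first.
  move=> x; rewrite yD ty /=; case: (boolP (y \subset x)) => yx; rewrite ?andbF //.
  by rewrite (subset_trans ty yx) !andbT.
rewrite -mulr_suml -[RHS]mul1r; congr (_ * _).
have -> : \sum_(x in D | y \subset x) (-1) ^+ (d - #|x|)
  = ((-1) ^+ d * \sum_(x in D | y \subset x) (-1) ^+ #|x| : int)%:P :> {poly int}.
  rewrite mulr_sumr rmorph_sum; apply: eq_bigr => x /andP[xD _].
  have xd := sf_card sphD xD; rewrite -{2}(subnK xd) exprD -mulrA -exprD addnn.
  by rewrite -mul2n exprM sqrrN expr1n mulr1 rmorphXn rmorphN rmorph1.
by rewrite (sf_euler sphD yD) -exprD addnn -mul2n exprM sqrrN !expr1n.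
Qed.

Lemma star_series_sym t m : t \in D -> (m <= d - #|t|)%N ->
  (star_series D t d)`_m = (star_series D t d)`_(d - #|t| - m).
Proof.
move=> tD mt; rewrite [in RHS]dehn_sommerville // /star_series !coef_sum.
apply: eq_bigr => x /andP[xD tx]; have xd := sf_card sphD xD; have tx' := subset_leq_card tx.
rewrite binomial_reverse; first by congr (_`_ _); lia.
by lia.
Qed.

Lemma star_series_size t : t \in D -> (size (star_series D t d) <= (d - #|t|).+1)%N.
Proof.
move=> tD; rewrite dehn_sommerville //; apply: (leq_trans (size_sum _ _ _)).
apply/bigmax_leqP => x /andP[xD tx]; have tx' := subset_leq_card tx.
by rewrite -[1]/(1%:P) size_exp_XsubC ltnS leq_sub2l.
Qed.

Lemma star_series_total t : t \in D ->
  \sum_(m < (d - #|t|).+1) (star_series D t d)`_m = #|[set F in D | (t \subset F) && (#|F| == d)]|%:Z.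
Proof.
move=> tD; have := horner_coef_wide 1 (star_series_size tD).
under eq_bigr do rewrite expr1n mulr1; move=> <-.
rewrite dehn_sommerville // horner_sum.
rewrite -sum1_card -natz natr_sum.
rewrite (eq_bigr (fun x : {set 'I_n} => (#|x| == d)%:R)); last first.
  move=> x /andP[xD _]; have xd := sf_card sphD xD.
  by rewrite horner_exp hornerD hornerX hornerN hornerC subrr expr0n subn_eq0 eqn_leq xd.
rewrite big_mkcond [RHS]big_mkcond; apply: eq_bigr => x _; rewrite inE.
by case: (x \in D) => //=; case: (t \subset x) => //=; case: eqP.
Qed.

End DehnSommerville.

Section StarHilbert.
Variables (K : fieldType) (n' d : nat).
Local Notation n := n'.+1.
Local Notation U m := (dhomog n K m).
Variables (D : {set {set 'I_n}}) (a : nat -> 'I_n -> K).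
Hypothesis sphD : sphere_facts K d D.
Hypothesis char2 : 2%N \in [pchar K].
Hypothesis gen : generic a d.

Section OneStar.
Variable t : {set 'I_n}.
Hypothesis tD : t \in D.

Local Notation hilbt := (hilb a (off_star D t)).

Lemma theta_nz r : (r < d)%N -> theta a r != 0.
Proof.
move=> rd; have [F [FD _ cF]] := sf_facet sphD (sf_empty sphD).
have := arow_not_killed gen rd (_ : r < #|F|)%N; rewrite cF => /(_ rd).
apply: contraNneq => z; have -> : arow a r = 0; last exact: sub0mx.
by apply/rowP=> i; rewrite -lin_coeff -/(theta a r) z mcoeff0 mxE.
Qed.

Lemma hilb_step r k : (r < d)%N -> (hilbt r.+1 k.+1 + hilbt r k = hilbt r k.+1)%N.
Proof.
move=> rd; apply: hilbS; [exact: off_star_up sphD t | exact: theta_nz |].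
by move=> f; apply: (star_nzd sphD char2 gen tD rd).
Qed.

Lemma hilb_trunc M r : (r <= d)%N ->
  eq_trunc M (\poly_(m < M) (hilbt r m)%:Z) ((1 - 'X) ^+ r * \poly_(m < M) (hilbt 0 m)%:Z).
Proof.
elim: r => [|r IH] rd; first by rewrite expr0 mul1r; apply: eq_trunc_refl.
apply: (eq_trunc_trans (q := (1 - 'X) * \poly_(m < M) (hilbt r m)%:Z)).
  apply: eq_trunc_of_coef => m mM.
  rewrite mulrBl mul1r coefB coefXM !coef_poly mM; case: m mM => [|m] mM /=.
    by rewrite subr0 hilbS0.
  by rewrite (ltnW mM) -(hilb_step m rd) PoszD addrK.
by rewrite exprS -mulrA; apply: eq_truncM (eq_trunc_refl _ _) (IH (ltnW rd)).
Qed.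

Lemma hilb_series m : (hilbt d m)%:Z = (star_series D t d)`_m.
Proof.
have /eq_trunc_coef/(_ (ltnSn m)) := hilb_trunc m.+1 (leqnn d).
rewrite coef_poly ltnSn => ->.
have /eq_trunc_coef/(_ (ltnSn m)) := @star_count _ D t d (fun x => @sf_card _ _ _ _ sphD x) m.+1 (ltn0Sn m).
move=> <-; apply: eq_trunc_coef (ltnSn m).
apply: eq_truncM; first exact: eq_trunc_refl.
apply: eq_trunc_of_coef => k km; rewrite coef_poly km (hilb0E _ _ km).
rewrite coef_sum -sum1_card -natz natr_sum big_mkcond [RHS]big_mkcond /=.
apply: eq_bigr => e _; rewrite inE coefXn /off_star negbK eq_sym.
by case: (_ \in D); case: (_ == _).
Qed.

Lemma hilb_partial m : (0 < d)%N -> (\sum_(k < m.+1) hilbt d k = hilbt d.-1 m)%N.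
Proof.
move=> d_gt0; have dE : d = d.-1.+1 by rewrite prednK.
elim: m => [|m IH]; first by rewrite big_ord1 {1}dE.
rewrite big_ord_recr /= IH {2}dE addnC hilb_step //; lia.
Qed.

Lemma hilb_sym m : (m <= d - #|t|)%N -> hilbt d m = hilbt d (d - #|t| - m).
Proof. by move=> mt; apply/eqP; rewrite -eqz_nat !hilb_series (star_series_sym sphD). Qed.

Definition star_facets := [set F in D | (t \subset F) && (#|F| == d)].

Lemma hilb_total : (\sum_(k < (d - #|t|).+1) hilbt d k = #|star_facets|)%N.
Proof.
apply/eqP; rewrite -eqz_nat -(star_series_total sphD tD) -natz natr_sum.
by apply/eqP/eq_bigr => k _; rewrite natz hilb_series.
Qed.

(** One form less turns the Hilbert function into its partial sums; by symmetry the sums up to m and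
    up to d - |t| - m - 1 together exhaust the total. This is the dimension count behind duality. *)
Lemma hilb_complement m : (0 < d)%N -> (m < d - #|t|)%N ->
  (hilbt d.-1 m + hilbt d.-1 (d - #|t| - m.+1) = #|star_facets|)%N.
Proof.
move=> d_gt0 mt; rewrite -hilb_total -!hilb_partial //.
set e := (d - #|t|)%N in mt *.
have -> : (\sum_(k < (e - m.+1).+1) hilbt d k = \sum_(m.+1 <= k < e.+1) hilbt d k)%N.
  rewrite -(add0n m.+1) big_addn big_mkord (_ : e.+1 - m.+1 = (e - m.+1).+1)%N; last by lia.
  rewrite (reindex_inj rev_ord_inj) /=; apply: eq_bigr => k _.
  have := ltn_ord k; rewrite ltnS => ke; rewrite hilb_sym -/e; last by lia.
  congr (hilb _ _ _ _); move: mt (nat_of_ord k) ke; clearbody e; clear; move=> mt k ke; rewrite add0n in ke *; lia.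
by rewrite -(big_mkord xpredT (hilbt d)) -big_cat_nat //=; [rewrite big_mkord | lia].
Qed.

End OneStar.
End StarHilbert.

(** * The degree map and Poincare duality *)

Section Points.
Variables (K : fieldType) (n d' : nat).
Local Notation d := d'.+1.
Variable a : nat -> 'I_n -> K.
Hypothesis char2 : 2%N \in [pchar K].
Hypothesis gen : generic a d.

Definition colmx (f : 'I_d -> 'I_n) : 'M[K]_d := \matrix_(r, c) a r (f c).
Definition dt f := \det (colmx f).
(** The coordinates, extended by 0, of the point supported on f at which the forms 0, ..., d-2
    vanish and form d-1 takes the value 1: the last column of the inverse matrix. *)
Definition zpt (f : 'I_d -> 'I_n) (w : 'I_n) : K :=
  \sum_c (f c == w)%:R * invmx (colmx f) c ord_max.

Section OnePoint.
Variable f : 'I_d -> 'I_n.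
Hypothesis f_inj : injective f.

Lemma dt_neq0 : dt f != 0.
Proof. by apply: gen. Qed.

Lemma colmx_unit : colmx f \in unitmx.
Proof. by rewrite unitmxE unitfE dt_neq0. Qed.

Lemma zpt_col c : zpt f (f c) = invmx (colmx f) c ord_max.
Proof.
rewrite /zpt (bigD1 c) //= eqxx mul1r big1 ?addr0 // => c' ne.
by rewrite (inj_eq f_inj) (negbTE ne) mul0r.
Qed.

Lemma zpt_off w : (forall c, f c != w) -> zpt f w = 0.
Proof. by move=> h; rewrite /zpt big1 // => c _; rewrite (negbTE (h c)) mul0r. Qed.

Lemma sum_zpt (v : 'I_n -> K) : \sum_w v w * zpt f w = \sum_c v (f c) * invmx (colmx f) c ord_max.
Proof.
under eq_bigr do rewrite /zpt mulr_sumr.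
rewrite exchange_big; apply: eq_bigr => c _ /=.
rewrite (bigD1 (f c)) //= eqxx mul1r big1 ?addr0 // => w ne.
by rewrite eq_sym (negbTE ne) mul0r mulr0.
Qed.

Lemma form_zpt (r : 'I_d) : \sum_w a r w * zpt f w = (r == ord_max)%:R.
Proof.
rewrite sum_zpt; have := congr1 (fun M : 'M_d => M r ord_max) (mulmxV colmx_unit).
by rewrite !mxE => <-; apply: eq_bigr => c _; rewrite mxE.
Qed.

(** Cramer's rule. The minor on the right omits the vertex c and the last row, so it belongs to a
    ridge rather than to the facet. *)
Lemma dt_zpt c : dt f * zpt f (f c) =
  (-1) ^+ (d' + c) * \det (\matrix_(i < d', j < d') a i (f (lift c j))).
Proof.
rewrite zpt_col /invmx colmx_unit !mxE mulrA divff ?dt_neq0 // mul1r /cofactor.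
congr (_ * \det _); apply/matrixP=> i j; rewrite !mxE; congr a.
by rewrite /= /bump leqNgt ltn_ord.
Qed.

Lemma zpt_neq0 c : zpt f (f c) != 0.
Proof.
have : dt f * zpt f (f c) != 0; last by rewrite mulf_eq0 negb_or => /andP[].
rewrite dt_zpt mulf_eq0 signr_eq0 /=; apply: gen => // i j /f_inj /lift_inj //.
Qed.

End OnePoint.

(** Reordering the columns multiplies by a permutation matrix, whose determinant has square 1 and is
    therefore 1. Minors thus depend only on the set of columns. *)
Lemma det_perm_char2 k (f g : 'I_k -> 'I_n) : injective f -> injective g ->
  (forall c, exists c', f c = g c') ->
  \det (\matrix_(r < k, c < k) a r (f c)) = \det (\matrix_(r < k, c < k) a r (g c)).
Proof.
move=> fi gi fg.
pose P : 'M[K]_k := \matrix_(c, c') (g c == f c')%:R.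
have -> : \matrix_(r < k, c < k) a r (f c) = \matrix_(r < k, c < k) a r (g c) *m P.
  apply/matrixP=> r c; rewrite !mxE; have [c' E] := fg c.
  rewrite (bigD1 c') //= !mxE E eqxx mulr1 big1 ?addr0 // => j ne.
  by rewrite !mxE E (inj_eq gi) (negbTE ne) mulr0.
have PP : P^T *m P = 1%:M.
  apply/matrixP=> c e; rewrite !mxE; have [c' E] := fg c.
  rewrite (bigD1 c') //= !mxE -E eqxx mul1r (inj_eq fi) big1 ?addr0 // => j ne.
  by rewrite !mxE E (inj_eq gi) (negbTE ne) mul0r.
have detP : \det P = 1.
  have := congr1 determinant PP; rewrite det_mulmx det_tr det1 => E.
  apply/eqP; rewrite -subr_eq0; suff : (\det P - 1) ^+ 2 == 0 by rewrite expf_eq0.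
  by rewrite sqrrB expr1n mulr1 mulr2n (addrr_pchar2 char2) subr0 expr2 E (addrr_pchar2 char2).
by rewrite det_mulmx detP mulr1.
Qed.

Definition facet_enum (F : {set 'I_n}) (w0 : 'I_n) (i : 'I_d) : 'I_n := nth w0 (enum F) i.

Variable w0 : 'I_n.
Implicit Types (F : {set 'I_n}).
Local Notation fe F := (facet_enum F w0).

Lemma facet_enum_inj (F : {set 'I_n}) : #|F| = d -> injective (fe F).
Proof.
move=> cF i j E; apply: ord_inj; apply/eqP.
rewrite -(nth_uniq w0 (s := enum F)) ?enum_uniq -?cardE ?cF //.
exact/eqP.
Qed.

Lemma facet_enum_in (F : {set 'I_n}) i : #|F| = d -> fe F i \in F.
Proof. by move=> cF; rewrite -mem_enum mem_nth // -cardE cF. Qed.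

Lemma facet_enum_surj (F : {set 'I_n}) w : #|F| = d -> w \in F -> exists i, w = fe F i.
Proof.
move=> cF wF; have lt : (index w (enum F) < d)%N by rewrite -cF cardE index_mem mem_enum.
by exists (Ordinal lt); rewrite /facet_enum /= nth_index // mem_enum.
Qed.

Definition zF (F : {set 'I_n}) := zpt (fe F).

Lemma zFE (F : {set 'I_n}) : zF F = zpt (fe F).
Proof. by []. Qed.

Lemma zF_neq0 F w : #|F| = d -> w \in F -> zF F w != 0.
Proof.
move=> cF wF; have [i ->] := facet_enum_surj cF wF.
by apply: zpt_neq0; apply: facet_enum_inj.
Qed.

Lemma zF_off F w : #|F| = d -> w \notin F -> zF F w = 0.
Proof.
move=> cF wF; apply: zpt_off => c; apply: contraNneq wF => <-; exact: facet_enum_in.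
Qed.

Lemma theta_zF F r : #|F| = d -> (r < d)%N -> (theta a r).@[zF F] = (r == d')%:R.
Proof.
move=> cF rd; rewrite thetaE raddf_sum /=.
under eq_bigr do rewrite mevalZ mevalXU.
exact: (form_zpt (facet_enum_inj cF) (Ordinal rd)).
Qed.

Lemma mnm_zF F (m : 'X_{1..n}) : #|F| = d -> ~~ (msup m \subset F) -> ('X_[m]).@[zF F] = 0.
Proof.
move=> cF /subsetPn[w]; rewrite inE => mw wF.
by rewrite mevalX (bigD1 w) //= zF_off // expr0n (negbTE mw) mul0r.
Qed.

(** In coordinates with respect to the forms restricted to F, the value at z_F is the last
    coordinate; if it is 0, only the first d-1 forms and variables outside F remain. *)
Lemma killed_zF F (v : 'rV[K]_n) : #|F| = d -> \sum_w v 0 w * zF F w = 0 -> (v <= killed a d' F)%MS.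
Proof.
move=> cF vz; have fi := facet_enum_inj cF.
pose y := (\row_c v 0 (fe F c)) *m invmx (colmx (fe F)).
have y0 : y 0 ord_max = 0.
  by rewrite -[RHS]vz /zF (sum_zpt _ (fun w => v 0 w)) mxE; apply: eq_bigr => c _; rewrite mxE.
have yM c : \sum_r y 0 r * a r (fe F c) = v 0 (fe F c).
  have : (y *m colmx (fe F)) 0 c = v 0 (fe F c) by rewrite mulmxKV ?colmx_unit // mxE.
  by rewrite mxE => <-; apply: eq_bigr => r _; congr (_ * _); rewrite mxE.
clearbody y.
rewrite -[v](subrK (\sum_(r < d') y 0 (widen_ord (leqnSn d') r) *: arow a r)).
apply: addmx_sub; last first.
  apply: summx_sub => r _; apply: scalemx_sub; apply: arow_killed; exact: ltn_ord.
rewrite [X in (X <= _)%MS]row_sum_delta; apply: summx_sub => w _.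
have [wF|wF] := boolP (w \in F); last by apply/scalemx_sub/delta_killed.
have [c ->] := facet_enum_surj cF wF.
rewrite !mxE -yM big_ord_recr /= y0 mul0r addr0 summxE.
under [X in _ - X]eq_bigr do rewrite !mxE.
by rewrite subrr scale0r sub0mx.
Qed.

Lemma comp_scaled_form k (p : {mpoly K[n]}) (z : 'I_n -> K) (l : {mpoly K[n]}) : p \is k.-homog ->
  p \mPo [tuple z i *: l | i < n] = p.@[z] *: l ^+ k.
Proof.
move=> /dhomogP ph; rewrite comp_mpolyEX [in RHS](mpolyE p) raddf_sum scaler_suml /=.
apply: eq_big_seq => m /ph mk; rewrite mevalZ mevalX comp_mpolyX -scalerA; congr (_ *: _).
under eq_bigr do rewrite tnth_mktuple exprZn.
rewrite scaler_prod; congr (_ *: _); by rewrite -mk /= mdegE expr_sum.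
Qed.

(** Modulo the first d-1 forms and the variables outside F, each X_i is z_F(i) theta_(d-1), so a
    form p of degree k becomes p(z_F) theta_(d-1)^k. *)
Lemma eval0_in_ideal F k (p : {mpoly K[n]}) : #|F| = d -> p \is k.-homog -> p.@[zF F] = 0 ->
  in_ideal (theta a) d' (not_sub F) p.
Proof.
move=> cF ph pz.
pose lq := [tuple zF F i *: theta a d' | i < n].
have -> : p = p - (p \mPo lq) by rewrite (comp_scaled_form _ _ ph) pz scale0r subr0.
apply: subst_diff; first exact: not_sub_up.
move=> i; rewrite tnth_mktuple -lin_delta /theta -linearZ -raddfB.
apply/lin_killed/killed_zF => //.
under eq_bigr do rewrite !mxE mulrBl.
rewrite sumrB (bigD1 i) //= !eqxx mul1r big1 ?addr0; last first.
  by move=> w ne; rewrite (negbTE ne) ?andbF mul0r.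
under eq_bigr do rewrite -mulrA.
rewrite -mulr_sumr (form_zpt (facet_enum_inj cF) ord_max) eqxx mulr1 subrr //.
Qed.

End Points.

Section DegreeMap.
Variables (K : fieldType) (n d' : nat) (w0 : 'I_n).
Local Notation d := d'.+1.
Variables (D : {set {set 'I_n}}) (a : nat -> 'I_n -> K).
Hypothesis sphD : sphere_facts K d D.
Hypothesis char2 : 2%N \in [pchar K].
Hypothesis gen : generic a d.
Implicit Types (F t : {set 'I_n}) (p : {mpoly K[n]}).

Local Notation theta := (theta a).
Local Notation zF := (zF d' a w0).
Let dD := sf_down sphD.

Definition facets := [set F in D | #|F| == d].

Lemma facetsP F : reflect (F \in D /\ #|F| = d) (F \in facets).
Proof. by rewrite inE; apply: (iffP andP) => -[? /eqP ?]. Qed.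

Definition mset t : 'X_{1..n} := [multinom (i \in t : nat) | i < n].
Definition xset t : {mpoly K[n]} := 'X_[mset t].

Lemma msup_mset t : msup (mset t) = t.
Proof. by apply/setP=> i; rewrite inE mnmE; case: (i \in t). Qed.

Lemma mdeg_mset t : mdeg (mset t) = #|t|.
Proof.
rewrite mdegE -sum1_card [RHS]big_mkcond; apply: eq_bigr => i _; rewrite mnmE.
by case: (i \in t).
Qed.

Lemma xset_homog t : xset t \is #|t|.-homog.
Proof. by rewrite dhomogX /= mdeg_mset. Qed.

Lemma xset_eval t (z : 'I_n -> K) : (xset t).@[z] = \prod_(w in t) z w.
Proof.
rewrite mevalX [RHS]big_mkcond; apply: eq_bigr => w _; rewrite mnmE.
by case: (w \in t); rewrite ?expr1 ?expr0.
Qed.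

Lemma xset_zF t F : F \in facets -> ~~ (t \subset F) -> (xset t).@[zF F] = 0.
Proof. by move=> /facetsP[_ cF] tF; apply: mnm_zF; rewrite ?msup_mset. Qed.

Definition dtF F : K := dt a (facet_enum (d' := d') F w0).

(** By Cramer's rule this is, up to sign, det^(d-1) divided by the product of the minors of the d
    ridges of F. *)
Definition wt F : K := (dtF F * \prod_(w in F) zF F w)^-1.

Lemma wt_neq0 F : F \in facets -> wt F != 0.
Proof.
move=> /facetsP[_ cF]; rewrite invr_eq0 mulf_eq0 negb_or dt_neq0 //=; last exact: facet_enum_inj.
by apply/prodf_neq0 => w wF; apply: zF_neq0.
Qed.

Definition psi p : K := \sum_(F in facets) wt F * p.@[zF F].

Lemma psi_is_linear : linear_for *%R psi.
Proof.
move=> c p q; rewrite /psi mulr_sumr -big_split; apply: eq_bigr => F _ /=.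
by rewrite mevalD mevalZ mulrDr mulrCA.
Qed.

HB.instance Definition _ := GRing.isLinear.Build K {mpoly K[n]} K *%R psi psi_is_linear.

Lemma in_ideal_eval0 t p F : in_ideal theta d' (off_star D t) p -> F \in facets -> t \subset F ->
  p.@[zF F] = 0.
Proof.
case=> g hg /facetsP[FD cF] tF.
rewrite -[p](subrK (\sum_(s < d') theta s * g s)) mevalD [X in _ + X]raddf_sum /=.
rewrite [X in _ + X]big1 ?addr0 => [|s _]; last first.
  by rewrite mevalM (theta_zF gen) // ?ltn_eqF ?mul0r // ltnW // ltnS.
rewrite [p - _]mpolyE raddf_sum big_seq big1 //= => m; rewrite mcoeff_msupp => /hg off.
rewrite mevalZ (mnm_zF a w0 cF) ?mulr0 //.
by apply: contraNN off => mF; apply: dD FD _; rewrite subUset mF.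
Qed.

(** Membership is decided on single facets, and there by one value. Evaluation at the facets through
    t is therefore injective on the graded pieces of the ring of the star modulo d-1 forms. *)
Lemma eval0_in_star t k p : t \in D -> p \is k.-homog ->
  (forall F, F \in facets -> t \subset F -> p.@[zF F] = 0) -> in_ideal theta d' (off_star D t) p.
Proof.
move=> tD ph hp; apply: (in_ideal_facets sphD char2 gen tD (ltnSn d')) => F FD tF cF.
by apply: (eval0_in_ideal gen (w0 := w0) cF ph); apply: hp => //; apply/facetsP.
Qed.

Lemma psi_in_ideal t p : in_ideal theta d' (off_star D t) p -> psi (xset t * p) = 0.
Proof.
move=> hp; rewrite /psi big1 // => F FF; rewrite mevalM.
have [tF|tF] := boolP (t \subset F); last by rewrite xset_zF ?mul0r ?mulr0.
by rewrite (in_ideal_eval0 hp) ?mulr0.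
Qed.

Lemma xset0 : xset set0 = 1.
Proof.
rewrite /xset (_ : mset set0 = 0%MM) ?mpolyX0 //.
by apply/mnmP=> i; rewrite mnmE inE mnm0E.
Qed.

Lemma xset_setD1 t v : v \in t -> xset t = 'X_v * xset (t :\ v).
Proof.
move=> vt; rewrite /xset -mpolyXD; congr 'X_[_]; apply/mnmP=> w; rewrite mnmDE mnm1E !mnmE in_setD1.
by rewrite (eq_sym v); case: (eqVneq w v) => [->|]; rewrite ?vt.
Qed.

(* The weight of a facet F is determined, up to the values on a ridge t of F,
   by a minor that only depends on t; the two facets through t cancel. *)
Lemma psi_ridge t : t \in D -> #|t| = d' -> psi (xset t) = 0.
Proof.
move=> tD ct; rewrite /psi (bigID (fun F : {set 'I_n} => t \subset F)) /= [X in _ + X]big1 ?addr0; last first.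
  by move=> F /andP[FF tF]; rewrite xset_zF ?mulr0.
pose g (i : 'I_d') := nth w0 (enum t) i.
have g_inj : injective g.
  move=> i j E; apply: ord_inj; apply/eqP.
  by rewrite -(nth_uniq w0 (s := enum t)) ?enum_uniq -?cardE ?ct //; apply/eqP.
pose mt := \det (\matrix_(i < d', j < d') a i (g j)).
have val F : F \in facets -> t \subset F -> wt F * (xset t).@[zF F] = mt^-1.
  move=> FF tF; case/facetsP: (FF) => FD cF.
  have /cards1P[u uE] : #|F :\: t| == 1%N by rewrite cardsD (setIidPr tF) cF ct subSnn.
  have : u \in F :\: t by rewrite uE set11.
  rewrite inE => /andP[ut uF].
  have [c uc] := facet_enum_surj w0 cF uF; have fi := @facet_enum_inj n d' w0 F cF.
  have mE : dtF F * zF F u = mt.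
    rewrite uc zFE dt_zpt // (oppr_pchar2 char2) expr1n mul1r; apply: det_perm_char2 => // [i j /fi/lift_inj //|j].
    set w := facet_enum _ _ _; have wt : w \in t.
      have : w \notin F :\: t by rewrite uE inE uc (inj_eq fi) eq_sym neq_lift.
      by rewrite inE facet_enum_in // andbT negbK.
    have lt : (index w (enum t) < d')%N by rewrite -ct cardE index_mem mem_enum.
    by exists (Ordinal lt); rewrite /g nth_index // mem_enum.
  have Fu : F = u |: t by rewrite -(setDUK tF) uE.
  rewrite xset_eval /wt -mE.
  have -> : \prod_(w in F) zF F w = zF F u * \prod_(w in t) zF F w.
    by rewrite {1}Fu big_setU1.
  have p0 : \prod_(w in t) zF F w != 0.
    by apply/prodf_neq0 => w wt; apply: (zF_neq0 gen w0) => //; apply: (subsetP tF).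
  by rewrite mulrA invfM -mulrA mulVf // mulr1.
rewrite (eq_bigr (fun=> mt^-1)) => [|F /andP[]]; last exact: val.
rewrite (eq_bigl (mem [set F in D | (t \subset F) && (#|F| == d)])); last first.
  by move=> F; rewrite /= !inE andbA andbAC.
by rewrite sumr_const (sf_ridge sphD tD) ?ct // mulr2n (addrr_pchar2 char2).
Qed.

Section Squarefree.
Variable r : nat.
Hypothesis rd : (r <= d)%N.

Definition squarefree_rep m p := exists c : {set 'I_n} -> K,
  in_ideal theta r (off_star D set0) (p - \sum_(s in D | #|s| == m) c s *: xset s).

Lemma squarefree_rep0 m : squarefree_rep m 0.
Proof. by exists (fun=> 0); rewrite big1 ?subrr; [apply: in_ideal0 | move=> *; rewrite scale0r]. Qed.

Lemma squarefree_repP m k p q : squarefree_rep m p -> squarefree_rep m q -> squarefree_rep m (k *: p + q).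
Proof.
case=> c hc [c' hc']; exists (fun s => k * c s + c' s).
under eq_bigr do rewrite scalerDl -scalerA.
rewrite big_split /= -scaler_sumr opprD addrACA -scalerBr.
by apply: in_idealD => //; apply: in_idealZ.
Qed.

Lemma squarefree_rep_sum m (I : finType) (P : pred I) (c : I -> K) (F : I -> {mpoly K[n]}) :
  (forall i, P i -> squarefree_rep m (F i)) -> squarefree_rep m (\sum_(i | P i) c i *: F i).
Proof.
move=> h; apply: (big_rec (squarefree_rep m)); first exact: squarefree_rep0.
by move=> i p Pi hp; apply: squarefree_repP => //; apply: h.
Qed.

Lemma squarefree_rep_eq m p q : in_ideal theta r (off_star D set0) (p - q) ->
  squarefree_rep m q -> squarefree_rep m p.
Proof.
move=> pq [c hc]; exists c; rewrite -(subrK q p) -addrA.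
exact: in_idealD.
Qed.

(** A row of the inverse of the minor on s combines the first |s| forms into one that restricts to
    X_w on s. *)
Lemma dual_form (s : {set 'I_n}) w : (#|s| <= r)%N -> w \in s ->
  exists v : 'I_n -> K, (forall u, u \in s -> v u = (u == w)%:R) /\
    in_ideal theta r (off_star D set0) (\sum_u v u *: 'X_u).
Proof.
move=> sr ws; pose k := #|s|.
pose e (i : 'I_k) : 'I_n := enum_val i.
have e_inj : injective e by apply: enum_val_inj.
pose M := \matrix_(i < k, j < k) a i (e j).
have Mu : M \in unitmx by rewrite unitmxE unitfE; apply: gen => //; apply: leq_trans sr rd.
pose j0 := enum_rank_in ws w.
pose y := row j0 (invmx M).
have yM j : \sum_i y 0 i * a i (e j) = (j == j0)%:R.
  have : (y *m M) 0 j = (j == j0)%:R by rewrite -row_mul mulVmx // !mxE eq_sym.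
  by rewrite mxE => <-; apply: eq_bigr => i _; congr (_ * _); rewrite mxE.
exists (fun u => \sum_i y 0 i * a i u); split=> [u us|].
  have uE : u = e (enum_rank_in ws u) by rewrite /e enum_rankK_in.
  rewrite {1}uE yM; congr (nat_of_bool _)%:R.
  by apply/eqP/eqP => [E|->//]; rewrite uE E /e enum_rankK_in.
have -> : \sum_u (\sum_i y 0 i * a i u) *: 'X_u = \sum_(i < k) y 0 i *: theta i.
  under eq_bigr do rewrite scaler_suml.
  rewrite exchange_big; apply: eq_bigr => i _; rewrite thetaE scaler_sumr.
  by apply: eq_bigr => u _; rewrite scalerA.
apply: in_ideal_sum => i _; apply: in_idealZ; rewrite -[theta i]mulr1.
by apply: in_ideal_theta; apply: leq_trans sr.
Qed.

Lemma msup_lt_mdeg (M : 'X_{1..n}) w : (1 < M w)%N -> (#|msup M| < mdeg M)%N.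
Proof.
move=> Mw; have wM : w \in msup M by rewrite inE -lt0n ltnW.
rewrite mdegE (bigD1 w) //= (cardsD1 w) wM.
have -> : #|msup M :\ w| = (\sum_(i < n | i != w) (i \in msup M))%N.
  rewrite -sum1_card big_mkcond [RHS]big_mkcond; apply: eq_bigr => i _; rewrite in_setD1.
  by case: (i != w); case: (i \in msup M).
apply: leq_ltn_trans (_ : (1 + \sum_(i < n | i != w) M i < _)%N); last by rewrite ltn_add2r.
by rewrite leq_add2l; apply: leq_sum => i _; rewrite inE; case: (M i).
Qed.

Lemma squarefree_off m (M : 'X_{1..n}) : msup M \notin D -> squarefree_rep m 'X_[M].
Proof.
move=> MD; apply: (squarefree_rep_eq (q := 0)); last exact: squarefree_rep0.
rewrite subr0; apply: in_ideal_mono => M'; rewrite mcoeffX.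
by case: (M =P M') => [<- _|_]; rewrite ?eqxx // /off_star setU0.
Qed.

Lemma squarefree_mset m (M : 'X_{1..n}) : msup M \in D -> mdeg M = m ->
  (forall w, (M w <= 1)%N) -> squarefree_rep m 'X_[M].
Proof.
move=> MD dM M1.
have ME : M = mset (msup M).
  by apply/mnmP=> i; rewrite mnmE inE; have := M1 i; case: (M i) => [|[|?]].
exists (fun s => (s == msup M)%:R); rewrite (bigD1 (msup M)) /=; last first.
  by rewrite MD -dM {2}ME mdeg_mset eqxx.
rewrite eqxx scale1r big1 ?addr0; last by move=> s /andP[_ /negbTE ->]; rewrite scale0r.
by rewrite /xset -ME subrr; apply: in_ideal0.
Qed.

(** A repeated factor X_w is traded, through [dual_form], for variables outside the support. The
    support grows while the degree stays, so the process stops at squarefree monomials. *)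
Lemma squarefree_mono m (M : 'X_{1..n}) : (m <= r)%N -> mdeg M = m -> squarefree_rep m 'X_[M].
Proof.
move=> mr; move E: (m - #|msup M|)%N => k; elim: k M E => [|k IH] M E dM.
  have [MD|MD] := boolP (msup M \in D); last exact: squarefree_off.
  apply: squarefree_mset => // w; rewrite leqNgt; apply/negP => /msup_lt_mdeg.
  by move: E; rewrite dM; lia.
have [MD|MD] := boolP (msup M \in D); last exact: squarefree_off.
case: (pickP (fun w => 1 < M w)%N) => [w Mw|M1]; last first.
  by apply: squarefree_mset => // w; rewrite leqNgt M1.
have wM : w \in msup M by rewrite inE -lt0n ltnW.
have cM : (#|msup M| <= r)%N by apply: leq_trans mr; rewrite -dM ltnW // (msup_lt_mdeg Mw).
have [v [vw vI]] := dual_form cM wM.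
pose M' := (M - U_(w))%MM.
have ME : M = (U_(w) + M')%MM.
  by rewrite addmC submK // lep1mP -lt0n ltnW.
apply: (squarefree_rep_eq (q := \sum_(u | u \notin msup M) (- v u) *: 'X_[(U_(u) + M')%MM])).
  rewrite [X in in_ideal _ _ _ X](_ : _ = 'X_[M'] * \sum_u v u *: 'X_u); first by apply: in_idealM vI; apply: off_star_up sphD _.
  rewrite mulr_sumr [RHS](bigID (mem (msup M))) /=; congr (_ + _); last first.
    rewrite -sumrN; apply: eq_bigr => u _.
    by rewrite scaleNr opprK -scalerAr mpolyXD mulrC.
  rewrite (bigD1 w) //= vw // eqxx scale1r big1 ?addr0; first by rewrite mulrC -mpolyXD -ME.
  by move=> u /andP[us /negbTE ne]; rewrite vw // ne scale0r mulr0.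
apply: squarefree_rep_sum => u us; apply: IH.
  have -> : msup (U_(u) + M')%MM = u |: msup M.
    have sM' : msup M' = msup M.
      apply/setP=> i; rewrite !inE mnmBE mnm1E; case: (w =P i) => [<-|]; last by rewrite subn0.
      by move: Mw; case: (M w) => [|[|]].
    rewrite msupD sM'; congr (_ :|: _); apply/setP=> i; rewrite !inE mnm1E (eq_sym i u).
    by case: (u == i).
  by rewrite cardsU1 us; lia.
by rewrite -dM {1}ME !mdegD !mdeg1.
Qed.

Lemma squarefree_homog m p : (m <= r)%N -> p \is m.-homog -> squarefree_rep m p.
Proof.
move=> mr /dhomogP ph; rewrite [p]mpolyE big_seq.
apply: (big_rec (squarefree_rep m)); first exact: squarefree_rep0.
move=> M q /ph MM hq; apply: squarefree_repP => //.
exact: squarefree_mono.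
Qed.

End Squarefree.

(** Modulo d-1 forms, degree d-1 is spanned by the monomials of ridges, which psi kills. *)
Lemma psi_low p : p \is d'.-homog -> psi p = 0.
Proof.
move=> ph; have [c hc] := squarefree_homog (leqnSn d') (leqnn d') ph.
have := psi_in_ideal hc; rewrite xset0 mul1r raddfB /= => /eqP; rewrite subr_eq0 => /eqP ->.
rewrite raddf_sum big1 //= => s /andP[sD /eqP cs].
by rewrite linearZ /= psi_ridge ?mulr0.
Qed.

Lemma psi_theta p : psi (theta d' * p) = psi p.
Proof.
apply: eq_bigr => F /facetsP[_ cF]; rewrite mevalM (theta_zF gen) // eqxx mul1r //.
Qed.

End DegreeMap.

(** * Orthogonal spaces of functions on a finite set *)

Section Orthogonal.
Variables (K : fieldType) (T : finType) (c : T -> K).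
Hypothesis c_neq0 : forall x, c x != 0.
Local Notation X := {ffun T -> K^o}.
Implicit Types (A B : {vspace X}).

Definition basis_mx A : 'M[K]_(\dim A, #|T|) := \matrix_(i, j) (vbasis A)`_i (enum_val j).

Lemma rank_basis_mx A : \rank (basis_mx A) = \dim A.
Proof.
apply/eqP; rewrite -/(row_free _); apply: inj_row_free => v v0.
have : \sum_i v 0 i *: (vbasis A)`_i = 0.
  apply/ffunP=> x; rewrite sum_ffunE ffunE.
  have := congr1 (fun M : 'rV_#|T| => M 0 (enum_rank x)) v0; rewrite !mxE => h; rewrite -[RHS]h.
  by apply: eq_bigr => i _; rewrite ffunE !mxE enum_rankK.
have /freeP fr := basis_free (vbasisP A).
move/(fr (v 0)) => h.
by apply/rowP=> i; rewrite h mxE.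
Qed.

Lemma orthogonal_dim A B :
  (forall u v, u \in A -> v \in B -> \sum_x c x * (u x * v x) = 0) ->
  (\dim A + \dim B <= #|T|)%N.
Proof.
move=> orth; pose G : 'M[K]_#|T| := diag_mx (\row_j c (enum_val j)).
have Gu : G \in unitmx.
  by rewrite unitmxE det_diag unitfE; apply/prodf_neq0 => i _; rewrite mxE.
have z : (basis_mx A *m G) *m (basis_mx B)^T = 0.
  apply/matrixP=> i j; rewrite !mxE -[RHS](orth (vbasis A)`_i (vbasis B)`_j).
  - rewrite [RHS](reindex _ (onW_bij _ (enum_val_bij T))) /=; apply: eq_bigr => k _.
    by rewrite mul_mx_diag !mxE mulrCA mulrA.
  - by apply/vbasis_mem/mem_nth; rewrite size_tuple.
  - by apply/vbasis_mem/mem_nth; rewrite size_tuple.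
have := mulmx0_rank_max z.
by rewrite mxrank_tr mxrankMfree ?row_free_unit // !rank_basis_mx.
Qed.

(** Orthogonal spaces of complementary dimensions are exact complements: enlarging A by a vector u
    outside it would violate [orthogonal_dim]. *)
Lemma orthogonal_mem A B (u : X) : (\dim A + \dim B = #|T|)%N ->
  (forall u v, u \in A -> v \in B -> \sum_x c x * (u x * v x) = 0) ->
  (forall v, v \in B -> \sum_x c x * (u x * v x) = 0) -> u \in A.
Proof.
move=> dAB orth uB.
have le : (\dim (A + <[u]>) + \dim B <= #|T|)%N.
  apply: orthogonal_dim => _ v /memv_addP[x xA [_ /vlineP[k ->] ->]] vB.
  under eq_bigr do rewrite ffunE mulrDl mulrDr.
  rewrite big_split /= orth // add0r.
  transitivity (k * \sum_y c y * (u y * v y)); last by rewrite uB ?mulr0.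
  by rewrite mulr_sumr; apply: eq_bigr => y _; rewrite ffunE /GRing.scale /= -mulrA mulrCA.
have : (A == A + <[u]>)%VS by rewrite eqEdim addvSl /=; move: le; rewrite -dAB leq_add2r.
by move/eqP=> ->; apply: (subvP (addvSr A <[u]>)); apply: memv_line.
Qed.

End Orthogonal.

Section Duality.
Variables (K : fieldType) (n' d' : nat).
Local Notation n := n'.+1.
Local Notation d := d'.+1.
Local Notation U m := (dhomog n K m).
Variables (D : {set {set 'I_n}}) (a : nat -> 'I_n -> K).
Hypothesis sphD : sphere_facts K d D.
Hypothesis char2 : 2%N \in [pchar K].
Hypothesis gen : generic a d.
Let w0 : 'I_n := ord0.
Local Notation theta := (theta a).
Local Notation zF := (zF d' a w0).
Local Notation psi := (psi d' w0 D a).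

Variable t : {set 'I_n}.
Hypothesis tD : t \in D.
Local Notation off := (off_star D t).
Local Notation e := (d - #|t|)%N.
Local Notation SF := (star_facets d D t).
Local Notation T := {F | F \in SF}.
Local Notation X := {ffun T -> K^o}.

Lemma SFP F : F \in SF -> F \in facets d' D /\ t \subset F.
Proof. by rewrite !inE => /and3P[-> -> ->]. Qed.

(** Besides the weight of psi this contains x_t, which is nonzero at the facets through t; so the
    diagonal form on functions is nondegenerate. *)
Definition cw (F : T) : K := wt d' w0 a (sval F) * (xset K t).@[zF (sval F)].

Lemma cw_neq0 F : cw F != 0.
Proof.
case: F => F FS; have [FF tF] := SFP FS; rewrite /cw /= mulf_neq0 ?(wt_neq0 w0 gen FF) //.
case/facetsP: FF => _ cF; rewrite xset_eval; apply/prodf_neq0 => w wt.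
by apply: (zF_neq0 gen w0 cF); apply: (subsetP tF).
Qed.

Definition ev k (f : U k) : X := [ffun F : T => (f : {mpoly K[n]}).@[zF (sval F)] : K^o].

Lemma ev_is_linear k : linear (@ev k).
Proof. by move=> c f g; apply/ffunP=> F; rewrite !ffunE /= mevalD mevalZ. Qed.

HB.instance Definition _ k := GRing.isLinear.Build K (U k) X _ (@ev k) (@ev_is_linear k).

(** A copy of the degree k part of the ring of the star modulo d-1 forms. As theta_(d-1) is 1 at all
    the points, these spaces increase with k, and the successive quotients are the graded pieces of
    the Artinian ring. *)
Definition wspace k : {vspace X} := limg (linfun (@ev k)).

Lemma mem_wspace k (u : X) : u \in wspace k -> exists g : U k, u = ev g.
Proof. by case/memv_imgP=> g _ ->; exists g; rewrite lfunE. Qed.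

Lemma ev_eq0 k (f : U k) : ev f = 0 <-> in_ideal theta d' off f.
Proof.
split=> [/ffunP h|h].
  apply: (eval0_in_star sphD char2 gen (w0 := w0) (k := k) tD); first exact: dhomog_is_dhomog.
  move=> F /facetsP[FD cF] tF; have FS : F \in SF by rewrite inE FD tF cF eqxx.
  by have := h (exist _ F FS); rewrite !ffunE.
apply/ffunP=> -[F FS]; have [FF tF] := SFP FS; rewrite !ffunE /=.
exact: (in_ideal_eval0 w0 sphD gen h FF tF).
Qed.

Lemma dim_wspace k : \dim (wspace k) = hilb a off d' k.
Proof.
rewrite /hilb -(limg_ker_dim (linfun (@ev k)) fullv) capfv.
have -> : lker (linfun (@ev k)) = jvs a off d' k; last by rewrite addKn.
apply/vspaceP=> f; rewrite memv_ker lfunE; apply/eqP/idP => [/ev_eq0 /mem_jvs //|/mem_jvs /ev_eq0 //].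
Qed.

Lemma pairing k l (p : U k) (q : U l) :
  \sum_F cw F * (ev p F * ev q F) = psi (xset K t * (val p * val q)).
Proof.
rewrite /psi [RHS](bigID (fun F : {set 'I_n} => t \subset F)) /= [X in _ = _ + X]big1 ?addr0; last first.
  by move=> F /andP[FF tF]; rewrite mevalM (xset_zF w0 a FF tF) mul0r mulr0.
rewrite [RHS](eq_bigl (mem SF)); last first.
  by move=> F; rewrite /= !inE -andbA; congr andb; rewrite andbC.
rewrite [RHS]big_sub /=; apply: eq_bigr => F _; rewrite !ffunE !mevalM /cw /=.
by rewrite -mulrA.
Qed.

Lemma psi_star_low p : p \is (d' - #|t|).-homog -> (#|t| <= d')%N -> psi (xset K t * p) = 0.
Proof.
move=> ph td; apply: (psi_low w0 sphD char2 gen); rewrite -(subnKC td).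
exact: dhomogM (xset_homog K t) ph.
Qed.

Lemma wspace_orth k l u v : (k + l + #|t| = d')%N -> u \in wspace k -> v \in wspace l ->
  \sum_F cw F * (u F * v F) = 0.
Proof.
move=> kl /mem_wspace[p ->] /mem_wspace[q ->]; rewrite pairing; apply: psi_star_low; last by lia.
have -> : (d' - #|t| = k + l)%N by lia.
by apply: dhomogM; apply: dhomog_is_dhomog.
Qed.

(** The two spaces are orthogonal because psi vanishes in degree d-1, and their dimensions add up to
    the number of facets by [hilb_complement]. *)
Lemma wspace_perp k l (u : X) : (k + l + #|t| = d')%N ->
  (forall v, v \in wspace l -> \sum_F cw F * (u F * v F) = 0) -> u \in wspace k.
Proof.
move=> kl h; apply: (orthogonal_mem cw_neq0 (B := wspace l)) => //; last first.
  by move=> x y; apply: wspace_orth.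
rewrite !dim_wspace card_sig.
have := hilb_complement sphD char2 gen tD (m := k) (ltn0Sn d').
have -> : (e - k.+1 = l)%N by lia.
by move=> -> //; lia.
Qed.

Lemma wspace_full u : u \in wspace e.
Proof.
suff -> : wspace e = fullv by rewrite memvf.
apply/eqP; rewrite eqEdim subvf /= dim_wspace.
have := hilb_total sphD char2 gen tD; rewrite (hilb_partial sphD char2 gen tD) // => ->.
have -> : \dim {:X} = #|SF| by rewrite dimvf -[RHS]muln1 -card_sig.
by [].
Qed.

(** In positive degree k the values of f are orthogonal to [wspace (e - k)], so they are the values
    of a form g of degree k-1; then f and theta_(d-1) g agree at every point. *)
Lemma star_poincare k (f : U k) : (k <= e)%N ->
  (forall g : U (e - k), psi (xset K t * (val f * val g)) = 0) -> in_ideal theta d off f.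
Proof.
have td := sf_card sphD tD.
move=> ke h; case: k f ke h => [|k] f ke h.
  (* A constant is tested against the monomial of F minus t: with the factor x_t it vanishes at all
     facets except F. *)
  have [F [FD tF cF]] := sf_facet sphD tD.
  have gh : xset K (F :\: t) \is (e - 0).-homog by rewrite (_ : e - 0 = #|F :\: t|)%N ?xset_homog // cardsD (setIidPr tF) cF subn0.
  have FF : F \in facets d' D by apply/facetsP.
  have := h (DHomog gh); rewrite /= /psi (bigD1 F) //= big1 ?addr0; last first.
    move=> F' /andP[FF' ne]; case/facetsP: (FF') => _ cF'.
    rewrite !mevalM mulrCA [X in _ * X]mulrCA.
    have [tF'|tF'] := boolP (t \subset F'); last by rewrite (xset_zF w0 a FF' tF') mul0r ?mulr0.
    have [sF'|sF'] := boolP (F :\: t \subset F'); last first.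
      by rewrite (xset_zF w0 a FF' sF') ?mulr0 ?mul0r.
    case/eqP: ne; apply/esym/eqP; rewrite eqEcard cF cF' leqnn andbT.
    by rewrite -(setDUK tF) subUset sF'.
  rewrite !mevalM => /eqP; rewrite !mulf_eq0 (negbTE (wt_neq0 w0 gen FF)) /=.
  rewrite !xset_eval => /orP[|/orP[|]].
  - by case/prodf_eq0 => w wt; rewrite (negbTE (zF_neq0 gen w0 cF (subsetP tF _ wt))).
  - have fC : val f = ((val f)@_0%MM)%:MP.
      apply/mpolyP=> m; rewrite mcoeffC; have [->|ne] := eqVneq m 0%MM; first by rewrite mulr1.
      by rewrite mulr0 (dhomog_nemf_coeff (dhomog_is_dhomog f)) //= mdeg_eq0.
    by rewrite fC mevalC => /eqP ->; rewrite mpolyC0; apply: in_ideal0.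
  - case/prodf_eq0 => w; rewrite inE => /andP[_ wF].
    by rewrite (negbTE (zF_neq0 gen w0 cF wF)).
have ku : ev f \in wspace k.
  apply: (wspace_perp (l := e - k.+1)); first by lia.
  by move=> v /mem_wspace[g ->]; rewrite pairing h.
have [g gE] := mem_wspace ku.
apply/in_idealS; exists (val g); apply/(ev_eq0 (f - mulh a d' g)).
rewrite raddfB /= gE; apply/eqP; rewrite subr_eq0; apply/eqP/ffunP=> -[F FS]; rewrite !ffunE /=.
have [/facetsP[_ cF] _] := SFP FS.
by rewrite mevalM (theta_zF gen) // eqxx mul1r.
Qed.

Section Functional.
Variables (k : nat) (phi : U k.+1 -> K^o).
Hypothesis phi_lin : linear phi.
HB.instance Definition _ := GRing.isLinear.Build K (U k.+1) K^o _ phi phi_lin.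
Hypothesis phi0 : forall f : U k.+1, in_ideal theta d off f -> phi f = 0.

(** Values at the points determine the class, so phi factors through functions on the facets and
    extends linearly to all of them. The weights annihilate [wspace k] because theta_(d-1) g has the
    values of g and phi kills it. *)
Lemma functional_weights : exists u : X,
  (forall f : U k.+1, phi f = \sum_F cw F * (u F * ev f F)) /\
  (forall v, v \in wspace k -> \sum_F cw F * (u F * v F) = 0).
Proof.
pose E := linfun (@ev k.+1); pose eta := (linfun phi \o E^-1)%VF.
have phiE f : phi f = eta (ev f).
  rewrite /eta comp_lfunE lfunE /=; apply/eqP; rewrite -subr_eq0 -raddfB; apply/eqP/phi0.
  apply: (in_ideal_leq (leqnSn d')); apply/ev_eq0; rewrite raddfB /=.
  apply/eqP; rewrite subr_eq0; apply/eqP.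
  rewrite -[RHS](lfunE (@ev k.+1)) limg_lfunVK //.
  by rewrite -[ev f](lfunE (@ev k.+1)) memv_img ?memvf.
pose delta (F : T) : X := [ffun F' => (F' == F)%:R].
have vE (v : X) : v = \sum_F v F *: delta F.
  apply/ffunP=> F; rewrite sum_ffunE (bigD1 F) //= !ffunE eqxx big1 ?addr0.
    by rewrite /GRing.scale /= mulr1.
  by move=> F' ne; rewrite !ffunE eq_sym (negbTE ne) scaler0.
pose u : X := [ffun F => (cw F)^-1 * eta (delta F)].
have etaZ (c : K) (x : X) : eta (c *: x) = c * eta x by exact: linearZZ.
have etaE v : eta v = \sum_F cw F * (u F * v F).
  rewrite {1}(vE v) raddf_sum; apply: eq_bigr => F _; rewrite /= etaZ ffunE.
  by rewrite !mulrA divff ?cw_neq0 // mul1r mulrC.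
exists u; split=> [f|_ /mem_wspace[g ->]]; first by rewrite phiE etaE.
rewrite -etaE -[RHS](phi0 (f := mulh a d' g)); last first.
  by rewrite -[X in in_ideal _ _ _ X]/(theta d' * val g); apply: in_ideal_theta.
rewrite phiE; congr (eta _); apply/ffunP=> -[F FS]; rewrite !ffunE /=.
by have [/facetsP[_ cF] _] := SFP FS; rewrite mevalM (theta_zF gen) // eqxx mul1r.
Qed.

Lemma star_functional : (k < e)%N ->
  exists y : U (e - k.+1), forall f : U k.+1, phi f = psi (xset K t * (val y * val f)).
Proof.
move=> ke; have [u [uE u0]] := functional_weights.
have [y yE] : exists y : U (e - k.+1), u = ev y.
  by apply/mem_wspace/(wspace_perp (l := k)); first lia.
by exists y => f; rewrite uE yE pairing.
Qed.

(** One degree above the top the weights are orthogonal to all functions, by [wspace_full]. *)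
Lemma star_functional_top : k = e -> forall f, phi f = 0.
Proof.
move=> ke f; have [u [uE u0]] := functional_weights.
have full v : v \in wspace k by rewrite ke wspace_full.
by rewrite uE; apply: u0.
Qed.

End Functional.

End Duality.

(** * Derivatives of the degree map *)

Section Derivations.
Variable K : fieldType.

Definition derivation (D : K -> K) :=
  (forall x y, D (x + y) = D x + D y) /\ (forall x y, D (x * y) = D x * y + x * D y).

Section OneDerivation.
Variable D : K -> K.
Hypothesis derD : derivation D.

Lemma derivation_add x y : D (x + y) = D x + D y. Proof. exact: derD.1. Qed.
Lemma derivation_mul x y : D (x * y) = D x * y + x * D y. Proof. exact: derD.2. Qed.
Lemma deriv_0 : D 0 = 0.
Proof. by apply: (addrI (D 0)); rewrite -derivation_add !addr0. Qed.
Lemma deriv_1 : D 1 = 0.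
Proof. by apply: (addrI (D 1)); rewrite addr0 -{3}[1](mulr1 1) derivation_mul mulr1 mul1r. Qed.
Lemma derivation_opp x : D (- x) = - D x.
Proof. by apply: (addrI (D x)); rewrite -derivation_add !subrr deriv_0. Qed.
Lemma deriv_sum (I : Type) (s : seq I) (P : pred I) (F : I -> K) :
  D (\sum_(i <- s | P i) F i) = \sum_(i <- s | P i) D (F i).
Proof. exact: (big_morph D derivation_add deriv_0). Qed.
Lemma deriv_nat (b : bool) : D b%:R = 0.
Proof. by case: b; rewrite ?deriv_0 ?deriv_1. Qed.
Lemma deriv_prod0 (I : finType) (P : pred I) (F : I -> K) :
  (forall i, P i -> D (F i) = 0) -> D (\prod_(i | P i) F i) = 0.
Proof.
move=> h; apply: (big_ind (fun x => D x = 0)) => //; first exact: deriv_1.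
by move=> x y Dx Dy; rewrite derivation_mul Dx Dy mul0r mulr0 addr0.
Qed.
Lemma deriv_det0 k (M : 'M[K]_k) : (forall i j, D (M i j) = 0) -> D (\det M) = 0.
Proof.
move=> h; rewrite /determinant deriv_sum big1 // => s _.
rewrite derivation_mul [X in _ + _ * X]deriv_prod0 // mulr0 addr0.
by case: (perm.odd_perm s); rewrite ?expr1 ?expr0 ?derivation_opp deriv_1 ?oppr0 mul0r.
Qed.

Hypothesis char2 : 2%N \in [pchar K].

Lemma addxx (x : K) : x + x = 0. Proof. exact: addrr_pchar2. Qed.

Lemma deriv_sq x : D (x ^+ 2) = 0.
Proof. by rewrite expr2 derivation_mul mulrC addxx. Qed.

Lemma deriv_sqM x y : D (x ^+ 2 * y) = x ^+ 2 * D y.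
Proof. by rewrite derivation_mul deriv_sq mul0r add0r. Qed.

End OneDerivation.
End Derivations.

(** * Derivatives of minors and inverse matrices *)

Section MinorCalculus.
Variables (K : fieldType) (d' : nat).
Local Notation d := d'.+1.
Hypothesis char2 : 2%N \in [pchar K].
Variable M : 'M[K]_d.
Hypothesis Mu : M \in unitmx.
Local Notation Y := (invmx M).

(* The coefficient of prod_(s in S) T_s in prod_(x in X) (Y x ord_max + sum_s Y x s T_s). *)
Fixpoint esum (S : {set 'I_d}) (X : seq 'I_d) : K :=
  if X is x :: X' then Y x ord_max * esum S X' + \sum_(s in S) Y x s * esum (S :\ s) X'
  else (S == set0)%:R.

Lemma esum0 X : esum set0 X = \prod_(x <- X) Y x ord_max.
Proof.
elim: X => [|x X IH]; first by rewrite big_nil /= eqxx.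
by rewrite big_cons /= IH big_set0 addr0.
Qed.

Section OneDer.
Variables (D : K -> K) (derD : derivation D).

Section Entry.
Variables (s0 c0 : 'I_d).
Hypothesis DM : forall r c, D (M r c) = ((r == s0) && (c == c0))%:R.

(** The rule D(M^-1) = - M^-1 D(M) M^-1 for a derivation that sees a single entry, the sign being
    dropped in characteristic 2. *)
Lemma deriv_inv c s : D (Y c s) = Y c s0 * Y c0 s.
Proof.
have E e : \sum_r D (Y c r) * M r e = - (Y c s0 * (e == c0)%:R).
  have : D ((Y *m M) c e) = 0 by rewrite mulVmx // mxE deriv_nat.
  rewrite mxE (deriv_sum derD).
  under eq_bigr do rewrite (derivation_mul derD) DM.
  rewrite big_split /=.
  move/eqP; rewrite addr_eq0 => /eqP ->; congr (- _).
  rewrite (bigD1 s0) //= eqxx big1 ?addr0 // => r /negbTE ->; by rewrite mulr0.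
have : \sum_e (\sum_r D (Y c r) * M r e) * Y e s = D (Y c s).
  under eq_bigr do rewrite mulr_suml.
  rewrite exchange_big /= (bigD1 s) //= [X in _ + X]big1 ?addr0.
    under eq_bigr do rewrite -mulrA.
    rewrite -mulr_sumr; have := congr1 (fun N : 'M_d => N s s) (mulmxV Mu).
    by rewrite !mxE eqxx => ->; rewrite mulr1.
  move=> r ne; under eq_bigr do rewrite -mulrA.
  rewrite -mulr_sumr; have := congr1 (fun N : 'M_d => N r s) (mulmxV Mu).
  by rewrite !mxE (negbTE ne) => ->; rewrite mulr0.
move<-; under eq_bigr do rewrite E.
rewrite (bigD1 c0) //= eqxx mulr1 big1 ?addr0; last by move=> e /negbTE ->; rewrite mulr0 oppr0 mul0r.
by rewrite mulNr oppr_pchar2.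
Qed.

Lemma deriv_det : D (\det M) = \det M * Y c0 s0.
Proof.
rewrite {1}(expand_det_row _ s0) (deriv_sum derD).
have cof c : D (cofactor M s0 c) = 0.
  rewrite /cofactor (derivation_mul derD) (deriv_det0 derD) ?mulr0 ?addr0.
    have -> : D ((-1) ^+ (s0 + c)) = 0.
      by rewrite -signr_odd; case: odd; rewrite ?expr1 ?expr0 ?(derivation_opp derD) (deriv_1 derD) ?oppr0.
    by rewrite mul0r.
  move=> i j; rewrite !mxE DM; case: eqP => // E.
  by have := neq_lift s0 i; rewrite E eqxx.
under eq_bigr do rewrite (derivation_mul derD) cof mulr0 addr0 DM eqxx /=.
rewrite (bigD1 c0) //= eqxx mul1r big1 ?addr0; last by move=> c /negbTE ->; rewrite mul0r.
by rewrite /invmx Mu !mxE mulrA divff ?mul1r // -unitfE -unitmxE.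
Qed.

Lemma deriv_esum (S : {set 'I_d}) X : s0 \notin S ->
  D (esum S X) = Y c0 ord_max * esum (s0 |: S) X + \sum_(s in S) Y c0 s * esum (s0 |: (S :\ s)) X.
Proof.
elim: X S => [|x X IH] S sS /=.
  rewrite (deriv_nat derD).
  have z (A : {set 'I_d}) : (s0 |: A == set0) = false.
    by apply/negbTE/set0Pn; exists s0; rewrite setU11.
  by rewrite z mulr0 big1 ?addr0 // => s _; rewrite z mulr0.
rewrite (derivation_add derD) (derivation_mul derD) (deriv_sum derD) IH // deriv_inv.
under [X in _ + X = _]eq_bigr => s sS'.
  rewrite (derivation_mul derD) deriv_inv IH; last by rewrite inE (negbTE sS) andbF.
  over.
rewrite !big_setU1 //= setU1K // .
have rm s : s \in S -> (s0 |: S) :\ s = s0 |: (S :\ s).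
  move=> sS'; apply/setP=> i; rewrite !inE; case: (i =P s0) => [->|] //=.
  by rewrite andbT; apply: contraNN sS => /eqP ->.
have -> : \sum_(s in S) Y x s * esum ((s0 |: S) :\ s) X = \sum_(s in S) Y x s * esum (s0 |: (S :\ s)) X.
  by apply: eq_bigr => s /rm ->.
have -> : \sum_(s in S) Y c0 s * (Y x ord_max * esum (s0 |: (S :\ s)) X +
     \sum_(s1 in s0 |: (S :\ s)) Y x s1 * esum ((s0 |: (S :\ s)) :\ s1) X) =
  \sum_(s in S) (Y c0 s * (Y x ord_max * esum (s0 |: (S :\ s)) X) + Y c0 s * (Y x s0 * esum (S :\ s) X)
    + \sum_(s1 in S :\ s) Y c0 s * (Y x s1 * esum (s0 |: (S :\ s :\ s1)) X)).
  apply: eq_bigr => s sS'; rewrite big_setU1 /=; last by rewrite inE (negbTE sS) andbF.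
  rewrite setU1K; last by rewrite inE (negbTE sS) andbF.
  rewrite !mulrDr addrA mulr_sumr; congr (_ + _); apply: eq_bigr => s1; rewrite inE => /andP[_ s1S].
  congr (_ * (_ * esum _ _)); apply/setP=> i; rewrite !inE; case: (i =P s0) => [->|] //=.
  by rewrite andbT; apply: contraNN sS => /eqP ->.
rewrite !big_split /=.
have sw : \sum_(s in S) Y x s * (\sum_(s1 in S :\ s) Y c0 s1 * esum (s0 |: (S :\ s :\ s1)) X) =
  \sum_(s in S) \sum_(s1 in S :\ s) Y c0 s * (Y x s1 * esum (s0 |: (S :\ s :\ s1)) X).
  under eq_bigr do rewrite mulr_sumr.
  rewrite (exchange_big_dep (mem S)) /=; last by move=> s s1; rewrite inE => _ /andP[].
  apply: eq_bigr => s sS'; apply: eq_big => [s1|s1 _].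
    by rewrite !inE sS' andbT eq_sym andbC.
  by rewrite mulrCA (_ : S :\ s1 :\ s = S :\ s :\ s1) // setDDl setUC -setDDl.
pose P := \sum_(s in S) Y c0 s * esum (s0 |: (S :\ s)) X.
pose Q := \sum_(s in S) Y c0 s * esum (S :\ s) X.
pose N := \sum_(s in S) Y x s * esum (s0 |: (S :\ s)) X.
have e1 : \sum_(i in S) (Y x i * (Y c0 ord_max * esum (s0 |: (S :\ i)) X +
      \sum_(s in S :\ i) Y c0 s * esum (s0 |: (S :\ i :\ s)) X)) =
   Y c0 ord_max * N + \sum_(s in S) Y x s * (\sum_(s1 in S :\ s) Y c0 s1 * esum (s0 |: (S :\ s :\ s1)) X).
  rewrite mulr_sumr -big_split /=; apply: eq_bigr => i _; rewrite mulrDr; congr (_ + _).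
  exact: mulrCA.
have e2 : \sum_(i in S) Y x s0 * Y c0 i * esum (S :\ i) X = Y x s0 * Q.
  by rewrite mulr_sumr; apply: eq_bigr => i _; rewrite mulrA.
have e3 : \sum_(i in S) Y c0 i * (Y x ord_max * esum (s0 |: (S :\ i)) X) = Y x ord_max * P.
  by rewrite mulr_sumr; apply: eq_bigr => i _; rewrite mulrCA.
have e4 : \sum_(i in S) Y c0 i * (Y x s0 * esum (S :\ i) X) = Y x s0 * Q.
  by rewrite mulr_sumr; apply: eq_bigr => i _; rewrite mulrCA.
rewrite e1 e2 e3 e4 sw -/P -/N; ring.
Qed.

(** The determinant supplies the summand Y c0 s0 absent from [deriv_esum]. A derivative by the entry
    (s0, c0) now simply adds s0 to the rows and c0 to the columns, so iterated derivatives are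
    bookkeeping. *)
Lemma deriv_det_esum (S : {set 'I_d}) X : s0 \notin S ->
  D (\det M * esum S X) = \det M * esum (s0 |: S) (c0 :: X).
Proof.
move=> sS; rewrite (derivation_mul derD) deriv_det deriv_esum //= big_setU1 //= setU1K //.
rewrite -mulrA -mulrDr; congr (_ * _); rewrite addrCA; congr (_ + (_ + _)).
apply: eq_bigr => s sS'; congr (_ * esum _ _).
apply/setP=> i; rewrite !inE; case: (i =P s0) => [->|] //=.
by rewrite andbT; apply/esym; apply: contraNneq sS => ->.
Qed.

End Entry.
Lemma deriv_inv0 : (forall r c, D (M r c) = 0) -> forall c s, D (Y c s) = 0.
Proof.
move=> DM c s; rewrite /invmx Mu !mxE.
have E : D (\det M * (\det M)^-1) = 0 by rewrite divff ?(deriv_1 derD) // -unitfE -unitmxE.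
have d0 : D (\det M) = 0 by apply: deriv_det0.
have i0 : D (\det M)^-1 = 0.
  move: E; rewrite (derivation_mul derD) d0 mul0r add0r => /eqP; rewrite mulf_eq0.
  by move: Mu; rewrite unitmxE unitfE => /negbTE -> /eqP.
rewrite (derivation_mul derD) i0 mul0r add0r /cofactor (derivation_mul derD) (deriv_det0 derD); last by move=> i j; rewrite !mxE.
rewrite mulr0 addr0 -signr_odd; case: odd; rewrite ?expr1 ?expr0 ?(derivation_opp derD) (deriv_1 derD) ?oppr0;
by rewrite mul0r mulr0.
Qed.

Lemma deriv_esum0 : (forall r c, D (M r c) = 0) -> forall S X, D (\det M * esum S X) = 0.
Proof.
move=> DM S X; rewrite (derivation_mul derD) (deriv_det0 derD) // mul0r add0r.
suff -> : D (esum S X) = 0 by rewrite mulr0.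
have Y0 := deriv_inv0 DM.
elim: X S => [|x X IH] S /=; first exact: deriv_nat.
rewrite (derivation_add derD) (derivation_mul derD) Y0 mul0r add0r IH mulr0 add0r (deriv_sum derD) big1 // => s _.
by rewrite (derivation_mul derD) Y0 mul0r add0r IH mulr0.
Qed.

End OneDer.

Lemma esum_swap S x y X : esum S (x :: y :: X) = esum S (y :: x :: X).
Proof.
rewrite /= !mulrDr !mulr_sumr.
under [X in _ + X = _]eq_bigr do rewrite mulrDr mulr_sumr.
under [X in _ = _ + X]eq_bigr do rewrite mulrDr mulr_sumr.
rewrite !big_split /= [X in _ + (_ + X) = _](exchange_big_dep (mem S)) /=; last first.
  by move=> s s1 _; rewrite inE => /andP[].
have -> : \sum_(j in S) \sum_(i in S | j \in S :\ i) Y x i * (Y y j * esum (S :\ i :\ j) X)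
   = \sum_(i in S) \sum_(j in S :\ i) Y y i * (Y x j * esum (S :\ i :\ j) X).
  apply: eq_bigr => s sS; apply: eq_big => [s1|s1 _].
    by rewrite !inE sS andbT andbC (eq_sym s).
  by rewrite mulrCA (_ : S :\ s1 :\ s = S :\ s :\ s1) // setDDl setUC -setDDl.
have -> : \sum_(i in S) Y x ord_max * (Y y i * esum (S :\ i) X)
   = \sum_(i in S) Y y i * (Y x ord_max * esum (S :\ i) X) by apply: eq_bigr => i _; rewrite mulrCA.
have -> : \sum_(i in S) Y x i * (Y y ord_max * esum (S :\ i) X)
   = \sum_(i in S) Y y ord_max * (Y x i * esum (S :\ i) X) by apply: eq_bigr => i _; rewrite mulrCA.
by rewrite (mulrCA (Y x ord_max)) -!addrA; congr (_ + _); rewrite addrCA.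
Qed.

(** In characteristic 2 the square of a linear factor is the sum of the squares of its terms, and
    only the constant one contributes to coefficients squarefree in the T_s. *)
Lemma esum_double S x X : esum S (x :: x :: X) = (Y x ord_max) ^+ 2 * esum S X.
Proof.
rewrite /= !mulrDr !mulr_sumr.
under [X in _ + X = _]eq_bigr do rewrite mulrDr mulr_sumr.
rewrite big_split /= mulrA -expr2 -addrA.
have -> : \sum_(i in S) Y x i * (Y x ord_max * esum (S :\ i) X)
   = \sum_(i in S) Y x ord_max * (Y x i * esum (S :\ i) X) by apply: eq_bigr => i _; rewrite mulrCA.
rewrite [X in _ + X]addrA addxx // add0r.
pose F s s1 := Y x s * (Y x s1 * esum (S :\ s :\ s1) X).
have FC s s1 : F s s1 = F s1 s by rewrite /F mulrCA setDDl setUC -setDDl.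
have -> : \sum_(s in S) \sum_(s1 in S :\ s) Y x s * (Y x s1 * esum (S :\ s :\ s1) X) = 0; last by rewrite ?addr0.
have -> : \sum_(s in S) \sum_(s1 in S :\ s) Y x s * (Y x s1 * esum (S :\ s :\ s1) X)
   = \sum_(s in S) \sum_(s1 in S | (s1 < s)%N) F s s1 + \sum_(s in S) \sum_(s1 in S | (s < s1)%N) F s s1.
  rewrite -big_split /=; apply: eq_bigr => s sS; rewrite (bigID (fun s1 : 'I_d => (s1 < s)%N)) /=.
  by congr (_ + _); apply: eq_bigl => s1; rewrite !inE -val_eqE /=; case: (s1 \in S); rewrite ?andbF ?andbT //=; case: ltngtP.
rewrite [X in _ + X](exchange_big_dep (mem S)) /=; last by move=> s s1 _ /andP[].
rewrite -big_split big1 //= => s sS.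
under [X in _ + X]eq_bigr do rewrite FC.
by rewrite [X in _ + X](eq_bigl (fun s1 => (s1 \in S) && (s1 < s)%N)) ?addxx // => i; rewrite sS.
Qed.

Lemma esum_perm S X X' : perm_eq X X' -> esum S X = esum S X'.
Proof.
have cons x (A B : seq 'I_d) : (forall T, esum T A = esum T B) -> forall T, esum T (x :: A) = esum T (x :: B).
  by move=> AB T /=; rewrite AB; congr (_ + _); apply: eq_bigr => s _; rewrite AB.
have pull x (A B : seq 'I_d) : forall T, esum T (A ++ x :: B) = esum T (x :: A ++ B).
  elim: A => [//|y A IH] T; rewrite -esum_swap; exact: cons.
have cat (A B C : seq 'I_d) : (forall T, esum T B = esum T C) -> forall T, esum T (A ++ B) = esum T (A ++ C).
  by move=> BC; elim: A => [//|x A IH]; apply: cons.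
have sw (A B C : seq 'I_d) : forall T, esum T (A ++ B ++ C) = esum T (B ++ A ++ C).
  elim: B => [//|y B IH] T; rewrite !cat_cons pull; exact: cons.
move=> pe; apply/esym; move: S.
have := catCA_perm_ind (P := fun Z => forall S, esum S Z = esum S X) _ pe; apply=> //.
by move=> A B C h S; rewrite sw.
Qed.

End MinorCalculus.

Lemma sum_sq_char2 (R : comNzRingType) (I : Type) (s : seq I) (P : pred I) (F : I -> R) :
  2%N \in [pchar R] -> (\sum_(i <- s | P i) F i) ^+ 2 = \sum_(i <- s | P i) F i ^+ 2.
Proof.
move=> c2; apply: (big_morph (fun x : R => x ^+ 2)) => [x y|]; last by rewrite expr0n.
by rewrite sqrrD mulr2n (addrr_pchar2 c2) addr0.
Qed.

Lemma deriv_det_cofactor (K : fieldType) (D : K -> K) k (M : 'M[K]_k) s0 c0 : derivation D ->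
  (forall r c, D (M r c) = ((r == s0) && (c == c0))%:R) -> D (\det M) = cofactor M s0 c0.
Proof.
move=> derD DM; rewrite {1}(expand_det_row _ s0) (deriv_sum derD).
have cof c : D (cofactor M s0 c) = 0.
  rewrite /cofactor (derivation_mul derD) (deriv_det0 derD) ?mulr0 ?addr0.
    have -> : D ((-1) ^+ (s0 + c)) = 0.
      by rewrite -signr_odd; case: odd; rewrite ?expr1 ?expr0 ?(derivation_opp derD) (deriv_1 derD) ?oppr0.
    by rewrite mul0r.
  move=> i j; rewrite !mxE DM; case: eqP => // E.
  by have := neq_lift s0 i; rewrite E eqxx.
under eq_bigr do rewrite (derivation_mul derD) cof mulr0 addr0 DM eqxx /=.
by rewrite (bigD1 c0) //= eqxx mul1r big1 ?addr0 // => c /negbTE ->; rewrite mul0r.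
Qed.

(** * Iterated derivatives of the summand of one facet *)

Section Iterated.
Variables (K : fieldType) (n d' : nat) (w0 : 'I_n).
Local Notation d := d'.+1.
Variable a : nat -> 'I_n -> K.
Hypothesis char2 : 2%N \in [pchar K].
Hypothesis gen : generic a d.
Variable der : nat -> 'I_n -> K -> K.
Hypothesis derP : forall s u, derivation (der s u).
Hypothesis der_a : forall s u r w, (s <= d)%N -> (r <= d)%N ->
  der s u (a r w) = ((s == r) && (u == w))%:R.

Definition diter (l : seq (nat * 'I_n)) (x : K) := foldr (fun p y => der p.1 p.2 y) x l.

Lemma diter_sum l (I : Type) (s : seq I) (P : pred I) (F : I -> K) :
  diter l (\sum_(i <- s | P i) F i) = \sum_(i <- s | P i) diter l (F i).
Proof. by elim: l => [//|p l IH]; rewrite /= IH (deriv_sum (derP _ _)). Qed.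

Lemma diter_sqM l x y : diter l (x ^+ 2 * y) = x ^+ 2 * diter l y.
Proof. by elim: l => [//|p l IH]; rewrite /= IH (deriv_sqM (derP _ _) char2). Qed.

Lemma diter0 l : diter l 0 = 0.
Proof. by elim: l => [//|p l IH]; rewrite /= IH (deriv_0 (derP _ _)). Qed.

Section OneFacet.
Variable f : 'I_d -> 'I_n.
Hypothesis f_inj : injective f.
Local Notation M := (colmx a f).
Let Mu : M \in unitmx := colmx_unit gen f_inj.

Lemma der_colmx (s c : 'I_d) r e : der s (f c) (M r e) = ((r == s) && (e == c))%:R.
Proof.
rewrite mxE der_a; [|exact: ltnW|exact: ltnW].
by rewrite (inj_eq f_inj) !(eq_sym c) !(eq_sym (s : nat)).
Qed.

Lemma diter_esum (l : seq ('I_d * 'I_d)) X : uniq (map fst l) ->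
  diter [seq (nat_of_ord p.1, f p.2) | p <- l] (\det M * esum M set0 X) =
  \det M * esum M [set s in map fst l] (map snd l ++ X).
Proof.
elim: l => [_|p l IH /andP[pl ul]].
  by rewrite (_ : [set s in map fst [::]] = set0) //; apply/setP=> s; rewrite !inE.
have -> : [set s in map fst (p :: l)] = p.1 |: [set s in map fst l].
  by apply/setP=> s; rewrite !inE.
transitivity (der p.1 (f p.2) (\det M * esum M [set s in map fst l] (map snd l ++ X))).
  by rewrite -IH.
by rewrite (deriv_det_esum char2 Mu (derP _ _) (der_colmx p.1 p.2)) // inE.
Qed.

(** The innermost derivatives, by entries of f, give an expression in the entries of f again; a
    derivative by an entry in a foreign column annihilates it. *)
Lemma diter_off (l : seq ('I_d * 'I_n)) X : uniq (map fst l) ->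
  has (fun p => [forall c, f c != p.2]) l ->
  diter [seq (nat_of_ord p.1, p.2) | p <- l] (\det M * esum M set0 X) = 0.
Proof.
elim: l => [//|p l IH] /= /andP[pl ul].
have [hl _|nl] := boolP (has (fun p => [forall c, f c != p.2]) l).
  by rewrite IH // (deriv_0 (derP _ _)).
rewrite orbF => /forallP pf.
pose pre u := odflt ord0 [pick c | f c == u].
have -> : [seq (nat_of_ord q.1, q.2) | q <- l] = [seq (nat_of_ord q.1, f q.2) | q <- [seq (q.1, pre q.2) | q <- l]].
  rewrite -map_comp; apply/eq_in_map => q ql /=; congr (_, _).
  move/hasPn/(_ q ql): nl; rewrite negb_forall => /existsP[c]; rewrite negbK => /eqP fc.
  by rewrite /pre; case: pickP => [c' /eqP //|/(_ c)]; rewrite fc eqxx.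
rewrite diter_esum -?map_comp //.
apply: (deriv_esum0 Mu (derP _ _)) => r c; rewrite mxE der_a; [|exact: ltnW|exact: ltnW].
by rewrite (eq_sym p.2) (negbTE (pf c)) andbF.
Qed.

Lemma diter_det k : (k <= d)%N ->
  diter [seq (i, f (inord i)) | i <- iota 0 k] (\det (\matrix_(i < k, j < k) a i (f (inord j)))) = 1.
Proof.
elim: k => [|k IH] kd; first by rewrite det_mx00.
rewrite -[k.+1]addn1 iotaD map_cat /diter foldr_cat /= add0n -/(diter _ _) addn1.
rewrite (deriv_det_cofactor (s0 := ord_max) (c0 := ord_max) (derP _ _)).
  rewrite /cofactor addnn -mul2n exprM sqrrN !expr1n mul1r -[RHS](IH (ltnW kd)).
  congr (diter _ (\det _)); apply/matrixP=> i j; rewrite !mxE.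
  by rewrite /= /bump !(leqNgt k) !ltn_ord.
move=> r c; rewrite mxE der_a; [|by lia|by have := ltn_ord r; lia].
rewrite (inj_eq f_inj) -!val_eqE /= !inordK //; last by have := ltn_ord c; lia.
by rewrite eq_sym (eq_sym k).
Qed.

(** The coefficient is the permanent of the inverse matrix, in characteristic 2 its determinant. The
    identity is obtained by differentiating det M once by each diagonal entry and computing the
    result in two ways. *)
Lemma esum_full : \det M * esum M setT (enum 'I_d) = 1.
Proof.
pose l := [seq (i, i) | i <- enum 'I_d].
have l1 : map fst l = enum 'I_d by rewrite -map_comp; apply: map_id.
have l2 : map snd l = enum 'I_d by rewrite -map_comp; apply: map_id.
have := @diter_esum l [::]; rewrite l1 l2 cats0 enum_uniq => /(_ isT).
rewrite (_ : [set s in enum 'I_d] = setT); last by apply/setP=> s; rewrite !inE mem_enum.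
move=> <-; rewrite esum0 big_nil mulr1 -[RHS](diter_det (leqnn d)) /l -map_comp.
have <- : M = \matrix_(i < d, j < d) a i (f (inord j)).
  by apply/matrixP=> i j; rewrite !mxE inord_val.
by congr diter; rewrite -val_enum_ord -map_comp; apply: eq_map => i /=; rewrite inord_val.
Qed.

Lemma esum_doubles S Z X : esum M S (Z ++ Z ++ X) = \prod_(x <- Z) (invmx M x ord_max) ^+ 2 * esum M S X.
Proof.
elim: Z => [|z Z IH]; first by rewrite big_nil mul1r.
rewrite big_cons -mulrA -IH -(esum_double char2).
by apply: esum_perm; rewrite /= perm_cons perm_sym -cat1s perm_catCA /=.
Qed.

End OneFacet.

Variable D : {set {set 'I_n}}.
Local Notation zF := (zF d' a w0).
Local Notation dtF := (dtF d' w0 a).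
Local Notation psi := (psi d' w0 D a).
Local Notation fe F := (facet_enum (d' := d') F w0).

Variables G L : {set 'I_n}.
Hypothesis GL : [disjoint G & L].
Hypothesis cGL : (#|G| + 2 * #|L|)%N = d.

(* One derivative per row: every vertex of G is used once, every vertex of L twice. *)
Definition vlist := enum G ++ enum L ++ enum L.
Definition rlist := zip (enum 'I_d) vlist.
Definition dlist : seq (nat * 'I_n) := [seq (nat_of_ord p.1, p.2) | p <- rlist].

Lemma size_vlist : size vlist = d.
Proof. by rewrite !size_cat -!cardE; lia. Qed.

Lemma rlist1 : map fst rlist = enum 'I_d.
Proof. by rewrite -/(unzip1 _) unzip1_zip // size_vlist size_enum_ord. Qed.

Lemma rlist2 : map snd rlist = vlist.
Proof. by rewrite -/(unzip2 _) unzip2_zip // size_vlist size_enum_ord. Qed.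

(** The derivatives add the columns G, L, L to those of F minus G: together F once and L twice. The
    doubled columns split off as squares and the rest is 1. If L is not inside F, some derivative
    uses a foreign column. *)
Lemma facet_derivative (F : {set 'I_n}) : #|F| = d -> G \subset F ->
  diter dlist (dtF F * \prod_(w in F :\: G) zF F w) =
  if L \subset F then \prod_(w in L) zF F w ^+ 2 else 0.
Proof.
move=> cF GF; have fi := @facet_enum_inj n d' w0 F cF.
pose pre w : 'I_d := odflt ord0 [pick c | fe F c == w].
have preK w : w \in F -> fe F (pre w) = w.
  move=> wF; rewrite /pre; case: pickP => [c /eqP //|no].
  by have [c E] := facet_enum_surj w0 cF wF; have := no c; rewrite -E eqxx.
have zE w : w \in F -> zF F w = invmx (colmx a (fe F)) (pre w) ord_max.
  by move=> wF; rewrite -{1}(preK w wF) zFE (zpt_col a fi).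
have prodE (A : {set 'I_n}) k : A \subset F ->
    \prod_(w in A) zF F w ^+ k = \prod_(x <- map pre (enum A)) (invmx (colmx a (fe F)) x ord_max) ^+ k.
  move=> AF; rewrite big_map big_enum; apply: eq_bigr => w wA.
  by rewrite zE // (subsetP AF).
pose X := map pre (enum (F :\: G)).
have -> : dtF F * \prod_(w in F :\: G) zF F w = \det (colmx a (fe F)) * esum (colmx a (fe F)) set0 X.
  rewrite esum0; congr (_ * _); have := prodE (F :\: G) 1%N (subsetDl _ _).
  by under eq_bigr do rewrite expr1; under [in X in _ = X -> _]eq_bigr do rewrite expr1.
have ul : uniq (map fst rlist) by rewrite rlist1 enum_uniq.
case: ifPn => [LF|nLF].
  have dE : dlist = [seq (nat_of_ord p.1, fe F p.2) | p <- [seq (p.1, pre p.2) | p <- rlist]].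
    rewrite -map_comp; apply/eq_in_map => p pl /=; congr (_, _); rewrite preK //.
    have : p.2 \in vlist by rewrite -rlist2 map_f.
    by rewrite !mem_cat !mem_enum => /or3P[/(subsetP GF)|/(subsetP LF)|/(subsetP LF)].
  rewrite dE (diter_esum fi) -?map_comp //.
  have -> : [set s in map (fst \o (fun p : 'I_d * 'I_n => (p.1, pre p.2))) rlist] = setT.
    apply/setP=> s; rewrite !inE -[X in s \in X]/(map fst rlist) rlist1 mem_enum //.
  have -> : map (snd \o (fun p : 'I_d * 'I_n => (p.1, pre p.2))) rlist = map pre vlist.
    by rewrite -rlist2 -map_comp.
  have pe : perm_eq (map pre vlist ++ X) (map pre (enum L) ++ map pre (enum L) ++ enum 'I_d).
    apply: (@perm_trans _ (map pre (enum L) ++ map pre (enum L) ++ map pre (enum F))).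
      rewrite -!map_cat perm_map //.
      have pG : perm_eq (enum G ++ enum (F :\: G)) (enum F).
        apply: uniq_perm; rewrite ?enum_uniq //.
          rewrite cat_uniq !enum_uniq /= andbT; apply/hasPn => w; rewrite !mem_enum.
          by rewrite inE => /andP[].
        move=> w; rewrite mem_cat !mem_enum inE; case: (boolP (w \in G)) => //= /(subsetP GF) ->.
        by [].
      rewrite /vlist -!catA; apply: perm_trans (_ : perm_eq _ (enum L ++ enum L ++ (enum G ++ enum (F :\: G)))) _.
        by rewrite perm_catCA perm_cat2l perm_catCA.
      by rewrite !perm_cat2l.
    rewrite !perm_cat2l; apply: uniq_perm; rewrite ?enum_uniq //.
      rewrite map_inj_in_uniq ?enum_uniq // => x y; rewrite !mem_enum => xF yF E.
      by rewrite -(preK x xF) E preK.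
    move=> c; rewrite mem_enum; apply/mapP; exists (fe F c); first by rewrite mem_enum facet_enum_in.
    by apply: fi; rewrite preK // facet_enum_in.
  rewrite (esum_perm _ _ pe) esum_doubles mulrCA (esum_full fi) mulr1.
  by rewrite prodE.
apply: (diter_off fi) => //.
case/subsetPn: nLF => w wL wF; apply/hasP.
have wr : w \in map snd rlist by rewrite rlist2 !mem_cat !mem_enum wL !orbT.
case/mapP: wr => p pl pw; exists p => //; rewrite -pw; apply/forallP=> c.
by apply: contraNneq wF => <-; apply: facet_enum_in.
Qed.

Lemma psi_derivative (J : 'X_{1..n}) :
  diter dlist (psi ('X_[J] ^+ 2 * xset K G)) = psi ('X_[J] * xset K G * xset K L) ^+ 2.
Proof.
rewrite /psi diter_sum (sum_sq_char2 _ _ _ char2); apply: eq_bigr => F FF.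
case/facetsP: (FF) => FD cF; rewrite !mevalM.
have [GF|GF] := boolP (G \subset F); last first.
  by rewrite (xset_zF w0 a FF GF) !(mulr0, mul0r) expr0n /= (diter0 dlist).
set q := dtF F * \prod_(w in F :\: G) zF F w.
have q0 : q != 0.
  rewrite mulf_neq0 ?dt_neq0 //; first exact: facet_enum_inj.
  by apply/prodf_neq0 => w; rewrite inE => /andP[_ wF]; apply: zF_neq0.
have gG : \prod_(w in G) zF F w != 0.
  by apply/prodf_neq0 => w wG; apply: zF_neq0 => //; apply: (subsetP GF).
have wtE : wt d' w0 a F * (xset K G).@[zF F] = q^-1.
  rewrite xset_eval /wt /q [\prod_(w in F) _](big_setID G) /= (setIidPr GF) !invfM.
  by rewrite mulrA mulrAC mulfVK.
(* Writing 1/q as q/q^2 isolates a square, which all derivations treat as a constant, and leaves q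
   for [facet_derivative]. *)
have -> : wt d' w0 a F * ('X_[J].@[zF F] ^+ 2 * (xset K G).@[zF F]) = ('X_[J].@[zF F] * q^-1) ^+ 2 * q.
  by rewrite mulrCA wtE; field.
rewrite diter_sqM (facet_derivative cF GF).
have -> : wt d' w0 a F * ('X_[J].@[zF F] * (xset K G).@[zF F] * (xset K L).@[zF F])
   = 'X_[J].@[zF F] * q^-1 * (xset K L).@[zF F] by rewrite -wtE; ring.
rewrite [RHS]exprMn; congr (_ * _); case: (boolP (L \subset F)) => LF.
  by rewrite xset_eval prodrXl.
by rewrite (xset_zF w0 a FF LF) expr0n.
Qed.

End Iterated.

(** * Missing faces and the size of stars *)

Local Close Scope ring_scope.

Section StarVertices.
Variables (K : fieldType) (V : finType) (d : nat) (D : {set {set V}}).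
Hypothesis sphD : sphere_facts K d D.
Let dD := sf_down sphD.

(** In contrast to [missing_face], points of the ambient type that are not vertices count here as
    minimal nonfaces, of cardinality 1. *)
Definition nonfaces_bounded N := forall G : {set V}, G \notin D ->
  (forall H : {set V}, H \proper G -> H \in D) -> #|G| <= N.

Definition star_vertices v : {set V} := [set w | [set v; w] \in D].

(** The second facet through the ridge [F :\ w] supplies p. *)
Lemma ridge_exchange (F : {set V}) w : F \in D -> #|F| = d -> w \in F ->
  exists p, p \notin F /\ (p |: (F :\ w)) \in D.
Proof.
move=> FD cF wF; have cR : #|F :\ w|.+1 = d by rewrite -cF (cardsD1 w F) wF.
have RD : F :\ w \in D by apply: dD FD (subsetDl _ _).
have FS : F \in [set G in D | F :\ w \subset G & #|G| == d].
  by rewrite inE FD subsetDl cF eqxx.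
have := sf_ridge sphD RD cR; rewrite (cardsD1 F) FS add1n => -[c1].
have /set0Pn[G] : [set G in D | F :\ w \subset G & #|G| == d] :\ F != set0.
  by rewrite -card_gt0 c1.
rewrite !inE => /and4P[GF GD RG /eqP cG].
have : #|G :\: (F :\ w)| == 1 by rewrite cardsD (setIidPr RG) cG -cR subSnn.
case/cards1P=> p Ep; have GE : G = p |: (F :\ w) by rewrite -Ep setUC -{1}(setID G (F :\ w)) (setIidPr RG).
exists p; rewrite -GE GD; split=> //; apply/negP => pF.
have : p \in G :\: (F :\ w) by rewrite Ep set11.
rewrite !inE pF andbT negbK => /andP[/eqP pw _].
by case/eqP: GF; rewrite GE pw setD1K.
Qed.

(* A minimal nonface inside p |: F contains p and all the w counted here. *)
Lemma exchange_card N (F : {set V}) p : nonfaces_bounded N -> F \in D -> #|F| = d -> p \notin F ->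
  #|[set w in F | p |: (F :\ w) \in D]| < N.
Proof.
move=> mf FD cF pF; set P := [set w in F | _].
have pFD : p |: F \notin D by apply/negP => /(sf_card sphD); rewrite cardsU1 pF cF; lia.
have [G [sG GD pr]] := minimal_nonface pFD.
apply: leq_trans (mf G GD pr).
have sub : p |: P \subset G.
  rewrite subUset sub1set; apply/andP; split.
    apply: contraNT GD => pG; apply: dD FD _; apply/subsetP=> x xG.
    by have := subsetP sG x xG; rewrite !inE => /orP[/eqP xp|//]; rewrite -xp xG in pG.
  apply/subsetP=> w; rewrite inE => /andP[wF wD]; apply: contraNT GD => wG.
  apply: dD wD _; apply/subsetP=> x xG; have := subsetP sG x xG.
  rewrite !inE => /orP[->//|->]; rewrite andbT.
  by apply/orP; right; apply: contraNneq wG => <-.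
apply: leq_trans (subset_leq_card sub); rewrite cardsU1.
by rewrite (_ : p \notin P) // inE negb_and pF.
Qed.

(** Otherwise at most two vertices of the star lie outside a facet F through v. Every w in F other
    than v is exchanged for one of them, and each serves fewer than N of the w, so d-1 <= 2(N-1). *)
Lemma star_vertices_card N v : nonfaces_bounded N -> [set v] \in D -> 1 < d -> (N.-1).*2 < d.-1 ->
  d.+2 < #|star_vertices v|.
Proof.
move=> mf vD d1 Nd; have [F [FD vF cF]] := sf_facet sphD vD.
rewrite sub1set in vF; rewrite ltnNge; apply/negP => cW.
pose Q := star_vertices v :\: F.
have FW : F \subset star_vertices v.
  apply/subsetP=> w wF; rewrite inE; apply: dD FD _.
  by apply/subsetP=> x; rewrite !inE => /orP[]/eqP->.
have cQ : #|Q| <= 2 by rewrite cardsD (setIidPr FW) cF; lia.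
have ex w : w \in F :\ v -> exists2 p, p \in Q & p |: (F :\ w) \in D.
  rewrite !inE => /andP[wv wF]; have [p [pF pD]] := ridge_exchange FD cF wF.
  exists p => //; rewrite !inE pF /=; apply: dD pD _; apply/subsetP=> x.
  by rewrite !inE => /orP[]/eqP->; rewrite ?eqxx // (eq_sym v w) wv vF orbT.
have : #|F :\ v| <= \sum_(p in Q) N.-1.
  apply: (@leq_trans (\sum_(p in Q) #|[set w in F | p |: (F :\ w) \in D]|)); last first.
    apply: leq_sum => p; rewrite inE => /andP[pF _].
    by have := exchange_card mf FD cF pF; lia.
  rewrite -sum1_card; under [X in _ <= X]eq_bigr => p _ do rewrite -sum1_card big_mkcond /=.
  rewrite exchange_big /= big_mkcond /=; apply: leq_sum => w _; case: ifP => // wF.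
  have [p pQ pD] := ex w wF; rewrite (bigD1 p) //= inE pD.
  by move: wF; rewrite !inE => /andP[_ ->].
rewrite sum_nat_const; have := cardsD1 v F; rewrite vF cF => dE.
have : #|Q| * N.-1 <= 2 * N.-1 by rewrite leq_mul2r cQ orbT.
by move: dE; move: #|F :\ v| => m; lia.
Qed.

End StarVertices.

Local Open Scope ring_scope.

(** * Monomials and coefficientwise derivations *)

Lemma deriv_Vconst (K : fieldType) (Df : K -> K) x : derivation Df -> Df x = 0 -> Df x^-1 = 0.
Proof.
move=> dD x0; have [->|nz] := eqVneq x 0; first by rewrite invr0 deriv_0.
apply: (mulfI nz); rewrite mulr0 -[LHS]add0r -[X in X + _](mul0r x^-1) -x0.
by rewrite -derivation_mul // mulfV // deriv_1.
Qed.

Lemma deriv_Xconst (K : fieldType) (Df : K -> K) x m : derivation Df -> Df x = 0 -> Df (x ^+ m) = 0.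
Proof.
move=> dD x0; elim: m => [|m IH]; first by rewrite expr0 deriv_1.
by rewrite exprS derivation_mul // x0 IH mul0r mulr0 addr0.
Qed.

Lemma exists_subset (T : finType) (A : {set T}) k : (k <= #|A|)%N ->
  exists2 B : {set T}, B \subset A & #|B| = k.
Proof.
move=> kA; exists [set x in take k (enum A)].
  by apply/subsetP=> x; rewrite inE => /mem_take; rewrite mem_enum.
rewrite cardsE (card_uniqP _) ?take_uniq ?enum_uniq // size_take -cardE.
by case: ltngtP kA => // ->.
Qed.

Lemma hpoly_sum (V : finType) d (D : {set {set V}}) : (forall s, s \in D -> (#|s| <= d)%N) ->
  hpoly d D = \sum_(s in D) ('X - 1) ^+ (d - #|s|).
Proof.
move=> cD; rewrite (partition_big (fun s : {set V} => inord #|s| : 'I_d.+1) predT) //=.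
apply: eq_bigr => k _; rewrite -sumr_const; apply: eq_big => s.
  rewrite inE; case: (boolP (s \in D)) => //= sD.
  by rewrite -val_eqE /= inordK // ltnS cD.
by rewrite inE => /andP[_ /eqP ->].
Qed.

Lemma hnum_star_series n d (D : {set {set 'I_n}}) m : (forall s, s \in D -> (#|s| <= d)%N) ->
  (m <= d)%N -> hnum d D m = (star_series D set0 d)`_m.
Proof.
move=> cD md; rewrite /hnum hpoly_sum // /star_series !coef_sum.
apply: eq_big => [s|s sD]; first by rewrite sub0set andbT.
by rewrite cards0 subn0 binomial_reverse ?subnKC ?cD.
Qed.

Lemma mnm_addBK n (M : 'X_{1..n}) w : M w != 0%N -> M = (U_(w) + (M - U_(w)))%MM.
Proof.
move=> Mw; apply/mnmP=> u; rewrite mnmDE mnmBE mnm1E.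
by case: eqP => [<-|_]; rewrite ?subnKC ?subn0 // lt0n.
Qed.

Lemma mnm_split n (M : 'X_{1..n}) m : mdeg M = m.+1 ->
  exists w M', M = (U_(w) + M')%MM /\ mdeg M' = m.
Proof.
move=> dM; have [w Mw] : exists w, M w != 0%N.
  have : mdeg M != 0 by rewrite dM.
  rewrite mdeg_eq0 => M0; apply/existsP; apply: contraNT M0.
  by rewrite negb_exists => /forallP h; apply/eqP/mnmP=> w; rewrite mnm0E; have := h w; lia.
have E := mnm_addBK Mw.
by exists w, (M - U_(w))%MM; split=> //; move: dM; rewrite {1}E mdegD mdeg1 => -[].
Qed.

Lemma homog_ind (K : fieldType) n k (P : {mpoly K[n]} -> Prop) : P 0 ->
  (forall c p q, P p -> P q -> P (c *: p + q)) -> (forall M, mdeg M = k -> P 'X_[M]) ->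
  forall p, p \is k.-homog -> P p.
Proof.
move=> P0 PD PX p /dhomogP ph; rewrite [p]mpolyE big_seq.
apply: (big_rec P) => // M q /ph Mk Pq; apply: PD => //; exact: PX.
Qed.

Lemma varM_homog (K : fieldType) n k w (p : {mpoly K[n]}) :
  p \is k.-homog -> 'X_w * p \is k.+1.-homog.
Proof. by move=> ph; rewrite -addn1 addnC; apply: dhomogM => //; rewrite dhomogX /= mdeg1. Qed.

Lemma thetaM_homog (K : fieldType) n (a : nat -> 'I_n -> K) r k (p : {mpoly K[n]}) :
  p \is k.-homog -> theta a r * p \is k.+1.-homog.
Proof. by move=> ph; rewrite -addn1 addnC; apply: dhomogM => //; apply: lin_homog. Qed.

Section CoefficientDerivation.
Variables (K : fieldType) (n : nat) (Df : K -> K).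
Hypothesis derD : derivation Df.

Definition dcoef (p : {mpoly K[n]}) : {mpoly K[n]} := \sum_(M <- msupp p) Df p@_M *: 'X_[M].

Lemma dcoefE p M : (dcoef p)@_M = Df p@_M.
Proof.
rewrite /dcoef raddf_sum /=; have [Mp|Mp] := boolP (M \in msupp p).
  rewrite (bigD1_seq M) ?msupp_uniq //= mcoeffZ mcoeffX eqxx mulr1 big1 ?addr0 // => M' ne.
  by rewrite mcoeffZ mcoeffX (negbTE ne) mulr0.
rewrite memN_msupp_eq0 // deriv_0 // big_seq big1 // => M' Mp'.
rewrite mcoeffZ mcoeffX; case: eqP => [E|_]; last by rewrite mulr0.
by case/negP: Mp; rewrite -E.
Qed.

Lemma dcoefD p q : dcoef (p + q) = dcoef p + dcoef q.
Proof. by apply/mpolyP=> M; rewrite mcoeffD !dcoefE mcoeffD derivation_add. Qed.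

Lemma dcoef0 : dcoef 0 = 0.
Proof. by apply/mpolyP=> M; rewrite dcoefE !mcoeff0 deriv_0. Qed.

Lemma dcoefM p q : dcoef (p * q) = dcoef p * q + p * dcoef q.
Proof.
apply/mpolyP=> M; rewrite dcoefE mcoeffD !mcoeffM deriv_sum // -big_split; apply: eq_bigr => k _ /=.
by rewrite (derivation_mul derD) !dcoefE.
Qed.

Lemma dcoefX M : dcoef 'X_[M] = 0.
Proof. by apply/mpolyP=> M'; rewrite dcoefE mcoeffX deriv_nat // mcoeff0. Qed.

Lemma dcoef_lin (v : 'I_n -> K) : dcoef (\sum_w v w *: 'X_w) = \sum_w Df (v w) *: 'X_w.
Proof.
rewrite (big_morph dcoef dcoefD dcoef0); apply: eq_bigr => w _.
apply/mpolyP=> M; by rewrite dcoefE !mcoeffZ mcoeffX (derivation_mul derD) (deriv_nat derD) mulr0 addr0.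
Qed.

Lemma dcoef_mono bad p : mono_ideal bad p -> mono_ideal bad (dcoef p).
Proof.
move=> h M; rewrite dcoefE => nz; apply: h; apply: contraNneq nz => ->.
by rewrite deriv_0.
Qed.

End CoefficientDerivation.

Lemma leq_dim_codim (K : fieldType) (U : vectType K) (T : finType) (J : {vspace U}) (el : T -> U) :
  (forall c : T -> K, \sum_x c x *: el x \in J -> forall x, c x = 0) ->
  (#|T| + \dim J <= \dim (fullv : {vspace U}))%N.
Proof.
move=> ind; pose f (c : {ffun T -> K^o}) := \sum_x (c x : K) *: el x.
have flin : linear f.
  move=> k c c'; rewrite /f scaler_sumr -big_split; apply: eq_bigr => x _ /=.
  by rewrite !ffunE scalerDl scalerA.
pose fL := HB.pack_for {linear {ffun T -> K^o} -> U} f (GRing.isLinear.Build K {ffun T -> K^o} U *:%R f flin).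
pose L := linfun fL.
have LE c : L c = f c by rewrite lfunE.
have zero c : L c \in J -> c = 0.
  rewrite LE => /ind h; apply/ffunP=> x; rewrite ffunE; exact: h.
have ker0 : (lker L == 0)%VS.
  by rewrite -subv0; apply/subvP=> c; rewrite memv_ker memv0 => /eqP h; apply/eqP/zero; rewrite h mem0v.
have cap : (limg L :&: J = 0)%VS.
  apply/eqP; rewrite -subv0; apply/subvP=> y; rewrite memv_cap memv0 => /andP[/memv_imgP[c _ ->] h].
  by rewrite (zero c h) linear0.
have -> : #|T| = \dim (limg L).
  rewrite (limg_dim_eq _); last by rewrite (eqP ker0) capv0.
  by rewrite dimvf /= -[LHS]muln1.
by rewrite -dimv_disjoint_sum // dimvS // subvf.
Qed.

(** * The Lefschetz property *)

Section GenericReduction.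
Variables (K : fieldType) (n' d' : nat).
Local Notation n := n'.+1.
Local Notation d := d'.+1.
Variables (D : {set {set 'I_n}}) (a : nat -> 'I_n -> K).
Hypothesis sphD : sphere_facts K d D.
Hypothesis char2 : 2%N \in [pchar K].
Hypothesis gen1 : generic a d.+1.
Variable der : nat -> 'I_n -> K -> K.
Hypothesis derP : forall s u, derivation (der s u).
Hypothesis der_a : forall s u r w, (s <= d)%N -> (r <= d)%N ->
  der s u (a r w) = ((s == r) && (u == w))%:R.

Let gen : generic a d.
Proof. by move=> k e kd; apply/gen1/leqW. Qed.

Local Notation theta := (theta a).
Local Notation zF := (zF d' a (@ord0 n')).
Local Notation psi := (psi d' (@ord0 n') D a).
Local Notation fe F := (facet_enum (d' := d') F (@ord0 n')).

(** Modulo the first d-1 forms p is theta_(d-1) g. The degree map does not see the factor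
    theta_(d-1), and x_t g has degree d-1, where it vanishes. *)
Lemma psi_star_top (t : {set 'I_n}) p : (#|t| <= d')%N -> p \is (d - #|t|).-homog ->
  in_ideal theta d (off_star D t) p -> psi (xset K t * p) = 0.
Proof.
move=> td; rewrite (subSn td) => ph /in_idealS[g hg].
have := in_ideal_homog (d' - #|t|).+1 hg; rewrite raddfB /= (pihomog_dE ph) pihomogM1; last exact: lin_homog.
set h := pihomog _ _ _ => /(psi_in_ideal ord0 sphD gen); rewrite mulrBr raddfB /= => /eqP.
rewrite subr_eq0 mulrCA => /eqP ->; rewrite psi_theta // (psi_star_low sphD char2 gen) //.
exact: pihomogP.
Qed.

Lemma psi_top p : p \is d.-homog -> in_ideal theta d (off_star D set0) p -> psi p = 0.
Proof.
move=> ph hp; rewrite -[p]mul1r -(xset0 K n).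
by apply: psi_star_top => //; rewrite cards0.
Qed.

(** Weights and points involve only the rows 0, ..., d-1; the coefficients of omega form row d, so
    derivatives by them meet this hypothesis. *)
Lemma deriv_psi (Df : K -> K) (m : 'X_{1..n}) : derivation Df ->
  (forall r w, (r < d)%N -> Df (a r w) = 0) -> Df (psi 'X_[m]) = 0.
Proof.
move=> dD D0; rewrite deriv_sum // big1 // => F /facetsP[FD cF].
have fi := @facet_enum_inj n d' ord0 F cF.
have DM i j : Df (colmx a (fe F) i j) = 0 by rewrite mxE D0.
have Dz w : Df (zF F w) = 0.
  have [wF|wF] := boolP (w \in F); last by rewrite zF_off // deriv_0.
  have [c ->] := facet_enum_surj ord0 cF wF.
  by rewrite zFE (zpt_col a fi) (deriv_inv0 (colmx_unit gen fi) dD).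
rewrite derivation_mul // [X in X * _]deriv_Vconst //; last first.
  rewrite derivation_mul // [X in _ + _ * X]deriv_prod0 // mulr0 addr0.
  by rewrite deriv_det0 ?mul0r.
rewrite mul0r add0r mevalX deriv_prod0 ?mulr0 // => w _; exact: deriv_Xconst.
Qed.

Lemma psi_sq_expand (f q : {mpoly K[n]}) :
  psi (f ^+ 2 * q) = \sum_(J <- msupp f) f@_J ^+ 2 * psi ('X_[J] ^+ 2 * q).
Proof.
rewrite {1}[f]mpolyE sum_sq_char2; last by rewrite (rmorph_pchar (@mpolyC n K)).
rewrite mulr_suml raddf_sum /=; apply: eq_bigr => J _.
by rewrite exprZn -scalerAl linearZ.
Qed.

Section Kernel.
Variables (k : nat) (f : {mpoly K[n]}).
Hypothesis fk : f \is k.-homog.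
Hypothesis kd : (2 * k < d)%N.
Hypothesis thf : in_ideal theta d (off_star D set0) (theta d * f).

(* psi (theta_d f^2 m) = 0; in characteristic 2 the squared coefficients of f are
   constants for d/da_{d,u}, which therefore extracts the X_u-term of theta_d. *)
Lemma psi_sq_var u (m : 'X_{1..n}) : (mdeg m + 2 * k).+1 = d -> psi (f ^+ 2 * ('X_u * 'X_[m])) = 0.
Proof.
move=> dm.
have key : psi (theta d * (f ^+ 2 * 'X_[m])) = 0.
  apply: psi_top.
    suff : theta d * (f ^+ 2 * 'X_[m]) \is (1 + ((k + k) + mdeg m)).-homog.
      by rewrite (_ : (1 + _)%N = d) //; lia.
    apply: dhomogM; first exact: lin_homog.
    by apply: dhomogM; [rewrite expr2; apply: dhomogM | rewrite dhomogX].
  have -> : theta d * (f ^+ 2 * 'X_[m]) = (f * 'X_[m]) * (theta d * f) by ring.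
  by apply: in_idealM => //; apply: (off_star_up sphD).
have psiw w : der d u (psi (f ^+ 2 * ('X_w * 'X_[m]))) = 0.
  rewrite psi_sq_expand deriv_sum // big1 // => J _; rewrite deriv_sqM //.
  have -> : 'X_[J] ^+ 2 * ('X_w * 'X_[m]) = 'X_[(J + J + (U_(w) + m))%MM] :> {mpoly K[n]}.
    by rewrite !mpolyXD expr2.
  rewrite deriv_psi ?mulr0 // => r v rd; rewrite der_a //; last exact: ltnW.
  by rewrite gtn_eqF.
move: key; rewrite thetaE mulr_suml raddf_sum /=.
have E w : psi (a d w *: 'X_w * (f ^+ 2 * 'X_[m])) = a d w * psi (f ^+ 2 * ('X_w * 'X_[m])).
  by rewrite -scalerAl linearZ /=; congr (_ * psi _); ring.
under eq_bigr do rewrite E.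
move/(congr1 (der d u)); rewrite deriv_0 // deriv_sum // (bigD1 u) //=.
rewrite derivation_mul // psiw mulr0 addr0 der_a // !eqxx mul1r big1 ?addr0 // => w wu.
by rewrite derivation_mul // psiw mulr0 addr0 der_a // eqxx eq_sym (negbTE wu) mul0r.
Qed.

(** Split s into L with k elements and G with the other d - 2k > 0. Then psi(f^2 x_G) = 0 by
    [psi_sq_var], and its iterated derivative is the square of psi(f x_G x_L), as the coefficients
    of f enter only squared. *)
Lemma psi_face (s : {set 'I_n}) : #|s| = (d - k)%N -> psi (f * xset K s) = 0.
Proof.
move=> cs.
have [L Ls cL] : exists2 L : {set 'I_n}, L \subset s & #|L| = k.
  by apply: exists_subset; rewrite cs; lia.
pose G := s :\: L.
have cG : #|G| = (d - 2 * k)%N by rewrite /G cardsD (setIidPr Ls) cs cL; lia.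
have GL : [disjoint G & L] by rewrite disjoint_sym disjoints_subset setCD subsetUr.
have cGL : (#|G| + 2 * #|L|)%N = d by rewrite cG cL; lia.
have xs : xset K s = xset K G * xset K L.
  rewrite /xset -mpolyXD; congr 'X_[_]; apply/mnmP=> w; rewrite mnmDE !mnmE inE.
  case: (boolP (w \in L)) => [/(subsetP Ls) ->|] //=; by rewrite addn0.
have [u uG] : exists u, u \in G by apply/set0Pn; rewrite -card_gt0 cG; lia.
have xG : xset K G = 'X_u * 'X_[mset (G :\ u)] := xset_setD1 K uG.
have : psi (f ^+ 2 * xset K G) = 0.
  rewrite xG psi_sq_var // mdeg_mset; move: cG; rewrite (cardsD1 u) uG; lia.
move/(congr1 (diter der (dlist d' G L))); rewrite (diter0 derP) psi_sq_expand (diter_sum derP).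
under eq_bigr => J _ do rewrite (diter_sqM char2 derP) (psi_derivative ord0 char2 gen derP der_a D GL cGL) -exprMn.
rewrite -sum_sq_char2 // => /eqP; rewrite expf_eq0 /= => /eqP h; rewrite -[RHS]h xs {1}[f]mpolyE.
rewrite mulr_suml raddf_sum /=; apply: eq_bigr => J _.
by rewrite -scalerAl linearZ /= mulrA.
Qed.

(** Duality asks for tests of f in degree d-k, and modulo the forms every test polynomial is a
    combination of squarefree monomials, where [psi_face] applies. *)
Lemma lefschetz : in_ideal theta d (off_star D set0) f.
Proof.
have := star_poincare sphD char2 gen (sf_empty sphD) (f := DHomog fk).
rewrite cards0 subn0; apply; first by lia.
move=> g; rewrite xset0 mul1r /=.
have gh : \val g \is (d - k).-homog by apply: valP.
have [c hc] := squarefree_homog sphD char2 gen (leqnn d) (leq_subr k d) gh.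
set q := \sum_(s in D | _) _ in hc.
have qh : q \is (d - k).-homog.
  by apply: rpred_sum => s /andP[_ /eqP cs]; apply: rpredZ; rewrite -cs xset_homog.
have : psi (f * (\val g - q)) = 0.
  apply: psi_top; last by apply: in_idealM => //; apply: (off_star_up sphD).
  suff : f * (\val g - q) \is (k + (d - k)).-homog by rewrite (_ : (k + _)%N = d) //; lia.
  by apply: dhomogM => //; apply: rpredB.
rewrite mulrBr raddfB /= => /eqP; rewrite subr_eq0 => /eqP ->.
rewrite /q mulr_sumr raddf_sum big1 //= => s /andP[_ /eqP cs].
by rewrite -scalerAr linearZ /= psi_face // mulr0.
Qed.

End Kernel.

Lemma gnum_hilb i : (0 < i)%N -> (2 * i <= d.+1)%N ->
  gnum d D i = (hilb a (off_star D set0) d.+1 i)%:Z.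
Proof.
case: i => // i _ id.
(* A coefficient of omega has a derivative equal to 1, so it cannot be 0. *)
have thd : theta d != 0.
  have : a d ord0 != 0.
    apply: contraTneq (oner_neq0 K) => h.
    by have := der_a ord0 ord0 (leqnn d) (leqnn d); rewrite h deriv_0 // !eqxx => E; rewrite negbK; apply/eqP/esym.
  apply: contraNneq => h; have := lin_coeff (arow a d) ord0.
  by rewrite -/(theta d) h mcoeff0 mxE => ->.
have := hilbS (off_star_up sphD (t := set0)) thd (k := i) (fun f h => lefschetz (valP f) _ h).
move/(_ ltac:(lia)) => E.
rewrite /gnum !(hnum_star_series (sf_card sphD)); [|lia|lia].
by rewrite -!(hilb_series sphD char2 gen (sf_empty sphD)); move: E; lia.
Qed.

(** * Nonzero classes on stars *)

Section Socle.
Variable t : {set 'I_n}.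
Hypothesis tD : t \in D.
Hypothesis td : (#|t| <= d')%N.

Local Notation off := (off_star D t).
Local Notation J p := (in_ideal theta d off p).
Local Notation C p := (in_ideal theta d.+1 off p).
Local Notation e := (d - #|t|)%N.
Local Notation pst p := (psi (xset K t * p)).

Let up : upward off := off_star_up sphD (t := t).

Lemma pst_mul k (f g : {mpoly K[n]}) : (k <= e)%N -> f \is k.-homog -> g \is (e - k).-homog ->
  J f -> pst (f * g) = 0.
Proof.
move=> ke fk gk Jf; apply: (psi_star_top) => //.
  by rewrite -(subnKC ke); apply: dhomogM.
by rewrite mulrC; apply: in_idealM.
Qed.

Lemma pst_mulr k (f g : {mpoly K[n]}) : (k <= e)%N -> f \is k.-homog -> g \is (e - k).-homog ->
  J g -> pst (f * g) = 0.
Proof.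
move=> ke fk gk Jg; rewrite (mulrC f); apply: (pst_mul (k := e - k)) => //; first by lia.
by rewrite subKn.
Qed.

Lemma pst_nondeg k (f : {mpoly K[n]}) : (k <= e)%N -> f \is k.-homog ->
  (forall g, g \is (e - k).-homog -> pst (f * g) = 0) -> J f.
Proof.
move=> ke fk h; apply: (star_poincare sphD char2 gen tD (f := DHomog fk)) => // g.
by apply: h; apply: valP.
Qed.

Lemma one_notin_ideal r : ~ in_ideal theta r off 1.
Proof.
case=> g /(_ 0%MM); rewrite mcoeffB mcoeff1 eqxx raddf_sum /= big1 ?subr0 ?oner_neq0 => [|s _].
  move/(_ isT); rewrite /off_star (_ : msup 0 = set0) ?set0U ?tD //.
  by apply/setP=> w; rewrite !inE mnm0E.
rewrite rmorphM /= thetaE raddf_sum big1 ?mul0r //= => w _.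
by rewrite mcoeffZ mcoeffX mnm1_eq0 mulr0.
Qed.

Lemma ideal_lift m : (forall f, f \is m.-homog -> C f) ->
  forall k f, (m <= k)%N -> f \is k.-homog -> C f.
Proof.
move=> h k; elim: k => [|k IH] f; first by rewrite leqn0 => /eqP m0 f0; apply: h; rewrite m0.
rewrite leq_eqVlt => /orP[/eqP <-|mk]; first exact: h.
apply: homog_ind => [|c p q hp hq|M /mnm_split[w [M' [-> dM]]]]; first exact: in_ideal0.
  by apply: in_idealD => //; apply: in_idealZ.
by rewrite mpolyXD; apply: in_idealM => //; apply: IH => //; rewrite dhomogX /= dM.
Qed.

Lemma ideal_quot m f : f \is m.+1.-homog -> C f ->
  exists g, g \is m.-homog /\ J (f - theta d * g).
Proof.
move=> fm /in_idealS[g hg]; exists (pihomog mdeg m g); split; first exact: pihomogP.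
by have := in_ideal_homog m.+1 hg; rewrite raddfB /= (pihomog_dE fm) pihomogM1 //; apply: lin_homog.
Qed.

(** * Vanishing modulo omega passes from degree s+1 down to degree s *)

Section Step.
Variables (s N : nat).
Hypothesis se : (2 * s.+1 <= e)%N.
Hypothesis mf : forall G : {set 'I_n}, G \notin D ->
  (forall H : {set 'I_n}, H \proper G -> H \in D) -> (#|G| <= N)%N.
Hypothesis Ne : (N + s <= e)%N.
Hypothesis Cs1 : forall f, f \is s.+1.-homog -> C f.

(** Surjectivity dualizes to injectivity: a test polynomial of degree e-k > s is omega h modulo the
    ideal, and f omega h vanishes because omega f does. *)
Lemma omega_inj k f : (k + s < e)%N -> f \is k.-homog -> J (theta d * f) -> J f.
Proof.
move=> ke fk Jf; apply: (pst_nondeg _ fk) => [|g gk]; first by lia.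
have [m em] : exists m, (e - k = m.+1)%N by exists (e - k).-1; lia.
rewrite em in gk; have [|h [hm Jh]] := ideal_quot gk.
  by apply: (ideal_lift Cs1) gk; lia.
have thh : theta d * h \is m.+1.-homog.
  by apply: thetaM_homog.
have -> : f * g = f * (g - theta d * h) + (theta d * f) * h by ring.
rewrite mulrDr raddfD /= (pst_mulr (k := k)) ?add0r; [|lia|done| |done]; last first.
  by rewrite em; apply: rpredB.
apply: (pst_mul (k := k.+1)) => //; first by lia.
  by apply: thetaM_homog.
by rewrite (_ : (e - k.+1)%N = m) //; lia.
Qed.

Variable z : {mpoly K[n]}.
Hypothesis zs : z \is s.-homog.

Lemma div_omega : exists zz : 'I_n -> {mpoly K[n]},
  forall w, zz w \is s.-homog /\ J ('X_w * z - theta d * zz w).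
Proof.
apply: (@fin_all_exists _ (fun=> _) (fun w zw => zw \is s.-homog /\ J ('X_w * z - theta d * zw))) => w.
have wz : 'X_w * z \is s.+1.-homog.
  by apply: varM_homog.
exact: ideal_quot (Cs1 wz).
Qed.

Section Functional.
Variable zz : 'I_n -> {mpoly K[n]}.
Hypothesis zzs : forall w, zz w \is s.-homog.
Hypothesis zzJ : forall w, J ('X_w * z - theta d * zz w).

(** Both terms become X_u X_w z after multiplication by omega, which is injective in degree s+1
    since 2s + 1 < e. *)
Lemma zz_swap u w : J ('X_u * zz w - 'X_w * zz u).
Proof.
apply: (@omega_inj s.+1); first by lia.
  by apply: rpredB; apply: varM_homog.
have -> : theta d * ('X_u * zz w - 'X_w * zz u) =
    'X_w * ('X_u * z - theta d * zz u) - 'X_u * ('X_w * z - theta d * zz w) by ring.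
by apply: in_idealB; apply: in_idealM.
Qed.

(** Multiplied by omega, the sum becomes theta_r z. With [zz_swap] this is the compatibility needed
    for the functional below to be well defined on the quotient. *)
Lemma zz_form r : (r < d)%N -> J (\sum_w a r w *: zz w).
Proof.
move=> rd; apply: (@omega_inj s); first by lia.
  by apply: rpred_sum => w _; apply/rpredZ/zzs.
have -> : theta d * (\sum_w a r w *: zz w) =
    theta r * z - \sum_w a r w *: ('X_w * z - theta d * zz w).
  rewrite mulr_sumr (thetaE _ r) mulr_suml -sumrB; apply: eq_bigr => w _.
  by rewrite scalerBr -scalerAl opprB addrCA subrr addr0 -scalerAr.
apply: in_idealB; first exact: in_ideal_theta.
by apply: in_ideal_sum => w _; apply: in_idealZ.
Qed.

(* The functional X_w m |-> psi (x_t z_w m), where X_w z = omega z_w; by zz_swap it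
   does not depend on the chosen w. A functional on forms of this degree is
   multiplication by some y, whence z_w = X_w y and z = omega y. *)
Definition phi_mon (M : 'X_{1..n}) : K :=
  if [pick w | M w != 0] is Some w then pst (zz w * 'X_[M - U_(w)]) else 0.

Lemma phi_monE w M : mdeg M = (e - s)%N -> phi_mon (U_(w) + M) = pst (zz w * 'X_[M]).
Proof.
move=> dM; rewrite /phi_mon; case: pickP => [u|/(_ w)]; last by rewrite mnmDE mnm1E eqxx.
have [->|uw] := eqVneq u w; first by rewrite addmC addmK.
rewrite mnmDE mnm1E (eq_sym w) (negbTE uw) add0n => Mu.
pose M' := (M - U_(u))%MM; have ME : M = (U_(u) + M')%MM := mnm_addBK Mu.
clearbody M'; have -> : (U_(w) + M - U_(u))%MM = (U_(w) + M')%MM by rewrite ME; apply/mnmP=> v; rewrite !(mnmBE, mnmDE); lia.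
apply/eqP; rewrite -subr_eq0 -raddfB /= -mulrBr ME !mpolyXD; apply/eqP.
have -> : zz u * ('X_w * 'X_[M']) - zz w * ('X_u * 'X_[M']) = ('X_w * zz u - 'X_u * zz w) * 'X_[M'] by ring.
apply: (pst_mul (k := s.+1)); [lia| |  |exact: zz_swap].
  by apply: rpredB; apply: varM_homog.
by rewrite dhomogX /=; apply/eqP; move: dM; rewrite ME mdegD mdeg1 subnS => <-.
Qed.

Definition phi (f : {mpoly K[n]}) : K :=
  \sum_(M : 'X_{1..n < (e - s).+2}) f@_M * phi_mon M.

Lemma phi_linear c f g : phi (c *: f + g) = c * phi f + phi g.
Proof.
rewrite /phi mulr_sumr -big_split; apply: eq_bigr => M _ /=.
by rewrite mcoeffD mcoeffZ mulrDl -mulrA.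
Qed.

Lemma phi0 : phi 0 = 0.
Proof. by rewrite /phi big1 // => M _; rewrite mcoeff0 mul0r. Qed.

Lemma phi_sum (c : 'I_n -> K) (F : 'I_n -> {mpoly K[n]}) :
  phi (\sum_w c w *: F w) = \sum_w c w * phi (F w).
Proof.
apply: (big_ind2 (fun p x => phi p = x)) => [|p x q y <- <-|w _]; first exact: phi0.
  by rewrite -[p]scale1r phi_linear mul1r scale1r.
by rewrite -[_ *: _]addr0 phi_linear phi0 addr0.
Qed.

Lemma phi_X M : mdeg M = (e - s).+1 -> phi 'X_[M] = phi_mon M.
Proof.
move=> dM; have bM : (mdeg M < (e - s).+2)%N by rewrite dM.
rewrite /phi (bigD1 (BMultinom bM)) //= mcoeffX eqxx mul1r big1 ?addr0 // => M' ne.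
rewrite mcoeffX; case: eqP => [E|_]; last by rewrite mul0r.
by case/eqP: ne; apply: val_inj; rewrite /= E.
Qed.

Lemma phi_mulX w g : g \is (e - s).-homog -> phi ('X_w * g) = pst (zz w * g).
Proof.
apply: (@homog_ind K n (e - s) (fun g => phi ('X_w * g) = pst (zz w * g))) => [|c p q hp hq|M dM].
- by rewrite !mulr0 phi0 raddf0.
- by rewrite !mulrDr -!scalerAr phi_linear hp hq [RHS]raddfD /= linearZ.
by rewrite -mpolyXD phi_X ?phi_monE // mdegD mdeg1 dM.
Qed.

(** A bad monomial all of whose divisors of degree one less are good is squarefree, and every
    minimal nonface in the union of its support with t contains the support. Its e-s+1 vertices
    would exceed N; here the bound on missing faces enters. *)
Lemma bad_split M : mdeg M = (e - s).+1 -> off (msup M) ->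
  exists w M', M = (U_(w) + M')%MM /\ off (msup M').
Proof.
move=> dM bM; have [/existsP[w /andP[Mw bw]]|no] :=
    boolP [exists w, (M w != 0%N) && off (msup (M - U_(w))%MM)].
  exists w, (M - U_(w))%MM; split=> //.
  exact: mnm_addBK.
have fw w : M w != 0%N -> msup (M - U_(w))%MM :|: t \in D.
  by move=> Mw; move: no; rewrite negb_exists => /forallP/(_ w); rewrite Mw /off_star negbK.
have M1 w : (M w <= 1)%N.
  rewrite leqNgt; apply/negP => Mw; move: bM; rewrite /off_star.
  have := fw w; rewrite -lt0n (ltnW Mw) => /(_ isT); rewrite (_ : msup (M - _) = msup M) => [->//|].
  apply/setP=> v; rewrite !inE mnmBE mnm1E; case: (w =P v) => [<-|_]; rewrite ?subn0 //.
  by rewrite -!lt0n subn_gt0 Mw (ltnW Mw).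
have ME : M = mset (msup M).
  by apply/mnmP=> w; rewrite mnmE inE; have := M1 w; case: (M w) => [|[|?]].
set G := msup M in ME; have cG : #|G| = (e - s).+1 by rewrite -dM ME mdeg_mset.
have [G' [sG GD' pr]] := minimal_nonface bM.
have GG : G \subset G'.
  apply/subsetP=> w wG; apply: contraNT GD' => wG'.
  have Mw : M w != 0%N by move: wG; rewrite inE.
  apply: (sf_down sphD (fw w Mw)); apply/subsetP=> x xG'.
  have xw : w != x by apply: contraNneq wG' => ->.
  have := subsetP sG x xG'; rewrite !inE mnmBE mnm1E (negbTE xw) subn0.
  by [].
have := mf GD' pr; have := subset_leq_card GG; rewrite cG; clear -Ne; lia.
Qed.

(** A bad monomial has the form X_w M' with M' still bad, so pairing with z_w gives 0; multiples of
    theta_r are killed by [zz_form]. *)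
Lemma phi_ideal r f : (r <= d)%N -> f \is (e - s).+1.-homog -> in_ideal theta r off f -> phi f = 0.
Proof.
elim: r f => [|r IH] f rd fh.
  move/in_ideal_mono0 => hf; rewrite /phi big1 // => M _.
  have [->|nz] := eqVneq (f@_M) 0; first by rewrite mul0r.
  have dM : mdeg M = (e - s).+1.
    by have /dhomogP := fh; apply; rewrite mcoeff_msupp.
  have [w [M' [E bM]]] := bad_split dM (hf _ nz).
  have dM' : mdeg M' = (e - s)%N by move: dM; rewrite E mdegD mdeg1 => -[].
  rewrite E phi_monE // (pst_mulr (k := s)) ?mulr0 //; first by lia.
    by rewrite dhomogX /= dM'.
  by apply: in_ideal_mono => M''; rewrite mcoeffX; case: (M' =P M'') => [<- _|_]; rewrite ?eqxx.
case/in_idealS=> g hg.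
have := in_ideal_homog (e - s).+1 hg; rewrite raddfB /= (pihomog_dE fh) pihomogM1; last exact: lin_homog.
set h := pihomog _ _ _ => Jh.
have hh : h \is (e - s).-homog by apply: pihomogP.
rewrite -[f](subrK (theta r * h)) -[X in X + _]scale1r phi_linear mul1r IH //; last 2 first.
- exact: ltnW.
- by apply: rpredB => //; apply: thetaM_homog.
rewrite add0r thetaE mulr_suml; under eq_bigr do rewrite -scalerAl.
rewrite phi_sum.
have -> : \sum_w a r w * phi ('X_w * h) = pst ((\sum_w a r w *: zz w) * h).
  rewrite mulr_suml mulr_sumr raddf_sum /=; apply: eq_bigr => w _.
  by rewrite phi_mulX // -scalerAl -scalerAr linearZ.
apply: (pst_mul (k := s)) => //; first by lia.
  by apply: rpred_sum => w _; apply/rpredZ/zzs.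
exact: zz_form.
Qed.

(** In general y has degree s-1. For s = 0 the functional lives above the top degree, so it is zero
    and y = 0; stating the degree of X_w y covers both cases. *)
Lemma phi_repr : exists y, (forall w, 'X_w * y \is s.-homog) /\
  forall f, f \is (e - s).+1.-homog -> phi f = pst (y * f).
Proof.
pose phi' (f : dhomog n K (e - s).+1) : K^o := phi (val f).
have lin' : linear phi' by move=> c f g; rewrite /phi' /= phi_linear.
have kill (f : dhomog n K (e - s).+1) : J (val f) -> phi' f = 0.
  by move=> Jf; apply: (phi_ideal (leqnn d)) => //; apply: valP.
have [s0|s0] := posnP s.
  exists 0; split=> [w|f fh]; first by rewrite mulr0 rpred0.
  rewrite mul0r mulr0 raddf0.
  by apply: (star_functional_top sphD char2 gen tD lin' kill _ (DHomog fh)); rewrite s0 subn0.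
have [|y hy] := star_functional sphD char2 gen tD lin' kill; first by rewrite ltn_subrL s0 /=; apply: leq_trans se; lia.
exists (val y); split=> [w|f fh]; last exact: (hy (DHomog fh)).
have yh : val y \is (e - (e - s).+1).-homog by apply: valP.
suff : 'X_w * val y \is (1 + (e - (e - s).+1)).-homog by rewrite (_ : (1 + _)%N = s) //; lia.
by apply: dhomogM => //; rewrite dhomogX /= mdeg1.
Qed.

(** Nondegeneracy turns the representation of phi into z_w = X_w y, so every variable kills z -
    omega y. This class has degree s < e, while the socle lies in degree e; hence z = omega y. *)
Lemma socle_step_aux : C z.
Proof.
have [y [yh hy]] := phi_repr.
have zy w : J (zz w - 'X_w * y).
  apply: (pst_nondeg (k := s)) => [||g gh]; first by lia.
    by apply: rpredB; [apply: zzs | apply: yh].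
  have -> : pst ((zz w - 'X_w * y) * g) = pst (zz w * g) - pst (y * ('X_w * g)).
    by rewrite -raddfB -mulrBr /=; congr psi; ring.
  by rewrite -phi_mulX // hy ?subrr //; apply: varM_homog.
have xz w : J ('X_w * (z - theta d * y)).
  have -> : 'X_w * (z - theta d * y) = ('X_w * z - theta d * zz w) + theta d * (zz w - 'X_w * y) by ring.
  by apply: in_idealD => //; apply: in_idealM.
apply/in_idealS; exists y.
have zyh : z - theta d * y \is s.-homog.
  apply: rpredB => //; rewrite thetaE mulr_suml; apply: rpred_sum => w _.
  by rewrite -scalerAl; apply/rpredZ/yh.
apply: (pst_nondeg _ zyh) => [|g]; first by lia.
apply: (@homog_ind K n (e - s) (fun g => pst ((z - theta d * y) * g) = 0)) => [|c p q hp hq|M dM].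
- by rewrite !mulr0 raddf0.
- by rewrite !mulrDr -!scalerAr raddfD /= linearZ /= hp hq mulr0 addr0.
have [m em] : exists m, (e - s = m.+1)%N by exists (e - s).-1; lia.
rewrite em in dM; have [w [M' [-> dM']]] := mnm_split dM.
have -> : (z - theta d * y) * 'X_[U_(w) + M'] = ('X_w * (z - theta d * y)) * 'X_[M'].
  by rewrite mpolyXD; ring.
apply: (pst_mul (k := s.+1)) => //; first by lia.
  by apply: varM_homog.
by rewrite dhomogX /= dM' subnS em.
Qed.

End Functional.

Lemma socle_step : C z.
Proof. by have [zz h] := div_omega; apply: (socle_step_aux (zz := zz)) => w; case: (h w). Qed.

End Step.

(** The induction starts from 1, which is never in the ideal. The bound [N + s <= e.+1] at s+1 is
    the bound needed for the step at s. *)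
Lemma star_nonzero N s : (2 * s <= e)%N -> (N + s <= e.+1)%N ->
  (forall G : {set 'I_n}, G \notin D -> (forall H : {set 'I_n}, H \proper G -> H \in D) -> (#|G| <= N)%N) ->
  exists f, f \is s.-homog /\ ~ C f.
Proof.
move=> se Ns mf; elim: s se Ns => [|s IH] se Ns.
  exists 1; split; first by rewrite -mpolyX0 dhomogX /= mdeg0.
  exact: one_notin_ideal.
case: IH => [||z [zs zC]]; [lia|lia|].
apply: NNPP => no; apply: zC; apply: (socle_step se mf _ _ zs); first by lia.
by move=> f fs; apply: NNPP => nC; apply: no; exists f.
Qed.

End Socle.

(** * Nonzero classes divisible by the monomial of the face *)

Section Peeling.
Variable t : {set 'I_n}.

Local Notation off := (off_star D t).
Local Notation C p := (in_ideal theta d.+1 off p).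
Let up : upward off := off_star_up sphD (t := t).

(* A derivation annihilating every theta_r: the coefficient part cancels X_u d/dX_v. *)
Definition mixed_deriv (u v : 'I_n) (p : {mpoly K[n]}) : {mpoly K[n]} :=
  'X_u * mderiv v p + \sum_(s < d.+1) a s v *: dcoef (der s u) p.

Section OneDerivation.
Variables u v : 'I_n.
Local Notation md := (mixed_deriv u v).

Lemma mixed_derivD p q : md (p + q) = md p + md q.
Proof.
rewrite /mixed_deriv mderivD mulrDr addrACA -big_split; congr (_ + _).
by apply: eq_bigr => s _; rewrite dcoefD // scalerDr.
Qed.

Lemma mixed_deriv0 : md 0 = 0.
Proof.
by rewrite /mixed_deriv mderiv0 mulr0 add0r big1 // => s _; rewrite dcoef0 // scaler0.
Qed.

Lemma mixed_derivM p q : md (p * q) = md p * q + p * md q.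
Proof.
rewrite /mixed_deriv mderivM.
rewrite (_ : \sum_(s < d.+1) a s v *: dcoef (der s u) (p * q) =
   (\sum_(s < d.+1) a s v *: dcoef (der s u) p) * q + p * (\sum_(s < d.+1) a s v *: dcoef (der s u) q)).
  by ring.
rewrite mulr_suml mulr_sumr -big_split; apply: eq_bigr => s _ /=.
by rewrite dcoefM // scalerDr scalerAl scalerAr.
Qed.

Lemma mixed_deriv_theta r : (r <= d)%N -> md (theta r) = 0.
Proof.
move=> rd; rewrite /mixed_deriv thetaE.
have -> : mderiv v (\sum_w a r w *: 'X_w) = (a r v)%:MP.
  rewrite raddf_sum (bigD1 v) //= mderivZ mderivX mnm1E eqxx big1 ?addr0 => [|w wv].
    rewrite (_ : (U_(v) - U_(v))%MM = 0%MM); last by apply/mnmP=> x; rewrite mnmBE mnm0E subnn.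
    by rewrite mpolyX0 scale1r -mul_mpolyC mulr1.
  by rewrite mderivZ mderivX mnm1E (negbTE wv) scale0r scaler0.
have rd' : (r < d.+1)%N by [].
rewrite (bigD1 (Ordinal rd')) //= [X in _ + (_ + X)]big1 => [|s sr].
  rewrite addr0 dcoef_lin // (bigD1 u) //= der_a // !eqxx scale1r big1 => [|w wu].
    rewrite addr0 mulrC mul_mpolyC; apply: addrr_pchar2; by rewrite (rmorph_pchar (@mpolyC n K)).
  by rewrite der_a // eqxx eq_sym (negbTE wu) scale0r.
rewrite dcoef_lin // big1 ?scaler0 // => w _; rewrite der_a //; last by rewrite -ltnS.
by rewrite (_ : (s : nat) == r = false) ?scale0r //; apply: negbTE; rewrite -val_eqE in sr.
Qed.

(** The forms are killed, so only their cofactors get differentiated. Bad monomials stay bad because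
    v lies in t: dropping X_v does not change the union of the support with t. *)
Lemma mixed_deriv_ideal p : v \in t -> C p -> C (md p).
Proof.
move=> vt [g hg].
have -> : md p = md (p - \sum_(s < d.+1) theta s * g s) + \sum_(s < d.+1) theta s * md (g s).
  rewrite -[p in LHS](subrK (\sum_(s < d.+1) theta s * g s)) [LHS]mixed_derivD; congr (_ + _).
  rewrite (big_morph md mixed_derivD mixed_deriv0); apply: eq_bigr => s _.
  by rewrite mixed_derivM mixed_deriv_theta ?mul0r ?add0r // -ltnS.
apply: in_idealD; last by apply: in_ideal_sum => s _; apply: in_ideal_theta.
apply: in_ideal_mono; set q := p - _ in hg *; apply: mono_idealD.
  apply: mono_idealM => //; rewrite [q]mpolyE raddf_sum /= big_seq; apply: mono_ideal_sum => M.
  rewrite mcoeff_msupp => /hg bM M'; rewrite mderivZ mderivX !mcoeffZ mcoeffX.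
  case: ((M - U_(v))%MM =P M') => [<- _|_]; last by rewrite !mulr0 eqxx.
  rewrite /off_star; apply: contra bM => /(sf_down sphD); apply; apply/subsetP=> w.
  rewrite !inE mnmBE mnm1E; case: (v =P w) => [<-|_]; first by rewrite vt !orbT.
  by rewrite subn0.
by apply: mono_ideal_sum => s _ M; rewrite mcoeffZ mulf_eq0 negb_or => /andP[_]; apply: dcoef_mono.
Qed.

End OneDerivation.

(** A monomial divisible by X_v is covered at once. Otherwise it is X_u M', and [mixed_deriv u v]
    sends x_v x_r M' to X_u x_r M'; as X_v occurs exactly once, no even factor arises. *)
Lemma peel_var (v : 'I_n) (r : {set 'I_n}) k : v \in t -> v \notin r ->
  (forall g, g \is k.-homog -> C (xset K (v |: r) * g)) ->
  forall g, g \is k.+1.-homog -> C (xset K r * g).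
Proof.
move=> vt vr h; apply: homog_ind => [|c p q hp hq|M dM].
- by rewrite mulr0; apply: in_ideal0.
- by rewrite mulrDr -scalerAr; apply: in_idealD => //; apply: in_idealZ.
have xv : mset (v |: r) = (U_(v) + mset r)%MM.
  apply/mnmP=> w; rewrite mnmDE mnm1E !mnmE !inE.
  by case: (eqVneq w v) => [->|]; rewrite ?(negbTE vr) ?eqxx // eq_sym => /negbTE ->.
have [Mv|Mv] := eqVneq (M v) 0%N; last first.
  have E := mnm_addBK Mv.
  have -> : xset K r * 'X_[M] = xset K (v |: r) * 'X_[M - U_(v)].
    by rewrite E /xset xv -!mpolyXD -E; congr 'X_[_]; rewrite {1}E; apply/mnmP=> x; rewrite !mnmDE; lia.
  by apply: h; rewrite dhomogX /=; move: dM; rewrite {1}E mdegD mdeg1 add1n => -[->].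
have [u [M' [E dM']]] := mnm_split dM.
have uv : u != v by apply/eqP => uv; move: Mv; rewrite E mnmDE mnm1E uv eqxx.
have M'v : M' v = 0%N by move: Mv; rewrite E mnmDE => /eqP; rewrite addn_eq0 => /andP[_ /eqP].
have /(mixed_deriv_ideal u vt) : C (xset K (v |: r) * 'X_[M']).
  by apply: h; rewrite dhomogX /= dM'.
rewrite /mixed_deriv big1 ?addr0 => [|s _]; last by rewrite /xset -mpolyXD dcoefX // scaler0.
rewrite /xset -mpolyXD mderivX xv !mnmDE mnm1E eqxx mnmE (negbTE vr) M'v scale1r -mpolyXD.
by rewrite -mpolyXD E; congr (C 'X_[_]); apply/mnmP=> w; rewrite !(mnmDE, mnmBE, mnm1E); lia.
Qed.

(** Contrapositive: if all multiples of x_t in degree i lie in the ideal, the vertices of t can be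
    removed from the monomial one by one until every form of degree i does. *)
Lemma peel_face i (f : {mpoly K[n]}) : (#|t| <= i)%N -> f \is i.-homog -> ~ C f ->
  exists g, g \is (i - #|t|).-homog /\ ~ C (xset K t * g).
Proof.
move=> ti fi nC; apply: NNPP => no; apply: nC; rewrite -[f]mul1r -(xset0 K n).
have h g : g \is (i - #|t|).-homog -> C (xset K t * g).
  by move=> gh; apply: NNPP => nC; apply: no; exists g.
suff H (r : {set 'I_n}) : r \subset t -> forall g, g \is (i - #|r|).-homog -> C (xset K r * g).
  by apply: H; rewrite ?sub0set // cards0 subn0.
move: {2}(#|t :\: r|)%N (erefl #|t :\: r|) => k; elim: k r => [|k IH] r kr rt g gh.
  have E : r = t.
    by apply/eqP; rewrite eqEsubset rt -setD_eq0 -cards_eq0 kr.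
  by rewrite E; apply: h; rewrite -E.
have [v] : exists v, v \in t :\: r by apply/set0Pn; rewrite -card_gt0 kr.
rewrite inE => /andP[vr vt].
have cr : (#|v |: r| = #|r|.+1)%N by rewrite cardsU1 vr.
have vrt : v |: r \subset t by rewrite subUset sub1set vt.
have ci : (i - #|r| = (i - #|v |: r|).+1)%N.
  by have := subset_leq_card vrt; rewrite cr; lia.
rewrite ci in gh; apply: (peel_var vt vr _ gh); apply: IH => //.
have -> : t :\: (v |: r) = (t :\: r) :\ v by rewrite setDDl setUC.
by move: kr; rewrite (cardsD1 v) inE vr vt => -[].
Qed.

End Peeling.

(** * Two classes for every vertex *)

Section TwoElements.
Variables i N : nat.
Hypothesis i2 : (2 <= i)%N.
Hypothesis id : (3 * i <= d)%N.
Hypothesis mf : nonfaces_bounded D N.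
Hypothesis Nd : (N + 2 * i <= d.+1)%N.
Hypothesis Nd2 : ((N.-1).*2 < d.-1)%N.

Local Notation C t p := (in_ideal theta d.+1 (off_star D t) p).

(** For e = d - |t| and |t| <= i, [3 * i <= d] gives 2i <= e and [N + 2 * i <= d.+1] gives N + i <=
    e + 1, the two bounds of [star_nonzero]. *)
Lemma face_element t : t \in D -> (#|t| <= i)%N ->
  exists g, g \is (i - #|t|).-homog /\ ~ C t (xset K t * g).
Proof.
move=> tD ti; have [f [fi nC]] : exists f, f \is i.-homog /\ ~ C t f.
  by apply: (star_nonzero tD _ _ _ mf); lia.
exact: (peel_face ti fi nC).
Qed.

Lemma off_face (t t' : {set 'I_n}) g : t :|: t' \notin D -> C t' (xset K t * g).
Proof.
move=> tD; rewrite mulrC; apply: in_idealM; first exact: off_star_up sphD _.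
apply: in_ideal_mono => M; rewrite mcoeffX; case: (_ =P M) => [<- _|_]; last by rewrite eqxx.
by rewrite msup_mset.
Qed.

Definition two_independent v := exists p q, [/\ p \is i.-1.-homog, q \is i.-1.-homog &
  forall b c, C [set v] (b *: ('X_v * p) + c *: ('X_v * q)) -> b = 0 /\ c = 0].

(** The monomial of [w |: r] vanishes on the star of [u |: r], and conversely; restricting a
    relation to either star isolates one coefficient. *)
Lemma two_independent_split v (r : {set 'I_n}) u w : v \in r -> (#|r| < i)%N ->
  u |: r \in D -> w |: r \in D -> u |: (w |: r) \notin D -> two_independent v.
Proof.
move=> vr ri uD wD nD.
have cle x : (#|x |: r| <= i)%N by rewrite cardsU1; case: (x \notin r); lia.
have [g [gh gC]] := face_element uD (cle u).
have [h [hh hC]] := face_element wD (cle w).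
have vx x : v \in x |: r by rewrite !inE vr orbT.
have fac x k : k \is (i - #|x |: r|).-homog -> xset K ((x |: r) :\ v) * k \is i.-1.-homog.
  move=> kh; have cx : (0 < #|x |: r|)%N by rewrite card_gt0; apply/set0Pn; exists v.
  have e1 : #|(x |: r) :\ v| = (#|x |: r|).-1 by rewrite [in RHS](cardsD1 v) vx.
  suff : xset K ((x |: r) :\ v) * k \is (#|(x |: r) :\ v| + (i - #|x |: r|)).-homog.
    by rewrite (_ : (_ + _)%N = i.-1) // e1; have := cle x; move: cx; move: #|x |: r| => m; clear; lia.
  by apply: dhomogM => //; apply: xset_homog.
exists (xset K ((u |: r) :\ v) * g), (xset K ((w |: r) :\ v) * h); split; [exact: fac|exact: fac|].
move=> b c; rewrite !mulrA -!xset_setD1 // => hC0.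
have sub x : [set v] \subset x |: r by rewrite sub1set.
have wk x p : C [set v] p -> C (x |: r) p.
  by apply: in_ideal_weaken => A; apply: (off_star_sub sphD).
have nD' : (w |: r) :|: (u |: r) \notin D.
  by move: nD; rewrite [in X in _ -> X]setUC -setUA (setUCA r) setUid.
split; apply: NNPP => /eqP nz.
  apply: gC; have : C (u |: r) (b *: (xset K (u |: r) * g)).
    rewrite -[X in in_ideal _ _ _ X](addrK (c *: (xset K (w |: r) * h))); apply: in_idealB; first exact: wk.
    by apply/in_idealZ/off_face.
  by move/(in_idealZ b^-1); rewrite scalerA mulVf // scale1r.
apply: hC; have : C (w |: r) (c *: (xset K (w |: r) * h)).
  rewrite -[X in in_ideal _ _ _ X](addKr (b *: (xset K (u |: r) * g))); apply: in_idealD; last exact: wk.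
  by apply/in_idealN/in_idealZ/off_face; rewrite setUC.
by move/(in_idealZ c^-1); rewrite scalerA mulVf // scale1r.
Qed.

(** * Vertices with a neighbourly star *)

Section Neighbourly.
Variable v : 'I_n.
Hypothesis vD : [set v] \in D.
Local Notation W := (star_vertices D v).
Hypothesis full : forall s : {set 'I_n}, s \subset W -> v \in s -> (#|s| <= i.+1)%N -> s \in D.

(** Values at v and u are prescribed, and d+1 further vertices of the star are the unknowns of d+1
    equations with invertible matrix; this uses d+3 vertices. *)
Lemma solution_point u (x : K) : u \in W -> u != v ->
  exists y : 'I_n -> K, [/\ y v = 1, y u = x, (forall w, w \notin W -> y w = 0) &
    forall r, (r <= d)%N -> \sum_w a r w * y w = 0].
Proof.
move=> uW uv.
have [B BW cB] : exists2 B : {set 'I_n}, B \subset W :\: [set u; v] & #|B| = d.+1.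
  apply: exists_subset; rewrite cardsD; have := star_vertices_card sphD mf vD _ Nd2.
  have : (#|W :&: [set u; v]| <= 2)%N by rewrite (leq_trans (subset_leq_card (subsetIr _ _))) // cards2 uv.
  by move: #|W :&: _| #|W| => x1 x2; lia.
pose e (j : 'I_d.+1) : 'I_n := enum_val (cast_ord (esym cB) j).
have ei : injective e by move=> j k /enum_val_inj/cast_ord_inj.
have eB j : e j \in W :\: [set u; v] by apply: (subsetP BW); apply: enum_valP.
have eu j : e j != u by have := eB j; rewrite !inE negb_or -andbA => /and3P[].
have ev j : e j != v by have := eB j; rewrite !inE negb_or -andbA => /and3P[].
have eW j : e j \in W by have := eB j; rewrite inE => /andP[].
pose M := \matrix_(r < d.+1, c < d.+1) a r (e c).
have Mu : M \in unitmx by rewrite unitmxE unitfE; apply: gen1.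
pose b := \col_(r < d.+1) (- (a r v + a r u * x)).
pose s := invmx M *m b.
have sM : M *m s = b by rewrite mulKVmx.
clearbody s.
exists (fun w => (w == v)%:R + (w == u)%:R * x + \sum_j (w == e j)%:R * s j 0); split.
- rewrite eqxx (eq_sym v) (negbTE uv) mul0r addr0 big1 ?addr0 // => j _.
  by rewrite eq_sym (negbTE (ev j)) mul0r.
- rewrite eqxx (negbTE uv) mul1r add0r big1 ?addr0 // => j _.
  by rewrite eq_sym (negbTE (eu j)) mul0r.
- move=> w wW; have vW : v \in W by rewrite inE setUid.
  have ne z : z \in W -> (w == z) = false by move=> zW; apply: contraNF wW => /eqP ->.
  by rewrite !ne // mul0r !add0r big1 // => j _; rewrite ne // mul0r.
move=> r rd; have rd' : (r < d.+1)%N by [].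
have pt z (t : K) : \sum_w a r w * ((w == z)%:R * t) = a r z * t.
  rewrite (bigD1 z) //= eqxx mul1r big1 ?addr0 // => w /negbTE ->.
  by rewrite mul0r mulr0.
have ptv : \sum_w a r w * (w == v)%:R = a r v.
  by have := pt v 1; rewrite mulr1 => <-; apply: eq_bigr => w _; rewrite mulr1.
under eq_bigr do rewrite !mulrDr.
rewrite !big_split /= ptv pt.
have -> : \sum_w a r w * (\sum_j (w == e j)%:R * s j 0) = \sum_j a r (e j) * s j 0.
  under eq_bigr do rewrite mulr_sumr.
  by rewrite exchange_big; apply: eq_bigr => j _; rewrite pt.
have := congr1 (fun Z : 'cV_d.+1 => Z (Ordinal rd') 0) sM; rewrite !mxE /= => E.
have -> : \sum_j a r (e j) * s j 0 = - (a r v + a r u * x).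
  by rewrite -E; apply: eq_bigr => j _; rewrite mxE.
by rewrite subrr.
Qed.

(** A monomial of degree i in vertices of the star has at most i+1 vertices together with v, hence
    is good. So every bad monomial of degree i involves a point outside W, where y is 0. *)
Lemma neighbourly_eval0 (f : {mpoly K[n]}) y : f \is i.-homog -> C [set v] f ->
  (forall w, w \notin W -> y w = 0) ->
  (forall r, (r <= d)%N -> \sum_w a r w * y w = 0) -> f.@[y] = 0.
Proof.
move=> fi Cf yW yth.
have thy r : (r < d.+1)%N -> (theta r).@[y] = 0.
  move=> rd; rewrite thetaE raddf_sum /= -[RHS](yth r) //; apply: eq_bigr => w _.
  by rewrite mevalZ mevalXU.
have : forall r f, (r <= d.+1)%N -> f \is i.-homog -> in_ideal theta r (off_star D [set v]) f -> f.@[y] = 0.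
  move=> {f fi Cf} r; elim: r => [|r IH] f rd fi.
    move/in_ideal_mono0 => hf; rewrite [f]mpolyE raddf_sum big_seq big1 //= => M Mf.
    rewrite mevalZ mevalX; have [/existsP[w /andP[Mw wW]]|no] := boolP [exists w, (M w != 0%N) && (w \notin W)].
      by rewrite (bigD1 w) //= yW // expr0n (negbTE Mw) mul0r mulr0.
    rewrite mcoeff_msupp in Mf; have := hf _ Mf; rewrite /off_star full //.
    - rewrite subUset sub1set !inE setUid vD andbT; apply/subsetP=> w; rewrite [w \in msup _]inE => Mw.
      by move: no; rewrite negb_exists => /forallP/(_ w); rewrite Mw negbK.
    - by rewrite !inE eqxx orbT.
    have dM : mdeg M = i by move/dhomogP: fi; apply; rewrite mcoeff_msupp.
    apply: leq_trans (leq_card_setU _ _) _; rewrite cards1 addn1 ltnS -dM mdegE -sum1_card big_mkcond /=.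
    by apply: leq_sum => w _; rewrite inE -lt0n; case: (M w).
  case/in_idealS=> g hg; have [j ij] : exists j, i = j.+1 by exists i.-1; lia.
  have := in_ideal_homog i hg; rewrite raddfB /= (pihomog_dE fi) ij pihomogM1; last exact: lin_homog.
  set h := pihomog _ _ _ => Jh; rewrite ij in fi IH.
  rewrite -[f](subrK (theta r * h)) mevalD IH ?add0r //; [|exact: ltnW|].
    by rewrite mevalM thy ?mul0r.
  by apply: rpredB => //; apply: thetaM_homog; apply: pihomogP.
by move/(_ d.+1 f (leqnn _) fi Cf).
Qed.

(* X_v^i and X_v^(i-1) X_u are told apart by their values at common zeros of the d+1 forms. *)
Lemma two_independent_neighbourly : two_independent v.
Proof.
have [u uW uv] : exists2 u, u \in W & u != v.
  have := star_vertices_card sphD mf vD _ Nd2; rewrite (cardsD1 v) => cW.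
  have /set0Pn[u] : W :\ v != set0.
    by rewrite -card_gt0; move: cW; case: (v \in W); move: #|W :\ v| => x; lia.
  by rewrite in_setD1 => /andP[]; exists u.
have [j ij] : exists j, i.-1 = j.+1 by exists i.-2; lia.
exists ('X_v ^+ i.-1), ('X_v ^+ j * 'X_u).
have Xn w m : ('X_w : {mpoly K[n]}) ^+ m \is m.-homog.
  by rewrite mpolyXn dhomogX /= mdegMn mdeg1 mul1n.
have Xp : ('X_v ^+ j * 'X_u : {mpoly K[n]}) \is i.-1.-homog by rewrite ij mulrC; apply: varM_homog.
split=> // b c Cbc.
have ev x y : y v = 1 -> y u = x ->
    (b *: ('X_v * 'X_v ^+ i.-1) + c *: ('X_v * ('X_v ^+ j * 'X_u))).@[y] = b + c * x.
  move=> yv yu; rewrite mevalD !mevalZ !mevalM !rmorphXn /= !mevalXU yv yu.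
  by rewrite !expr1n !mul1r mulr1.
have hom : (b *: ('X_v * 'X_v ^+ i.-1) + c *: ('X_v * ('X_v ^+ j * 'X_u))) \is i.-homog.
  have ii : i = i.-1.+1 by lia.
  by rewrite [X in X.-homog]ii; apply: rpredD; apply: rpredZ; apply: varM_homog.
have E x : b + c * x = 0.
  have [y [yv yu yW yth]] := solution_point x uW uv.
  by rewrite -(ev _ _ yv yu); apply: (neighbourly_eval0 hom Cbc).
have b0 : b = 0 by have := E 0; rewrite mulr0 addr0.
by split=> //; have := E 1; rewrite b0 add0r mulr1.
Qed.

End Neighbourly.

(** If the star is not neighbourly, a smallest nonface s containing v among the sets concerned has
    two further vertices u and w. Removing either gives a face, and r, without both, has at most i-1
    elements. *)
Lemma vertex_two_independent v : [set v] \in D -> two_independent v.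
Proof.
move=> vD; apply: NNPP => no; apply: (no); apply: two_independent_neighbourly => //.
move=> s; move E : #|s| => k; elim: k s E => [|k IH] s cs sW vs ki.
  by move/eqP: cs; rewrite cards_eq0 => /eqP s0; rewrite s0 inE in vs.
have [/eqP|/set0Pn[u us]] := boolP (s :\ v == set0).
  move=> s0; rewrite (_ : s = [set v]) //; apply/eqP; rewrite eqEsubset sub1set vs andbT.
  by rewrite -setD_eq0 s0.
have [/eqP s0|/set0Pn[w]] := boolP ((s :\ v) :\ u == set0).
  have uv : u != v by move: us; rewrite !inE => /andP[].
  have -> : s = [set v; u].
    by rewrite -(setD1K vs) -(setD1K us) s0 setU0.
  have /(subsetP sW) : u \in s by move: us; rewrite !inE => /andP[].
  by rewrite inE.
rewrite !inE => /and3P[wu wv ws]; move: us; rewrite !inE => /andP[uv us].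
pose r := (s :\ u) :\ w.
have wsu : w \in s :\ u by rewrite !inE wu.
have usw : u \in s :\ w by rewrite !inE eq_sym wu.
have wr : w |: r = s :\ u by rewrite setD1K.
have ur : u |: r = s :\ w by rewrite /r setDDl [in X in u |: X]setUC -setDDl setD1K.
have wD : w |: r \in D.
  rewrite wr; apply: IH; last exact: ltnW.
  - by move: cs; rewrite (cardsD1 u) us add1n => -[].
  - exact: subset_trans (subsetDl _ _) sW.
  by rewrite !inE eq_sym uv.
have uD : u |: r \in D.
  rewrite ur; apply: IH; last exact: ltnW.
  - by move: cs; rewrite (cardsD1 w) ws add1n => -[].
  - exact: subset_trans (subsetDl _ _) sW.
  by rewrite !inE eq_sym wv.
apply: NNPP => /negP sD; apply: no; apply: (two_independent_split _ _ uD wD).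
- by rewrite !inE eq_sym wv eq_sym uv.
- by move: cs ki; rewrite (cardsD1 u) us (cardsD1 w) wsu -/r !add1n => -[<-].
by rewrite wr setD1K.
Qed.

Lemma independent_gnum (A : {set 'I_n}) : independent D A -> (2 * #|A|)%:Z <= gnum d D i.
Proof.
case/andP=> /subsetP AD /forall_inP Aind.
have nadj u v : u \in A -> v \in A -> u != v -> [set u; v] \notin D.
  by move=> uA vA uv; have /forall_inP/(_ v vA) := Aind u uA; rewrite /adjacent uv.
rewrite (gnum_hilb); [|lia|lia].
rewrite lez_nat /hilb; set U := dhomog _ _ _; set J := jvs _ _ _ _.
pose T := {x : 'I_n | x \in A}.
have ex (x : T) : exists pq : {mpoly K[n]} * {mpoly K[n]}, [/\ pq.1 \is i.-1.-homog, pq.2 \is i.-1.-homog &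
    forall b c, in_ideal theta d.+1 (off_star D [set val x]) (b *: ('X_(val x) * pq.1) + c *: ('X_(val x) * pq.2)) -> b = 0 /\ c = 0].
  have xD : [set val x] \in D by have := AD _ (valP x); rewrite inE.
  have [p [q h]] := vertex_two_independent xD.
  by exists (p, q).
have [pq hpq] := fin_all_exists ex.
pose q (x : T * bool) := if x.2 then (pq x.1).1 else (pq x.1).2.
have qh x : 'X_(val x.1) * q x \is i.-homog.
  suff : 'X_(val x.1) * q x \is i.-1.+1.-homog by rewrite (_ : i.-1.+1 = i) //; lia.
  by apply: varM_homog; rewrite /q; case: (hpq x.1) => h1 h2 _; case: x.2.
have ind (c : T * bool -> K) : \sum_x c x *: (DHomog (qh x) : U) \in J -> forall x, c x = 0.
  move/(mem_jvs a _ d.+1 _); rewrite raddf_sum /= => hJ [x e].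
  have : in_ideal theta d.+1 (off_star D [set val x]) (c (x, true) *: ('X_(val x) * (pq x).1) + c (x, false) *: ('X_(val x) * (pq x).2)).
    have := in_ideal_weaken (fun B => off_star_sub sphD (sub0set [set val x])) hJ.
    rewrite (bigID (fun y : T * bool => y.1 == x)) /=; set S1 := \sum_(y | y.1 == x) _; set S2 := \sum_(y | y.1 != x) _.
    have -> : S1 = c (x, true) *: ('X_(val x) * (pq x).1) + c (x, false) *: ('X_(val x) * (pq x).2).
      pose G y b := c (y, b) *: ('X_(val y) * q (y, b)).
      have : \sum_(y | pred1 x y) \sum_b G y b = \sum_(p | pred1 x p.1 && predT p.2) G p.1 p.2.
        exact: pair_big.
      rewrite (big_pred1 x) // big_bool => -> /=; apply: eq_big => [y|[y b] _] //=; by rewrite andbT.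
    move=> h1; rewrite -[X in in_ideal _ _ _ X](addrK S2); apply: in_idealB => //.
    apply: in_ideal_sum => -[y b] /= yx; apply: in_idealZ.
    have -> : 'X_(val y) = xset K [set val y].
      by rewrite (xset_setD1 K (set11 (val y))) setDv xset0 mulr1.
    apply: off_face; apply: nadj; rewrite ?(valP x) ?(valP y) //.
  by case: (hpq x) => _ _ h /h[]; case: e.
have := leq_dim_codim ind; rewrite card_prod card_bool card_sig /=.
have -> : #|[pred x | x \in A]| = #|A| by apply: eq_card.
move: (\dim _) (\dim _) => x y; move: #|A| => z; clear; rewrite /=; lia.
Qed.

End TwoElements.

End GenericReduction.

(** * Generic coefficients *)

Section QuotientRule.
Variables (F : fieldType) (p q r s p' q' r' s' : F).

Lemma quotient_rule_eq : q != 0 -> s != 0 -> p * s = r * q ->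
  p' * s + p * s' = r' * q + r * q' ->
  (r' * s - r * s') / s ^+ 2 = (p' * q - p * q') / q ^+ 2.
Proof.
move=> q0 s0 cr dcr; apply/eqP; rewrite eqr_div ?expf_neq0 // eq_sym; apply/eqP.
have -> : (p' * q - p * q') * s ^+ 2 =
    q * s * (p' * s + p * s') - (q * s' + q' * s) * (p * s) by ring.
by rewrite dcr cr; ring.
Qed.

Lemma quotient_rule_add : q != 0 -> s != 0 ->
  ((p' * s + p * s' + (r' * q + r * q')) * (q * s) - (p * s + r * q) * (q' * s + q * s')) / (q * s) ^+ 2 =
  (p' * q - p * q') / q ^+ 2 + (r' * s - r * s') / s ^+ 2.
Proof. by move=> q0 s0; field; rewrite q0 s0. Qed.

Lemma quotient_rule_mul : q != 0 -> s != 0 ->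
  ((p' * r + p * r') * (q * s) - (p * r) * (q' * s + q * s')) / (q * s) ^+ 2 =
  (p' * q - p * q') / q ^+ 2 * (r / s) + p / q * ((r' * s - r * s') / s ^+ 2).
Proof. by move=> q0 s0; field; rewrite q0 s0. Qed.

End QuotientRule.

Section FractionDerivation.
Variable R : idomainType.
Local Notation tofrac := (@FracField.tofrac R).

Lemma fraction_split (x : {fraction R}) : exists nd : R * R,
  (nd.2 != 0) && (x == tofrac nd.1 / tofrac nd.2).
Proof.
have d0 : \d_(repr x) != 0 := denom_ratioP _.
exists (\n_(repr x), \d_(repr x)); rewrite d0 /=; apply/eqP.
have t0 : tofrac \d_(repr x) != 0 by rewrite tofrac_eq0.
apply: (canRL (mulfK t0)); rewrite -{1}[x]reprK.
change (FracField.mul (\pi_(FracField.type R)%qT (repr x)) (tofrac \d_(repr x)) = tofrac \n_(repr x)).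
rewrite !piE; apply/eqmodP; rewrite /= FracField.equivfE /FracField.mulf.
by rewrite !numden_Ratio ?oner_eq0 ?mulf_neq0 ?oner_neq0 // !mulr1 mulrC.
Qed.

Variable D0 : R -> R.
Hypothesis D0D : forall x y, D0 (x + y) = D0 x + D0 y.
Hypothesis D0M : forall x y, D0 (x * y) = D0 x * y + x * D0 y.

(** The quotient rule on one chosen representative; [frac_derE] shows that the choice does not
    matter. *)
Definition frac_der (x : {fraction R}) : {fraction R} :=
  let nd := xchoose (fraction_split x) in
  (tofrac (D0 nd.1) * tofrac nd.2 - tofrac nd.1 * tofrac (D0 nd.2)) / tofrac nd.2 ^+ 2.

Lemma frac_derE p q : q != 0 -> frac_der (tofrac p / tofrac q) =
  (tofrac (D0 p) * tofrac q - tofrac p * tofrac (D0 q)) / tofrac q ^+ 2.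
Proof.
move=> q0; rewrite /frac_der; set nd := xchoose _.
have /andP[d0 /eqP E] := xchooseP (fraction_split (tofrac p / tofrac q)).
rewrite -/nd in d0 E; move: nd d0 E => [n e] /= e0 E.
have te : tofrac e != 0 by rewrite tofrac_eq0.
have tq : tofrac q != 0 by rewrite tofrac_eq0.
have cr : p * e = n * q.
  apply/eqP; rewrite -tofrac_eq !rmorphM /=; apply/eqP.
  have := congr1 (fun z => z * tofrac q * tofrac e) E; rewrite divfK // => ->.
  by rewrite mulrAC divfK.
have dcr : D0 p * e + p * D0 e = D0 n * q + n * D0 q by rewrite -!D0M cr.
move/(congr1 tofrac): dcr; rewrite !rmorphD !rmorphM /= => dcr.
move/(congr1 tofrac): cr; rewrite !rmorphM /= => cr.
exact: quotient_rule_eq.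
Qed.

Lemma frac_der_tofrac p : frac_der (tofrac p) = tofrac (D0 p).
Proof.
have D01 : D0 1 = 0.
  by apply: (addrI (D0 1)); rewrite addr0 -{3}[1](mulr1 1) D0M mulr1 mul1r.
have := frac_derE p (oner_neq0 R); rewrite D01 rmorph0 rmorph1 expr1n !divr1 mulr0 subr0 mulr1.
by [].
Qed.

Lemma frac_der_derivation : derivation frac_der.
Proof.
split=> x y; have [[p q] /= /andP[q0 /eqP ->]] := fraction_split x;
  have [[r s] /= /andP[s0 /eqP ->]] := fraction_split y;
  have tq : tofrac q != 0 by [rewrite tofrac_eq0 | rewrite tofrac_eq0];
  have ts : tofrac s != 0 by [rewrite tofrac_eq0 | rewrite tofrac_eq0].
  rewrite addf_div // -!rmorphM -rmorphD /= !frac_derE ?mulf_neq0 // !(D0D, D0M) !(rmorphD, rmorphM) /=.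
  exact: quotient_rule_add.
rewrite mulf_div -!rmorphM /= !frac_derE ?mulf_neq0 // !D0M !rmorphD !rmorphM /=.
exact: quotient_rule_mul.
Qed.

End FractionDerivation.

Section GenericField.
Variables (n d : nat).

Definition entry := ('I_d.+1 * 'I_n)%type.
Definition coef_ring : idomainType := {mpoly 'F_2[#|{: entry}|]}.
Definition coef_field : fieldType := {fraction coef_ring}.

Definition F2_embed : {rmorphism 'F_2 -> coef_field} :=
  @FracField.tofrac coef_ring \o @mpolyC #|{: entry}| 'F_2.

(** [inord] makes this faithful for rows r <= d only, whence the bounds in [generic_der_coef]. *)
Definition entry_index r w : 'I_#|{: entry}| := enum_rank ((inord r, w) : entry).
Definition generic_coef r w : coef_field := FracField.tofrac 'X_(entry_index r w).
Definition generic_der s u : coef_field -> coef_field :=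
  frac_der (mderiv (entry_index s u)).

Lemma generic_derP s u : derivation (generic_der s u).
Proof. apply: frac_der_derivation => p q; [exact: mderivD | exact: mderivM]. Qed.

Lemma generic_der_coef s u r w : (s <= d)%N -> (r <= d)%N ->
  generic_der s u (generic_coef r w) = ((s == r) && (u == w))%:R.
Proof.
move=> sd rd; rewrite /generic_der frac_der_tofrac; last exact: mderivM.
rewrite mderivX mnm1E (inj_eq enum_rank_inj) xpair_eqE -(inj_eq val_inj) /= !inordK ?ltnS //.
rewrite (eq_sym r) (eq_sym w); case: (boolP ((s == r) && (u == w))) => [/andP[/eqP -> /eqP ->]|_]; last by rewrite scale0r rmorph0.
rewrite (_ : (U_(_) - U_(_))%MM = 0%MM); last by apply/mnmP=> x; rewrite mnmBE mnm0E subnn.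
by rewrite mpolyX0 scale1r rmorph1.
Qed.

End GenericField.

(** The derivative of the (k+1)-minor by its lower right entry is the k-minor, nonzero by induction;
    the derivative of 0 would be 0. *)
Lemma derivation_generic (K : fieldType) n d (a : nat -> 'I_n -> K) (der : nat -> 'I_n -> K -> K) :
  (forall s u, derivation (der s u)) ->
  (forall s u r w, (s <= d)%N -> (r <= d)%N -> der s u (a r w) = ((s == r) && (u == w))%:R) ->
  generic a d.+1.
Proof.
move=> derP der_a k; elim: k => [|k IH] e kd ei.
  by rewrite det_mx00 oner_neq0.
pose M := \matrix_(i < k.+1, j < k.+1) a i (e j).
have DM r c : der k (e ord_max) (M r c) = ((r == ord_max) && (c == ord_max))%:R.
  rewrite mxE der_a //; last by rewrite -ltnS (leq_trans (ltn_ord r)).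
  by rewrite (inj_eq ei) [k == r]eq_sym [_ == c]eq_sym.
have H := deriv_det_cofactor (derP k (e ord_max)) DM.
apply: contraTneq (IH (fun j => e (lift ord_max j)) (ltnW kd) _) => [det0|]; last by move=> j j' /ei/lift_inj.
move: H; rewrite /M det0 (deriv_0 (derP _ _)) /cofactor => /esym/eqP.
rewrite mulf_eq0 signr_eq0 /= negbK => /eqP h; apply/eqP; rewrite -[RHS]h.
by congr (\det _); apply/matrixP=> r c; rewrite !mxE /= /bump leqNgt ltn_ord add0n.
Qed.

(** * Relabelling the vertices *)

Section Transport.
Variables (V V' : finType) (f : V -> V').
Hypothesis fbij : bijective f.
Variable D : {set {set V}}.

Let fi : injective f := bij_inj fbij.
Local Notation F := (fun x : {set V} => f @: x).
Definition push_complex : {set {set V'}} := [set F x | x in D].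
Local Notation D' := push_complex.

Lemma push_inj : injective F. Proof. exact: imset_inj. Qed.

Lemma push_surj (y : {set V'}) : exists x, y = F x.
Proof.
exists (f @^-1: y); apply/setP=> w; have [g fg gf] := fbij.
by rewrite -(gf w) mem_imset // inE.
Qed.

Lemma pushK (x : {set V}) : f @^-1: (f @: x) = x.
Proof. by apply/setP=> w; rewrite inE mem_imset. Qed.

Lemma push_bij : bijective F.
Proof.
exists (fun y : {set V'} => f @^-1: y) => [x|y]; first exact: pushK.
by have [x ->] := push_surj y; rewrite pushK.
Qed.

Lemma mem_push x : (F x \in D') = (x \in D).
Proof. by rewrite mem_imset //; apply: push_inj. Qed.

Lemma card_push (x : {set V}) : #|F x| = #|x|. Proof. exact: card_imset. Qed.

Lemma push_sub x y : (F x \subset F y) = (x \subset y).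
Proof.
apply/idP/idP=> [h|]; last exact: imsetS.
by apply/subsetP=> w wx; have := subsetP h (f w); rewrite !mem_imset //; apply.
Qed.

Lemma sum_push (R : nmodType) (P : pred {set V'}) (c : {set V'} -> R) :
  \sum_(y | P y) c y = \sum_(x | P (F x)) c (F x).
Proof. by apply: reindex; apply: onW_bij; apply: push_bij. Qed.

(** Transporting these facts, all sums and cardinalities over faces, avoids relabelling boundary
    matrices and Betti numbers. *)
Lemma push_sphere_facts (K : fieldType) d : sphere_facts K d D -> sphere_facts K d D'.
Proof.
move=> S; split.
- by rewrite -(imset0 f) mem_push (sf_empty S).
- move=> s t; have [x ->] := push_surj s; have [y ->] := push_surj t.
  by rewrite !mem_push push_sub; apply: (sf_down S).
- by move=> s; have [x ->] := push_surj s; rewrite mem_push card_push; apply: (sf_card S).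
- move=> s; have [x ->] := push_surj s; rewrite mem_push => /(sf_facet S)[G [GD sG cG]].
  by exists (F G); rewrite mem_push push_sub card_push.
- move=> t q c; have [x ->] := push_surj t; rewrite mem_push card_push => xD xq cyc.
  have [|h hE] := sf_exact S (c := fun z => c (F z)) xD xq.
    move=> y yD xy cy; have := cyc (F y); rewrite mem_push push_sub card_push => /(_ yD xy cy).
    rewrite sum_push => E; rewrite -[RHS]E; apply: eq_bigl => z.
    by rewrite mem_push push_sub card_push.
  exists (fun y : {set V'} => h (f @^-1: y)) => y; have [z ->] := push_surj y.
  rewrite mem_push push_sub card_push => zD xz cz; rewrite hE // sum_push; apply: eq_big => [w|w _].
    by rewrite mem_push push_sub card_push.
  by rewrite pushK.
- move=> t c; have [x ->] := push_surj t; rewrite mem_push => xD cyc.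
  have [|h hE] := sf_top S (c := fun z => c (F z)) xD.
    move=> y yD xy cy; have := cyc (F y); rewrite mem_push push_sub card_push => /(_ yD xy cy).
    rewrite sum_push => E; rewrite -[RHS]E; apply: eq_bigl => z.
    by rewrite mem_push push_sub card_push.
  exists h => y; have [z ->] := push_surj y.
  by rewrite mem_push push_sub card_push; apply: hE.
- move=> t; have [x ->] := push_surj t; rewrite mem_push => xD.
  rewrite -(sf_euler S xD) sum_push; apply: eq_big => [z|z _]; first by rewrite mem_push push_sub.
  by rewrite card_push.
move=> t; have [x ->] := push_surj t; rewrite mem_push card_push => xD cx.
rewrite -(sf_ridge S xD cx) -(card_imset _ push_inj); apply: eq_card => y.
have [z ->] := push_surj y; rewrite (mem_imset _ _ push_inj) !inE mem_push push_sub card_push.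
by [].
Qed.

Lemma push_gnum d k : gnum d D' k = gnum d D k.
Proof.
have E : hpoly d D' = hpoly d D.
  apply: eq_bigr => m _; congr (_ *+ _); rewrite -(card_imset _ push_inj); apply: eq_card => y.
  by have [z ->] := push_surj y; rewrite (mem_imset _ _ push_inj) !inE mem_push card_push.
by case: k => //= k; rewrite /hnum E.
Qed.

Lemma push_independent A : independent D A -> independent D' (F A).
Proof.
have im1 v : [set f v] = F [set v] by rewrite imset_set1.
have im2 u v : [set f u; f v] = F [set u; v] by rewrite imsetU !imset_set1.
case/andP=> /subsetP AD /forall_inP Aind; apply/andP; split.
  by apply/subsetP=> _ /imsetP[v /AD vD ->]; rewrite inE im1 mem_push; rewrite inE in vD.
apply/forall_inP=> _ /imsetP[u uA ->]; apply/forall_inP=> _ /imsetP[v vA ->].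
have /forall_inP/(_ v vA) := Aind u uA.
by rewrite /adjacent im2 mem_push (inj_eq fi).
Qed.

Lemma push_nonfaces N : nonfaces_bounded D N -> nonfaces_bounded D' N.
Proof.
move=> h G; have [x ->] := push_surj G; rewrite mem_push card_push => xD pr.
apply: h => // y yx; rewrite -mem_push; apply: pr.
by rewrite properE !push_sub -properE.
Qed.

End Transport.

Lemma missing_nonfaces_bounded (V : finType) (D : {set {set V}}) N : (0 < N)%N ->
  (forall s, missing_face D s -> (#|s| <= N)%N) -> nonfaces_bounded D N.
Proof.
move=> N0 h G GD pr; have [c1|c1] := leqP #|G| 1; first exact: leq_trans c1 N0.
apply: h; split=> //; apply/subsetP=> v vG; rewrite inE; apply: pr.
by rewrite properEcard sub1set vG cards1.
Qed.

Local Close Scope ring_scope.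

Theorem theorem5p3 (V : finType) (d i j : nat) (Delta : {set {set V}})
  (hi : 2 <= i) (hid : 3 * i <= d)
  (hj : j = minn ((d - 1) %/ 2 - 1) (d - 2 * i))
  (hDelta : sphere_class j d Delta) :
  ((2 * independence_number Delta)%:Z <= gnum d Delta i)%R.
Proof.
case: d hid hj hDelta => [|d'] hid hj hDelta; first by lia.
have [sphD mfD] := hDelta.
have D0 : set0 \in Delta by case: sphD => -[].
(* A facet has d > 0 elements, so the relabelled vertex type is some ['I_n'.+1], whose [ord0] serves
   as default vertex. *)
have V0 : 0 < #|V|.
  have [s ms _] := maxset_exists (P := fun s => s \in Delta) D0.
  have [_ /(_ s ms) cs _] := sphD.
  by apply: leq_trans (max_card (mem s)); rewrite cs.
have Vn : #|V| = #|V|.-1.+1 by rewrite prednK.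
pose n' := #|V|.-1; pose f (v : V) : 'I_n'.+1 := cast_ord Vn (enum_rank v).
have fbij : bijective f.
  exists (fun k => enum_val (cast_ord (esym Vn) k)) => k.
    by rewrite /f cast_ordK enum_rankK.
  by rewrite /f enum_valK cast_ordKV.
have [|A indA cA] := @eq_bigmax_cond _ (independent Delta) (fun A : {set V} => #|A|).
  apply/card_gt0P; exists set0; rewrite unfold_in /independent sub0set.
  by apply/forall_inP => u; rewrite inE.
have {}cA : independence_number Delta = #|A| by rewrite -cA.
have derP := @generic_derP n'.+1 d'.+1; have der_a := @generic_der_coef n'.+1 d'.+1.
rewrite cA -(card_push fbij A) -(push_gnum fbij Delta).
(* With N = j+1, the bound j <= d - 2i gives N + 2i <= d + 1, and the other bound on j gives 2(N-1)
   < d - 1. *)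
apply: (independent_gnum (push_sphere_facts fbij (sphere_factsP sphD (F2_embed n'.+1 d'.+1)))
  (F2_pchar (F2_embed n'.+1 d'.+1)) (derivation_generic derP der_a) derP der_a hi hid (N := j.+1)).
- by apply: (push_nonfaces fbij); apply: missing_nonfaces_bounded.
- by rewrite hj; lia.
- by rewrite hj; lia.
exact: push_independent.
Qed.
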